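(* Let $\lambda_1,\dots,\lambda_n$ be distinct points in $\mathbb H_{1/2}$ and $w_1,\dots,w_n\in\mathbb D$. Suppose there exists $\varphi\in H^\infty(\mathbb H_0)\cap\mathcal D$ with $\|\varphi\|_\infty\le1$ and $\varphi(\lambda_j)=w_j$ for $j=1,\dots,n$. Then: (i) the matrix $[(1-\overline{w_i}w_j)\zeta(\overline{\lambda_i}+\lambda_j)]_{i,j=1}^n$ is positive semi-definite; (ii) the matrix $\Big[\frac{1-\overline{w_i}w_j}{\overline{\lambda_i}+\lambda_j}\Big]_{i,j=1}^n$ is positive semi-definite and has rank equal to $n$.
   Context: $\mathbb H_\delta=\{s\in\mathbb C:\operatorname{Re}s>\delta\}$; $\mathbb D$ is the open unit disc; $\zeta$ is the Riemann zeta function. $H^\infty(\mathbb H_0)$ is the space of bounded holomorphic functions on $\mathbb H_0$ with sup norm $\|\cdot\|_\infty$. $\mathcal D$ denotes the set of functions representable by a convergent Dirichlet series $\sum_n a_n n^{-s}$ in some right half-plane. *)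

(* Defs.v *)
(* MathComp + MathComp-Analysis, complex numbers are R[i] = complex R
   (mathcomp-real-closed) over an arbitrary R : realType. *)
From HB Require Import structures.
From mathcomp Require Import all_boot all_order all_algebra.
From mathcomp Require Import all_classical all_reals all_analysis.
From mathcomp Require Import complex.
Set Implicit Arguments. Unset Strict Implicit. Unset Printing Implicit Defensive.
Import Order.TTheory GRing.Theory Num.Theory.
Import numFieldTopology.Exports numFieldNormedType.Exports.
Local Open Scope ring_scope.
Local Open Scope complex_scope.
Local Open Scope classical_set_scope.

Section Defs.
Variable R : realType.

(* n^{-s} = exp(-s log n) for n >= 1 and s complex, written out via
   exp(-s log n) = e^{-Re s log n} (cos (Im s log n) - i sin (Im s log n)). *)
Definition nat_cpowN (n : nat) (s : R[i]) : R[i] :=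
  let r : R := (expR (- complex.Re s * ln (n%:R : R)))%R in
  let t : R := (complex.Im s * ln (n%:R : R))%R in
  ((r * cos t)%R +i* (- (r * sin t))%R)%C.

(* Riemann zeta function, given by its Dirichlet series sum_{n>=1} n^{-s};
   this is the definition of zeta on Re s > 1, the only region where it is used. *)
Definition zeta (s : R[i]) : R[i] :=
  lim (series (fun k : nat => (nat_cpowN k.+1 s : R[i]^o)) @ \oo).

(* H_delta = { s | Re s > delta } *)
Definition halfplane (delta : R) : set R[i] := [set s | (delta < complex.Re s)%R].

(* phi is holomorphic (complex differentiable) at every point of H_0 *)
Definition holomorphic_on (U : set R[i]) (phi : R[i] -> R[i]) : Prop :=
  forall z, U z -> derivable (phi : R[i]^o -> R[i]^o) z 1.

(* phi belongs to H^infty(H_0) with ||phi||_infty <= 1 *)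
Definition Hinf_unit_ball (phi : R[i] -> R[i]) : Prop :=
  holomorphic_on (halfplane 0) phi /\
  (forall z, halfplane 0 z -> `|phi z| <= 1).

(* phi belongs to the class D: it is represented, on some right half-plane,
   by a convergent Dirichlet series sum_{n>=1} a_n n^{-s}. *)
Definition dirichlet_rep (phi : R[i] -> R[i]) : Prop :=
  exists (a : nat -> R[i]) (sigma : R),
    forall s, halfplane sigma s ->
      series (fun k : nat => (a k.+1 * nat_cpowN k.+1 s : R[i]^o)) @ \oo
        --> (phi s : R[i]^o).

(* positive semi-definite complex matrix: v^* M v >= 0 for all v *)
Definition psd_mx (n : nat) (M : 'M[R[i]]_n) : Prop :=
  forall v : 'cV[R[i]]_n, 0 <= ((map_mx (fun x => x^*) v)^T *m M *m v) 0 0.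

End Defs.

(* Main.v *)
Require Import Defs.
From HB Require Import structures.
From mathcomp Require Import all_boot all_order all_algebra.
From mathcomp Require Import all_classical all_reals all_analysis.
From mathcomp Require Import complex.
From mathcomp Require Import ring lra.
Import Order.TTheory GRing.Theory Num.Theory.
Import numFieldTopology.Exports numFieldNormedType.Exports.
Local Open Scope ring_scope.
Local Open Scope complex_scope.
Local Open Scope classical_set_scope.

(* The multiplier phi acts contractively on two kernel spaces.

   On the half-plane Re s > 0, the Schur algorithm (subtract a value by a Moebius map, divide
   by a Blaschke factor, apply the maximum principle) shows that the Pick form with kernel
   1 / (conj x + y) is nonnegative at any finite set of points. If it had a null vector v at
   the lambda_j, then v would stay null against the kernel at every further point x, so that
   sum_j conj(v_j) (1 - phi(x) conj(w_j)) / (x + conj(lambda_j)) = 0 for large real x. As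
   phi(x) - a_1 decays exponentially, this forces v_j (1 - conj(a_1) w_j) = 0, hence v = 0.

   For the zeta kernel, let f = sum_m b_m m^-s and Q = sum_n e_n n^s be finite sums. Suitable
   finite averages of phi f Q over vertical translates tend to sum_(k m = n) a_k b_m e_n at
   +oo, and near Re s = 0 they are at most (sum |b_m|^2 + sum |e_n|^2) / 2, because the
   averages kill all cross terms of |f|^2 and |Q|^2. By the maximum principle the truncated
   matrix of multiplication by phi is a contraction. The maximum principle applied to
   (phi - S_K) K^s also shows that the partial sums S_K converge to phi on Re s > 1/2, so that
   the adjoint matrix acts on (n^-lambda_j)_n as multiplication by w_j.

   The maximum principle comes from Goursat's theorem on rectangles. *)

Set Implicit Arguments.
Unset Strict Implicit.
Unset Printing Implicit Defensive.

(** Nothing is known about [phi] on Re s = 0, and its series is only given to converge far to the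
    right. Estimates are therefore made on lines Re s = c with c > 0, at a cost that disappears as c
    tends to 0, while the series itself serves only for the behaviour at +oo. The bound 1/2 enters
    twice: the zeta kernel needs Re (conj x + y) > 1, and contractivity yields |a_1| + ... + |a_K|
    <= sqrt K, so that phi - S_K is of order K^(1/2 - Re s). Quotients are never extended across
    removable singularities; the maximum principle tolerates a finite exceptional set instead. It
    rests on a Cauchy estimate with an unspecified constant, so no contour integral has to be
    evaluated or bounded sharply. Truncating all sums at N leaves finitely many frequencies log (n /
    (k m)), which finitely many vertical shifts annihilate exactly; no limiting mean value is
    needed. *)

Local Notation Re := complex.Re.
Local Notation Im := complex.Im.
Local Notation normc := ComplexField.Normc.normc.

(** * Complex modulus and complex differentiability *)

Section Norm.
Variable R : realType.
Local Notation C := R[i].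
(* Inside products [x ^*] would otherwise be parsed as [Num.conj x]. *)
Local Notation "x ^*" := (conjc x) : ring_scope.
Implicit Types (x y z : C).

Lemma normE x : `|x| = (normc x)%:C.
Proof. by rewrite normc_def; case: x. Qed.

Lemma normc_ge0 x : 0 <= normc x.
Proof. by rewrite -lecR -normE normr_ge0. Qed.

Lemma normc_eq0 x : (normc x == 0) = (x == 0).
Proof.
apply/eqP/eqP => [|->]; first exact: ComplexField.Normc.eq0_normc.
exact: ComplexField.Normc.normc0.
Qed.

Lemma normc_gt0 x : (0 < normc x) = (x != 0).
Proof. by rewrite lt_def normc_ge0 andbT normc_eq0. Qed.

Lemma normcD x y : normc (x + y) <= normc x + normc y.
Proof. exact: le_normcD. Qed.

Lemma normcM x y : normc (x * y) = normc x * normc y.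
Proof. exact: ComplexField.Normc.normcM. Qed.

Lemma normcV x : normc x^-1 = (normc x)^-1.
Proof. exact: ComplexField.Normc.normcV. Qed.

Lemma normcf_div x y : normc (x / y) = normc x / normc y.
Proof. by rewrite normcM normcV. Qed.

Lemma normcR (r : R) : normc r%:C = `|r|.
Proof. by rewrite /= expr0n addr0 sqrtr_sqr. Qed.

Lemma normcX x n : normc (x ^+ n) = normc x ^+ n.
Proof.
elim: n => [|n IH]; first by rewrite !expr0 ComplexField.Normc.normc1.
by rewrite !exprS normcM IH.
Qed.

Lemma normcN x : normc (- x) = normc x.
Proof. exact: (@normcN R x). Qed.

Lemma normcB x y : normc (x - y) = normc (y - x).
Proof. by rewrite -normcN opprB. Qed.

Lemma normc_leB x y : normc (x - y) <= normc x + normc y.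
Proof. by rewrite -(normcN y) normcD. Qed.

Lemma normc_distl x y : normc x - normc y <= normc (x - y).
Proof. by rewrite lerBlDr -{1}(subrK y x) normcD. Qed.

Lemma normc_conj x : normc x^* = normc x.
Proof. by case: x => a b /=; rewrite sqrrN. Qed.

Lemma normc_sqr x : normc x ^+ 2 = Re x ^+ 2 + Im x ^+ 2.
Proof. by case: x => a b /=; rewrite sqr_sqrtr // addr_ge0 // sqr_ge0. Qed.

Lemma normc_ge_Re x : `|Re x| <= normc x.
Proof.
rewrite -(@ler_pXn2r _ 2) ?nnegrE ?normc_ge0 ?normr_ge0 // normc_sqr.
by rewrite -normrX ger0_norm ?sqr_ge0 // lerDl sqr_ge0.
Qed.

Lemma normc_ge_Im x : `|Im x| <= normc x.
Proof.
rewrite -(@ler_pXn2r _ 2) ?nnegrE ?normc_ge0 ?normr_ge0 // normc_sqr.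
by rewrite -normrX ger0_norm ?sqr_ge0 // lerDr sqr_ge0.
Qed.

Lemma normc_le_ReIm x : normc x <= `|Re x| + `|Im x|.
Proof.
rewrite -(@ler_pXn2r _ 2) ?nnegrE ?normc_ge0 ?addr_ge0 ?normr_ge0 // normc_sqr.
rewrite sqrrD !real_normK ?num_real // lerD2r lerDl.
by rewrite mulrn_wge0 ?mulr_ge0.
Qed.

Lemma normc_sum (I : Type) (r : seq I) (P : pred I) (F : I -> C) :
  normc (\sum_(i <- r | P i) F i) <= \sum_(i <- r | P i) normc (F i).
Proof.
elim/big_rec2: _ => [|i y x _ IH]; first by rewrite ComplexField.Normc.normc0.
by apply: (le_trans (normcD _ _)); rewrite lerD2l.
Qed.

Lemma normc_prod (I : Type) (r : seq I) (P : pred I) (F : I -> C) :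
  normc (\prod_(i <- r | P i) F i) = \prod_(i <- r | P i) normc (F i).
Proof.
elim/big_rec2: _ => [|i y x _ IH]; first by rewrite ComplexField.Normc.normc1.
by rewrite normcM IH.
Qed.

Lemma Re_sum (I : Type) (r : seq I) (P : pred I) (F : I -> C) :
  Re (\sum_(i <- r | P i) F i) = \sum_(i <- r | P i) Re (F i).
Proof. by elim/big_rec2: _ => [//|i y x _ <-]; case: (F i) x => [a b] []. Qed.

Lemma mulcJ x : x^* * x = (normc x ^+ 2)%:C.
Proof.
rewrite normc_sqr; case: x => a b; apply/eqP.
rewrite eq_complex /=; apply/andP; split; apply/eqP; ring.
Qed.

Lemma conjcD x y : (x + y)^* = x^* + y^*.
Proof. exact: (rmorphD conjc). Qed.

Lemma conjcB x y : (x - y)^* = x^* - y^*.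
Proof. exact: (rmorphB conjc). Qed.

Lemma conjcM x y : (x * y)^* = x^* * y^*.
Proof. exact: (rmorphM conjc). Qed.

Lemma conjcf_div x y : (x / y)^* = x^* / y^*.
Proof. exact: (fmorph_div conjc). Qed.

Lemma conjc_sum (I : Type) (r : seq I) (P : pred I) (F : I -> C) :
  (\sum_(i <- r | P i) F i)^* = \sum_(i <- r | P i) (F i)^*.
Proof. exact: (rmorph_sum conjc). Qed.

Lemma gt0c x : 0 < x -> x = (Re x)%:C /\ 0 < Re x.
Proof. by case: x => a b; rewrite ltcE /= => /andP[/eqP -> ->]. Qed.

Lemma ge0c x : (0 <= x) = (Im x == 0) && (0 <= Re x).
Proof. by rewrite lecE. Qed.

End Norm.

#[local] Arguments ComplexField.Normc.normc : simpl never.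

Section Cdiff.
Variable R : realType.
Local Notation C := R[i].
Local Notation "x ^*" := (conjc x) : ring_scope.
Implicit Types (f g : C -> C) (z : C).

(* A wrapper, so that unification does not unfold [derivable]. *)
Variant cdiff f z : Prop := Cdiff of derivable (f : C^o -> C^o) z 1.

(** The norm of [R[i]] is itself complex valued, so the epsilons of the library are complex; by
    [gt0c] a positive one is real. Multiplying the difference quotient by h also makes the case h =
    0 harmless. *)
Lemma cdiffP f z : cdiff f z <-> exists d : C, forall e : R, 0 < e ->
  exists2 del : R, 0 < del & forall h, normc h < del ->
    normc (f (z + h) - f z - d * h) <= e * normc h.
Proof.
split.
  move=> [/cvg_ex[d /cvgrPdist_le H]]; exists d => e e0.
  have e0' : (0 : C) < e%:C by rewrite ltcR.
  have := H _ e0'; rewrite near_withinE => /nbhs_normP[del /= del0 Hd].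
  have [delE delr] := gt0c del0.
  exists (Re del) => // h hdel.
  have [->|h0] := eqVneq h 0.
    by rewrite addr0 mulr0 subr0 subrr ComplexField.Normc.normc0 mulr0.
  have := Hd h; rewrite /ball_ /= sub0r normrN normE delE ltcR => /(_ hdel h0).
  rewrite normE lecR /= => Hh.
  have -> : f (z + h) - f z - d * h = - (h * (d - h^-1 *: (f (h *: 1 + z) - f z : C^o))).
    have -> : h^-1 *: (f (h *: 1 + z) - f z : C^o) = h^-1 * (f (z + h) - f z).
      by rewrite /GRing.scale /= mulr1 (addrC h).
    by rewrite mulrBr mulrA mulfV // mul1r opprB mulrC.
  by rewrite normcN normcM mulrC ler_wpM2r // normc_ge0.
case=> d H; split; apply/cvg_ex; exists d; apply/cvgrPdist_le => e /gt0c[-> e0].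
rewrite near_withinE; apply/nbhs_normP.
have [del del0 Hd] := H _ e0.
exists del%:C; first by rewrite /= ltcR.
move=> h; rewrite /ball_ /= sub0r normrN normE ltcR => hdel h0.
rewrite normE lecR /=.
have -> : h^-1 *: (f (h *: 1 + z) - f z : C^o) = h^-1 * (f (z + h) - f z).
  by rewrite /GRing.scale /= mulr1 (addrC h).
have nh : 0 < normc h by rewrite normc_gt0.
rewrite -(ler_pM2l nh) -normcM mulrBr mulrA mulfV // mul1r (mulrC (normc h)).
rewrite (mulrC h) normcB; exact: Hd.
Qed.

Lemma cdiff_cst (c : C) z : cdiff (fun=> c) z.
Proof. by split; exact: derivable_cst. Qed.

Lemma cdiff_id z : cdiff id z.
Proof. by split; exact: derivable_id. Qed.

Lemma cdiffD f g z : cdiff f z -> cdiff g z -> cdiff (fun w => f w + g w) z.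
Proof. by move=> [hf] [hg]; split; exact: derivableD hf hg. Qed.

Lemma cdiffB f g z : cdiff f z -> cdiff g z -> cdiff (fun w => f w - g w) z.
Proof. by move=> [hf] [hg]; split; exact: derivableB hf hg. Qed.

Lemma cdiffM f g z : cdiff f z -> cdiff g z -> cdiff (fun w => f w * g w) z.
Proof. by move=> [hf] [hg]; split; exact: derivableM hf hg. Qed.

Lemma cdiffV f z : f z != 0 -> cdiff f z -> cdiff (fun w => (f w)^-1) z.
Proof. by move=> f0 [hf]; split; exact: derivableV f0 hf. Qed.

Lemma cdiff_div f g z :
  g z != 0 -> cdiff f z -> cdiff g z -> cdiff (fun w => f w / g w) z.
Proof. move=> g0 hf hg; exact: (cdiffM hf (cdiffV g0 hg)). Qed.

Lemma cdiff_inv_sub (c z : C) : z - c != 0 -> cdiff (fun w => (w - c)^-1) z.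
Proof.
move=> h; apply: (@cdiffV (fun w => w - c)); first exact: h.
exact: (cdiffB (cdiff_id z) (cdiff_cst c z)).
Qed.

Lemma cdiffX f n z : cdiff f z -> cdiff (fun w => f w ^+ n) z.
Proof.
move=> hf; elim: n => [|n IH]; first exact: cdiff_cst.
have -> : (fun w => f w ^+ n.+1) = (fun w => f w * f w ^+ n).
  by apply/funext => w; rewrite exprS.
exact: (cdiffM hf IH).
Qed.

Lemma cdiff_sum (I : Type) (r : seq I) (F : I -> C -> C) z :
  (forall i, cdiff (F i) z) -> cdiff (fun w => \sum_(i <- r) F i w) z.
Proof.
move=> hF; elim: r => [|i r IH].
  by under eq_fun do rewrite big_nil; exact: cdiff_cst.
by under eq_fun do rewrite big_cons; exact: (cdiffD (hF i) IH).
Qed.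

Lemma cdiff_prod (I : Type) (r : seq I) (F : I -> C -> C) z :
  (forall i, cdiff (F i) z) -> cdiff (fun w => \prod_(i <- r) F i w) z.
Proof.
move=> hF; elim: r => [|i r IH].
  by under eq_fun do rewrite big_nil; exact: cdiff_cst.
by under eq_fun do rewrite big_cons; exact: (cdiffM (hF i) IH).
Qed.

Lemma cdiff_affine f (a b : C) z :
  cdiff f (a * z + b) -> cdiff (fun w => f (a * w + b)) z.
Proof.
have [->|a0] := eqVneq a 0.
  move=> _; have -> : (fun w => f (0 * w + b)) = (fun=> f b).
    by apply/funext => w; rewrite mul0r add0r.
  exact: cdiff_cst.
have na : 0 < normc a by rewrite normc_gt0.
move=> /cdiffP[d H]; apply/cdiffP; exists (d * a) => e e0.
have [del del0 Hd] := H (e / normc a) (divr_gt0 e0 na).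
exists (del / normc a); first exact: divr_gt0.
move=> h; rewrite ltr_pdivlMr // mulrC -normcM => /Hd.
rewrite normcM (mulrA _ (normc a)) divfK ?gt_eqF // (mulrA d).
by rewrite (_ : a * (z + h) + b = a * z + b + a * h); last by ring.
Qed.

Lemma cdiff_cont f z : cdiff f z -> forall e : R, 0 < e ->
  exists2 del : R, 0 < del & forall h, normc h < del -> normc (f (z + h) - f z) <= e.
Proof.
move=> /cdiffP[d H] e e0; have [del del0 Hd] := H 1 ltr01.
have d1 : 0 < 1 + normc d by rewrite ltr_wpDr // normc_ge0.
exists (Num.min del (e / (1 + normc d))).
  by rewrite lt_min del0 divr_gt0.
move=> h; rewrite lt_min => /andP[h1]; rewrite ltr_pdivlMr // => h2.
have -> : f (z + h) - f z = (f (z + h) - f z - d * h) + d * h by ring.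
apply: (le_trans (normcD _ _)); rewrite normcM.
have := Hd h h1; lra.
Qed.

End Cdiff.

(** * The complex exponential *)

Section Cexp.
Variable R : realType.
Local Notation C := R[i].
Local Notation "x ^*" := (conjc x) : ring_scope.
Implicit Types (z w : C).

Definition cexp z : C := (expR (Re z) * cos (Im z)) +i* (expR (Re z) * sin (Im z)).

Lemma cexpD z w : cexp (z + w) = cexp z * cexp w.
Proof.
case: z w => [a b] [c d]; rewrite /cexp /= expRD cosD sinD; apply/eqP.
by rewrite eq_complex /=; apply/andP; split; apply/eqP; ring.
Qed.

Lemma cexp0 : cexp 0 = 1.
Proof. by rewrite /cexp /= expR0 cos0 sin0 mulr1 mulr0. Qed.

Lemma normc_cexp z : normc (cexp z) = expR (Re z).
Proof.
rewrite /cexp /ComplexField.Normc.normc /= !exprMn -mulrDr cos2Dsin2 mulr1 sqrtr_sqr ger0_norm //.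
Qed.

Lemma cexp_conj z : (cexp z)^* = cexp z^*.
Proof. by case: z => a b; rewrite /cexp /= cosN sinN mulrN. Qed.

Lemma derive_eps (f : R -> R) (df : R) : is_derive (0 : R^o) 1 (f : R^o -> R^o) df ->
  forall e : R, 0 < e -> exists2 del : R, 0 < del & forall h : R, `|h| < del ->
    `|f h - f 0 - df * h| <= e * `|h|.
Proof.
move=> [dv dE] e e0.
have : h^-1 *: ((f \o shift 0) (h *: (1:R^o)) - f 0 : R^o) @[h --> (0:R)^'] --> (df : R^o).
  by rewrite -dE; exact: dv.
move=> /cvgrPdist_le/(_ _ e0); rewrite near_withinE => /nbhs_normP[del /= del0 Hd].
exists del => // h hdel.
have [->|h0] := eqVneq h 0; first by rewrite subrr mulr0 subr0 normr0 mulr0.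
have := Hd h; rewrite /ball_ /= sub0r normrN => /(_ hdel h0) Hh.
have -> : f h - f 0 - df * h = - (h * (df - h^-1 *: (f (h *: 1 + 0) - f 0 : R^o))).
  have -> : h^-1 *: (f (h *: 1 + 0) - f 0 : R^o) = h^-1 * (f h - f 0).
    by rewrite /GRing.scale /= mulr1 addr0.
  by rewrite mulrBr mulrA mulfV // mul1r opprB mulrC.
by rewrite normrN normrM mulrC ler_wpM2r.
Qed.

Lemma cexp_eps (e : R) : 0 < e -> exists2 del : R, 0 < del &
  forall h, normc h < del -> normc (cexp h - 1 - h) <= e * normc h.
Proof.
move=> e0.
(* The error splits into four terms, bounded by 1, 3, 3 and 2 times e' N with N = |h|; hence 9. The
   bound e' <= 1 gives N <= 1, from which the constants 2 and 3 below follow. *)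
have [e' [e'0 e'1 e'8]] : exists e' : R, [/\ 0 < e', e' <= 1 & e' <= e / 9].
  exists (Num.min 1 (e / 9)).
  by rewrite lt_min ltr01 divr_gt0 // !ge_min !lexx orbT.
have [d1 d10 H1] := derive_eps (is_derive_expR 0) e'0.
have [d2 d20 H2] := derive_eps (is_derive_cos 0) e'0.
have [d3 d30 H3] := derive_eps (is_derive_sin 0) e'0.
exists (Num.min (Num.min d1 d2) (Num.min d3 e')); first by rewrite !lt_min d10 d20 d30 e'0.
move=> h; rewrite !lt_min => /andP[/andP[h1 h2] /andP[h3 h4]].
have [hr hi] := (normc_ge_Re h, normc_ge_Im h).
move: (H1 _ (le_lt_trans hr h1)) (H2 _ (le_lt_trans hi h2)) (H3 _ (le_lt_trans hi h3)).
rewrite expR0 cos0 sin0 oppr0 !mul0r !subr0 !mul1r.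
set u := Re h in hr *; set v := Im h in hi *; set N := normc h in hr hi h1 h2 h3 h4 *.
move=> E1 E2 E3.
have N0 : 0 <= N by rewrite normc_ge0.
have hN8 : N <= 1 by apply: le_trans (ltW h4) e'1.
have B1 : `|expR u - 1 - u| <= e' * N by apply: (le_trans E1); rewrite ler_pM2l.
have B2 : `|cos v - 1| <= e' * N by apply: (le_trans E2); rewrite ler_pM2l.
have B3 : `|sin v - v| <= e' * N by rewrite addr0 in E3; apply: (le_trans E3); rewrite ler_pM2l.
have B1' : `|expR u - 1| <= 2 * N.
  have -> : expR u - 1 = (expR u - 1 - u) + u by ring.
  apply: (le_trans (ler_normD _ _)).
  have : e' * N <= N by rewrite ler_piMl.
  lra.
have B4 : `|expR u| <= 3.
  have -> : expR u = (expR u - 1) + 1 by ring.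
  apply: (le_trans (ler_normD _ _)); rewrite normr1; lra.
apply: (le_trans (normc_le_ReIm _)).
have -> : Re (cexp h - 1 - h) = (expR u - 1 - u) + expR u * (cos v - 1).
  by rewrite /u /v; case: (h) => a b /=; ring.
have -> : Im (cexp h - 1 - h) = expR u * (sin v - v) + (expR u - 1) * v.
  by rewrite /u /v; case: (h) => a b /=; ring.
apply: (le_trans (lerD (ler_normD _ _) (ler_normD _ _))); rewrite !normrM.
have A1 : `|expR u| * `|cos v - 1| <= 3 * (e' * N) by rewrite ler_pM.
have A2 : `|expR u| * `|sin v - v| <= 3 * (e' * N) by rewrite ler_pM.
have A3 : `|expR u - 1| * `|v| <= 2 * N * e'.
  by rewrite ler_pM //; apply: le_trans (ltW h4).
have : e' * N <= e / 9 * N by rewrite ler_wpM2r.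
lra.
Qed.

Lemma cdiff_cexp z : cdiff cexp z.
Proof.
apply/cdiffP; exists (cexp z) => e e0.
have n0 : 0 < normc (cexp z) by rewrite normc_cexp expR_gt0.
have [del del0 H] := cexp_eps (divr_gt0 e0 n0).
exists del => // h /H Hh.
have -> : cexp (z + h) - cexp z - cexp z * h = cexp z * (cexp h - 1 - h).
  by rewrite cexpD; ring.
by rewrite normcM mulrC -ler_pdivlMr // mulrAC.
Qed.

End Cexp.

#[local] Arguments cexp : simpl never.

(** * Goursat's theorem and a Cauchy estimate on rectangles *)

Section SegmentIntegral.
Variable R : realType.
Local Notation C := R[i].
Local Notation "x ^*" := (conjc x) : ring_scope.
Notation mu := (@lebesgue_measure R).
Implicit Types (a b c : R) (g : R -> C) (u : R -> R).

Definition rint u a b : R := \int[mu]_(x in `[a, b]) u x.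

(** The increment h may leave the segment, so this is continuity on the line at the points of
    [a, b]. Functions coming from [cdiff] satisfy it, and no one-sided limits at the ends are
    needed. *)
Definition rcont u a b := forall x, a <= x <= b -> forall e : R, 0 < e ->
  exists2 del : R, 0 < del & forall h, `|h| < del -> `|u (x + h) - u x| <= e.

Lemma rcont_integrable u a b : rcont u a b -> mu.-integrable `[a, b] (EFin \o u).
Proof.
move=> hu; apply: continuous_compact_integrable; first exact: segment_compact.
apply: continuous_in_subspaceT => x; rewrite inE /= in_itv /= => /hu {}hu.
apply/(@cvgrPdist_le R R^o) => e e0; have [del del0 H] := hu _ e0.
apply/nbhs_normP; exists del => //= y; rewrite /ball_ /= distrC => /H.
by rewrite addrCA subrr addr0 distrC.
Qed.

Lemma rint_split u a c b : a <= c -> c <= b -> rcont u a b ->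
  rint u a b = rint u a c + rint u c b.
Proof.
move=> ac cb /rcont_integrable hu.
have icb : mu.-integrable `[c, b] (EFin \o u).
  apply: integrableS hu => //.
  by move=> x /=; rewrite !in_itv /= => /andP[x1 ->]; rewrite (le_trans ac x1).
have := @Rintegral_itvB _ u (BLeft a) (BRight b) c hu.
rewrite !bnd_simp => /(_ ac cb); rewrite /rint.
rewrite Rintegral_itv_obnd_cbnd; last first.
  apply: integrableS icb => //.
  by move=> x /=; rewrite !in_itv /= => /andP[/ltW -> ->].
by move=> /eqP; rewrite subr_eq addrC => /eqP.
Qed.

Lemma rint_cst (k : R) a b : a <= b -> rint (fun=> k) a b = k * (b - a).
Proof.
move=> ab; rewrite /rint Rintegral_cst //= lebesgue_measure_itv /= lte_fin.
by case: (ltgtP a b) ab => // -> _; rewrite subrr.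
Qed.

Lemma rcont_cst (k : R) a b : rcont (fun=> k) a b.
Proof. by move=> x _ e e0; exists 1 => // h _; rewrite subrr normr0 ltW. Qed.

Lemma rcontZ (k : R) u a b : rcont u a b -> rcont (fun x => k * u x) a b.
Proof.
move=> hu x xab e e0; have k0 : 0 < `|k| + 1 by rewrite ltr_wpDl.
have [d d0 H] := hu x xab _ (divr_gt0 e0 k0).
exists d => // h /H; rewrite -mulrBr normrM ler_pdivlMr //.
have := normr_ge0 (u (x + h) - u x); set t := `|u _ - _|.
move=> t0; rewrite mulrDr mulr1 mulrC; lra.
Qed.

Lemma rintB u v a b : rcont u a b -> rcont v a b ->
  rint (fun x => u x - v x) a b = rint u a b - rint v a b.
Proof.
move=> /rcont_integrable hu /rcont_integrable hv.
by rewrite /rint RintegralB.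
Qed.

Lemma rintZ (k : R) u a b : rcont u a b ->
  rint (fun x => k * u x) a b = k * rint u a b.
Proof. by move=> /rcont_integrable hu; rewrite /rint RintegralZl. Qed.

Lemma rint_ge (m : R) u a b : a <= b -> rcont u a b ->
  (forall x, a <= x <= b -> m <= u x) -> m * (b - a) <= rint u a b.
Proof.
move=> ab hu mu_; rewrite -rint_cst // /rint; apply: le_Rintegral => //.
- exact: (rcont_integrable (@rcont_cst m a b)).
- exact: rcont_integrable.
Qed.

Lemma rint_le (m : R) u a b : a <= b -> rcont u a b ->
  (forall x, a <= x <= b -> u x <= m) -> rint u a b <= m * (b - a).
Proof.
move=> ab hu mu_; rewrite -rint_cst // /rint; apply: le_Rintegral => //.
- exact: rcont_integrable.
- exact: (rcont_integrable (@rcont_cst m a b)).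
Qed.

Lemma rint_norm (M : R) u a b : a <= b -> rcont u a b ->
  (forall x, a <= x <= b -> `|u x| <= M) -> `|rint u a b| <= M * (b - a).
Proof.
move=> ab hu hM; rewrite ler_norml -mulNr rint_ge //=.
  by apply: rint_le => // x /hM; rewrite ler_norml => /andP[].
by move=> x /hM; rewrite ler_norml => /andP[].
Qed.

Definition ccont g a b := forall x, a <= x <= b -> forall e : R, 0 < e ->
  exists2 del : R, 0 < del & forall h, `|h| < del -> normc (g (x + h) - g x) <= e.

Definition cint g a b : C := rint (fun x => Re (g x)) a b +i* rint (fun x => Im (g x)) a b.

Lemma ReB (z w : C) : Re (z - w) = Re z - Re w.
Proof. by case: z w => [? ?] []. Qed.

Lemma ImB (z w : C) : Im (z - w) = Im z - Im w.
Proof. by case: z w => [? ?] []. Qed.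

Lemma ccont_Re g a b : ccont g a b -> rcont (fun x => Re (g x)) a b.
Proof.
move=> hg x xab e e0; have [d d0 H] := hg x xab e e0; exists d => // h /H.
by apply: le_trans; rewrite /= -ReB normc_ge_Re.
Qed.

Lemma ccont_Im g a b : ccont g a b -> rcont (fun x => Im (g x)) a b.
Proof.
move=> hg x xab e e0; have [d d0 H] := hg x xab e e0; exists d => // h /H.
by apply: le_trans; rewrite /= -ImB normc_ge_Im.
Qed.

Lemma cint_split g a c b : a <= c -> c <= b -> ccont g a b ->
  cint g a b = cint g a c + cint g c b.
Proof.
move=> ac cb hg; rewrite /cint (rint_split ac cb (ccont_Re hg)).
by rewrite (rint_split ac cb (ccont_Im hg)).
Qed.

Lemma cintB f g a b : ccont f a b -> ccont g a b ->
  cint (fun x => f x - g x) a b = cint f a b - cint g a b.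
Proof.
move=> hf hg; rewrite /cint.
have -> : (fun x => Re (f x - g x)) = (fun x => Re (f x) - Re (g x)).
  by apply/funext => x /=; rewrite ReB.
have -> : (fun x => Im (f x - g x)) = (fun x => Im (f x) - Im (g x)).
  by apply/funext => x /=; rewrite ImB.
by rewrite (rintB (ccont_Re hf) (ccont_Re hg)) (rintB (ccont_Im hf) (ccont_Im hg)).
Qed.

Lemma cintZ (k : C) g a b : ccont g a b ->
  cint (fun x => k * g x) a b = k * cint g a b.
Proof.
move=> hg; have [hr hi] := (ccont_Re hg, ccont_Im hg).
case: k => kr ki; rewrite /cint.
have -> : (fun x => Re ((kr +i* ki) * g x)) =
    (fun x => kr * Re (g x) - ki * Im (g x)).
  by apply/funext => x /=; case: (g x).
have -> : (fun x => Im ((kr +i* ki) * g x)) =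
    (fun x => kr * Im (g x) - (- ki) * Re (g x)).
  by apply/funext => x /=; case: (g x) => ? ? /=; rewrite mulNr opprK.
rewrite (rintB (rcontZ kr hr) (rcontZ ki hi)) (rintB (rcontZ kr hi) (rcontZ (- ki) hr)).
rewrite (rintZ kr hr) (rintZ ki hi) (rintZ kr hi) (rintZ (- ki) hr).
by rewrite mulNr opprK.
Qed.

Lemma cint_cst (k : C) a b : a <= b -> cint (fun=> k) a b = k * (b - a)%:C.
Proof.
move=> ab; rewrite /cint.
rewrite !rint_cst //; case: k => ? ? /=; apply/eqP; rewrite eq_complex /=.
by rewrite !mulr0 subr0 add0r !eqxx.
Qed.

(** The factor 2 comes from bounding real and imaginary parts separately. It does no harm, since
    [half_plane_max] removes all such constants. *)
Lemma cint_norm (M : R) g a b : a <= b -> ccont g a b ->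
  (forall x, a <= x <= b -> normc (g x) <= M) -> normc (cint g a b) <= 2 * M * (b - a).
Proof.
move=> ab hg hM; apply: (le_trans (normc_le_ReIm _)) => /=.
have h1 : `|rint (fun x => Re (g x)) a b| <= M * (b - a).
  by apply: rint_norm (ccont_Re hg) _ => // x /hM; apply: le_trans; exact: normc_ge_Re.
have h2 : `|rint (fun x => Im (g x)) a b| <= M * (b - a).
  by apply: rint_norm (ccont_Im hg) _ => // x /hM; apply: le_trans; exact: normc_ge_Im.
lra.
Qed.

Lemma ccont_cst (k : C) a b : ccont (fun=> k) a b.
Proof.
move=> x _ e e0; exists 1 => // h _.
by rewrite subrr ComplexField.Normc.normc0 ltW.
Qed.

Lemma ccontB f g a b : ccont f a b -> ccont g a b -> ccont (fun x => f x - g x) a b.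
Proof.
move=> hu hv x xab e e0; have e2 : 0 < e / 2 by rewrite divr_gt0.
have [d1 d10 H1] := hu x xab _ e2; have [d2 d20 H2] := hv x xab _ e2.
exists (Num.min d1 d2); first by rewrite lt_min d10.
move=> h; rewrite lt_min => /andP[/H1 {}H1 /H2 {}H2].
have -> : f (x + h) - g (x + h) - (f x - g x) =
  (f (x + h) - f x) - (g (x + h) - g x) by ring.
by apply: (le_trans (normc_leB _ _)); lra.
Qed.

Lemma cint_near (M : R) (k : C) g a b : a <= b -> ccont g a b ->
  (forall x, a <= x <= b -> normc (g x - k) <= M) ->
  normc (cint g a b - k * (b - a)%:C) <= 2 * M * (b - a).
Proof.
move=> ab hg hM; rewrite -cint_cst // -(cintB hg (@ccont_cst k a b)).
exact: (cint_norm ab (ccontB hg (@ccont_cst k a b)) hM).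
Qed.

End SegmentIntegral.

(** * Contour integrals over rectangles *)

Section Goursat.
Variable R : realType.
Local Notation C := R[i].
Local Notation "x ^*" := (conjc x) : ring_scope.
Implicit Types (f g H : C -> C) (x y : R).

Definition in_rect x1 x2 y1 y2 (z : C) := (x1 <= Re z <= x2) && (y1 <= Im z <= y2).

(* The boundary of [x1, x2] x [y1, y2] is run through counterclockwise. *)
Definition rect_int f x1 x2 y1 y2 : C :=
  cint (fun x => f (x +i* y1)) x1 x2 - cint (fun x => f (x +i* y2)) x1 x2
  + 'i * (cint (fun y => f (x2 +i* y)) y1 y2 - cint (fun y => f (x1 +i* y)) y1 y2).

Lemma cdiff_ccont_h f (y a b : R) :
  (forall x, a <= x <= b -> cdiff f (x +i* y)) -> ccont (fun x => f (x +i* y)) a b.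
Proof.
move=> hf x /hf /cdiff_cont H e /H[d d0 Hd]; exists d => // h hd.
have -> : (x + h) +i* y = x +i* y + h%:C by rewrite /GRing.add /= addr0.
by apply: Hd; rewrite normcR.
Qed.

Lemma cdiff_ccont_v f (x a b : R) :
  (forall y, a <= y <= b -> cdiff f (x +i* y)) -> ccont (fun y => f (x +i* y)) a b.
Proof.
move=> hf y /hf /cdiff_cont H e /H[d d0 Hd]; exists d => // h hd.
have -> : x +i* (y + h) = x +i* y + 0 +i* h by rewrite /GRing.add /= addr0.
by apply: Hd; rewrite /ComplexField.Normc.normc /= expr0n add0r sqrtr_sqr.
Qed.

Lemma rect_int_splith f x1 c x2 y1 y2 : x1 <= c -> c <= x2 ->
  (forall x, x1 <= x <= x2 -> cdiff f (x +i* y1) /\ cdiff f (x +i* y2)) ->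
  rect_int f x1 x2 y1 y2 = rect_int f x1 c y1 y2 + rect_int f c x2 y1 y2.
Proof.
move=> h1 h2 hf; rewrite /rect_int.
rewrite (cint_split h1 h2 (cdiff_ccont_h (fun x hx => (hf x hx).1))).
rewrite (cint_split h1 h2 (cdiff_ccont_h (fun x hx => (hf x hx).2))).
ring.
Qed.

Lemma rect_int_splitv f x1 x2 y1 c y2 : y1 <= c -> c <= y2 ->
  (forall y, y1 <= y <= y2 -> cdiff f (x1 +i* y) /\ cdiff f (x2 +i* y)) ->
  rect_int f x1 x2 y1 y2 = rect_int f x1 x2 y1 c + rect_int f x1 x2 c y2.
Proof.
move=> h1 h2 hf; rewrite /rect_int.
rewrite (cint_split h1 h2 (cdiff_ccont_v (fun x hx => (hf x hx).1))).
rewrite (cint_split h1 h2 (cdiff_ccont_v (fun x hx => (hf x hx).2))).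
ring.
Qed.

Lemma normci : normc ('i : C) = 1.
Proof. by rewrite /ComplexField.Normc.normc /= expr0n expr1n add0r sqrtr1. Qed.

(** Opposite sides are paired pointwise: the difference of f at two facing points is close to d
    times their separation, which is constant along the side. The two constants obtained this way
    cancel in the contour integral, so no primitive of the linear part is needed. *)
Lemma rect_int_local f (p : C) (e : R) : 0 < e -> cdiff f p ->
  exists2 del : R, 0 < del & forall x1 x2 y1 y2,
    x1 <= x2 -> y1 <= y2 -> in_rect x1 x2 y1 y2 p ->
    (forall z, in_rect x1 x2 y1 y2 z -> cdiff f z) ->
    (x2 - x1) + (y2 - y1) < del ->
    normc (rect_int f x1 x2 y1 y2) <= e * ((x2 - x1) + (y2 - y1)) ^+ 2.
Proof.
(* An error e/4 D at one point becomes e/2 D for a pair of facing points and e D per unit length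
   after the factor 2 of [cint_near]; summing over the two directions gives e D^2. *)
move=> e0 /cdiffP[d Hd]; have [del del0 H] := Hd (e / 4) (divr_gt0 e0 (ltr0n _ 4)).
exists del => // x1 x2 y1 y2 x12 y12 pin hf hdel.
set D := _ + _ in hdel *.
have D0 : 0 <= D by rewrite addr_ge0 // subr_ge0.
have key z : in_rect x1 x2 y1 y2 z -> normc (f z - f p - d * (z - p)) <= e / 4 * D.
  move=> zin; have hz : normc (z - p) <= D.
    move: pin zin => /andP[/andP[? ?] /andP[? ?]] /andP[/andP[? ?] /andP[? ?]].
    apply: (le_trans (normc_le_ReIm _)); rewrite ReB ImB /D.
    by apply: lerD; rewrite ler_norml; lra.
  have := H (z - p) (le_lt_trans hz hdel); rewrite (addrC p) subrK => h.
  by apply: (le_trans h); rewrite ler_wpM2l // divr_ge0 // ltW.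
have diff z w k : in_rect x1 x2 y1 y2 z -> in_rect x1 x2 y1 y2 w -> z - w = k ->
    normc (f z - f w - d * k) <= e / 2 * D.
  move=> zin win <-.
  have -> : f z - f w - d * (z - w) =
    (f z - f p - d * (z - p)) - (f w - f p - d * (w - p)) by ring.
  apply: (le_trans (normc_leB _ _)); have := key _ zin; have := key _ win; lra.
have inb x : x1 <= x <= x2 -> in_rect x1 x2 y1 y2 (x +i* y1).
  by move=> hx; rewrite /in_rect /= hx lexx y12.
have int x : x1 <= x <= x2 -> in_rect x1 x2 y1 y2 (x +i* y2).
  by move=> hx; rewrite /in_rect /= hx lexx y12.
have inl y : y1 <= y <= y2 -> in_rect x1 x2 y1 y2 (x1 +i* y).
  by move=> hx; rewrite /in_rect /= hx lexx x12.
have inr y : y1 <= y <= y2 -> in_rect x1 x2 y1 y2 (x2 +i* y).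
  by move=> hx; rewrite /in_rect /= hx lexx x12.
have cb := cdiff_ccont_h (fun x hx => hf _ (inb x hx)).
have ct := cdiff_ccont_h (fun x hx => hf _ (int x hx)).
have cl := cdiff_ccont_v (fun x hx => hf _ (inl x hx)).
have cr := cdiff_ccont_v (fun x hx => hf _ (inr x hx)).
rewrite /rect_int -(cintB cb ct) -(cintB cr cl).
have := @cint_near _ (e / 2 * D) (d * (0 +i* (y1 - y2))) _ _ _ x12 (ccontB cb ct).
move=> /(_ (fun x hx => diff _ _ _ (inb x hx) (int x hx) _)).
have hk1 (x : R) : x +i* y1 - x +i* y2 = 0 +i* (y1 - y2).
  by apply/eqP; rewrite eq_complex /= subrr !eqxx.
move=> /(_ hk1).
have := @cint_near _ (e / 2 * D) (d * (x2 - x1)%:C) _ _ _ y12 (ccontB cr cl).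
move=> /(_ (fun x hx => diff _ _ _ (inr x hx) (inl x hx) _)).
have hk2 (y : R) : x2 +i* y - x1 +i* y = (x2 - x1)%:C.
  by apply/eqP; rewrite eq_complex /= subrr !eqxx.
move=> /(_ hk2).
set A := cint _ _ _; set B := cint _ _ _ => hA hB.
have -> : B + 'i * A = (B - d * (0 +i* (y1 - y2)) * (x2 - x1)%:C)
   + 'i * (A - d * (x2 - x1)%:C * (y2 - y1)%:C).
  have -> : 0 +i* (y1 - y2) = - ('i * (y2 - y1)%:C) :> C.
    by apply/eqP; rewrite eq_complex /=; apply/andP; split; apply/eqP; ring.
  ring.
apply: (le_trans (normcD _ _)); rewrite normcM normci mul1r.
rewrite expr2 mulrA; apply: (le_trans (lerD hB hA)).
by rewrite -mulrDr /D; lra.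
Qed.

Lemma exp2_unbounded (w del : R) : 0 < del -> exists n, w < del * 2 ^+ n.
Proof.
move=> del0; exists (Num.bound `|w / del|); rewrite mulrC -ltr_pdivrMr //.
apply: (le_lt_trans (ler_norm _)); apply: (lt_le_trans (archi_boundP (normr_ge0 _))).
by rewrite -natrX ler_nat ltnW // ltn_expl.
Qed.

Lemma midpoint (a b : R) : a <= b -> let c := (a + b) / 2 in
  [/\ a <= c, c <= b, c - a = (b - a) / 2 & b - c = (b - a) / 2].
Proof. by move=> ab c; rewrite /c; split; lra. Qed.

(** Compactness by bisection: if P failed, one could pass forever to a quarter on which it still
    fails, and these rectangles shrink to a point where the local hypothesis applies. *)
Lemma rect_bisection (P : R -> R -> R -> R -> Prop) X1 X2 Y1 Y2 :
  X1 <= X2 -> Y1 <= Y2 ->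
  (forall x1 x2 y1 y2, X1 <= x1 -> x1 <= x2 -> x2 <= X2 ->
     Y1 <= y1 -> y1 <= y2 -> y2 <= Y2 ->
     let cx := (x1 + x2) / 2 in let cy := (y1 + y2) / 2 in
     P x1 cx y1 cy -> P cx x2 y1 cy -> P x1 cx cy y2 -> P cx x2 cy y2 -> P x1 x2 y1 y2) ->
  (forall p, in_rect X1 X2 Y1 Y2 p -> exists2 del : R, 0 < del &
     forall x1 x2 y1 y2, X1 <= x1 -> x1 <= x2 -> x2 <= X2 ->
     Y1 <= y1 -> y1 <= y2 -> y2 <= Y2 -> in_rect x1 x2 y1 y2 p ->
     (x2 - x1) + (y2 - y1) < del -> P x1 x2 y1 y2) ->
  P X1 X2 Y1 Y2.
Proof.
move=> hX hY Hquad Hloc; apply: contrapT => nP.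
pose st := (R * R * R * R)%type.
pose ok (s : st) := [/\ X1 <= s.1.1.1 <= s.1.1.2, s.1.1.2 <= X2,
   Y1 <= s.1.2 <= s.2, s.2 <= Y2 & ~ P s.1.1.1 s.1.1.2 s.1.2 s.2].
pose half (s t : st) := [/\ s.1.1.1 <= t.1.1.1, t.1.1.2 <= s.1.1.2, s.1.2 <= t.1.2,
   t.2 <= s.2 & (t.1.1.2 - t.1.1.1) + (t.2 - t.1.2) = ((s.1.1.2 - s.1.1.1) + (s.2 - s.1.2)) / 2].
have /choice[step Hstep] : forall s, exists t, ok s -> ok t /\ half s t.
  move=> [[[x1 x2] y1] y2].
  have [|nok] := pselect (ok (x1, x2, y1, y2)); last by exists (x1, x2, y1, y2).
  rewrite /ok /= => -[/andP[a1 a2] a3 /andP[a4 a5] a6 nPs].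
  have H := Hquad _ _ _ _ a1 a2 a3 a4 a5 a6.
  set cx := (x1 + x2) / 2 in H; set cy := (y1 + y2) / 2 in H.
  have [b1 b2 m1 m2] := midpoint a2; have [b3 b4 m3 m4] := midpoint a5.
  have [P1|N1] := pselect (P x1 cx y1 cy); last first.
    exists (x1, cx, y1, cy) => _; rewrite /ok /half /=; split;
      last by split; rewrite ?lexx //= ?m1 ?m2 ?m3 ?m4 -mulrDl.
    by split => //; rewrite ?a1 ?a4 // ?(le_trans b2) ?(le_trans b4).
  have [P2|N2] := pselect (P cx x2 y1 cy); last first.
    exists (cx, x2, y1, cy) => _; rewrite /ok /half /=; split;
      last by split; rewrite ?lexx //= ?m1 ?m2 ?m3 ?m4 -mulrDl.
    by split => //; rewrite ?(le_trans a1 b1) ?a4 // (le_trans b4).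
  have [P3|N3] := pselect (P x1 cx cy y2); last first.
    exists (x1, cx, cy, y2) => _; rewrite /ok /half /=; split;
      last by split; rewrite ?lexx //= ?m1 ?m2 ?m3 ?m4 -mulrDl.
    by split => //; rewrite ?a1 ?(le_trans a4 b3) // (le_trans b2).
  have [P4|N4] := pselect (P cx x2 cy y2); last first.
    exists (cx, x2, cy, y2) => _; rewrite /ok /half /=; split;
      last by split; rewrite ?lexx //= ?m1 ?m2 ?m3 ?m4 -mulrDl.
    by split => //; rewrite ?(le_trans a1 b1) ?(le_trans a4 b3).
  by case: nPs; exact: H.
pose u n := iter n step (X1, X2, Y1, Y2).
have oku n : ok (u n).
  elim: n => [|n IH]; first by rewrite /ok /= !lexx hX hY.
  exact: (Hstep _ IH).1.
have hu n : half (u n) (u n.+1) by exact: (Hstep _ (oku n)).2.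
have wu n : (((u n).1.1.2 - (u n).1.1.1) + ((u n).2 - (u n).1.2)) * 2 ^+ n = (X2 - X1) + (Y2 - Y1).
  elim: n => [|n IH]; first by rewrite expr0 mulr1.
  have [_ _ _ _ ->] := hu n.
  by rewrite exprS mulrA divfK ?pnatr_eq0.
have mon n m : [/\ (u n).1.1.1 <= (u (n + m)%N).1.1.1, (u (n + m)%N).1.1.2 <= (u n).1.1.2,
   (u n).1.2 <= (u (n + m)%N).1.2 & (u (n + m)%N).2 <= (u n).2].
  elim: m => [|m [i1 i2 i3 i4]]; first by rewrite addn0 !lexx.
  rewrite addnS; have [j1 j2 j3 j4 _] := hu (n + m)%N.
  by split; [apply: le_trans j1|apply: (le_trans j2)|apply: le_trans j3|apply: (le_trans j4)].
have lex n m : (u n).1.1.1 <= (u m).1.1.2.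
  have [i1 _ _ _] := mon n m; have [_ i2 _ _] := mon m n.
  rewrite addnC in i2; apply: (le_trans i1); apply: le_trans i2.
  by have [/andP[_ ->]] := oku (n + m)%N.
have ley n m : (u n).1.2 <= (u m).2.
  have [_ _ i1 _] := mon n m; have [_ _ _ i2] := mon m n.
  rewrite addnC in i2; apply: (le_trans i1); apply: le_trans i2.
  by have [_ _ /andP[_ ->]] := oku (n + m)%N.
(* By [lex] and [ley] every left or lower bound lies below every right or upper bound, so these
   suprema give a point common to all the rectangles. *)
pose px := sup (range (fun n => (u n).1.1.1)); pose py := sup (range (fun n => (u n).1.2)).
have px1 n : (u n).1.1.1 <= px.
  apply: ub_le_sup; last by exists n.
  by exists (u 0%N).1.1.2 => _ [m _ <-]; exact: lex.
have px2 n : px <= (u n).1.1.2.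
  by apply: ge_sup; [exists (u 0%N).1.1.1, 0%N | move=> _ [m _ <-]; exact: lex].
have py1 n : (u n).1.2 <= py.
  apply: ub_le_sup; last by exists n.
  by exists (u 0%N).2 => _ [m _ <-]; exact: ley.
have py2 n : py <= (u n).2.
  by apply: ge_sup; [exists (u 0%N).1.2, 0%N | move=> _ [m _ <-]; exact: ley].
have [|del del0 Hd] := Hloc (px +i* py).
  by rewrite /in_rect /= (px1 0%N) (px2 0%N) (py1 0%N) (py2 0%N).
have [n hn] := exp2_unbounded ((X2 - X1) + (Y2 - Y1)) del0.
have [/andP[a1 a2] a3 /andP[a4 a5] a6] := oku n; apply; apply: Hd => //.
  by rewrite /in_rect /= px1 px2 py1 py2.
by rewrite -(wu n) ltr_pM2r // exprn_gt0 in hn.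
Qed.

Theorem goursat f x1 x2 y1 y2 : x1 <= x2 -> y1 <= y2 ->
  (forall z, in_rect x1 x2 y1 y2 z -> cdiff f z) -> rect_int f x1 x2 y1 y2 = 0.
Proof.
move=> x12 y12 hf; apply/eqP; rewrite -normc_eq0 eq_le normc_ge0 andbT.
set D := (x2 - x1) + (y2 - y1); have D0 : 0 <= D ^+ 2 by rewrite sqr_ge0.
have sub a1 a2 b1 b2 z : x1 <= a1 -> a2 <= x2 -> y1 <= b1 -> b2 <= y2 ->
    in_rect a1 a2 b1 b2 z -> cdiff f z.
  move=> h1 h2 h3 h4 /andP[/andP[h5 h6] /andP[h7 h8]]; apply: hf.
  by rewrite /in_rect (le_trans h1 h5) (le_trans h6 h2) (le_trans h3 h7) (le_trans h8 h4).
suff H e : 0 < e -> normc (rect_int f x1 x2 y1 y2) <= e * D ^+ 2.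
  apply/ler_addgt0Pr => e e0; rewrite add0r.
  have D1 : 0 < D ^+ 2 + 1 by rewrite ltr_wpDl.
  apply: (le_trans (H _ (divr_gt0 e0 D1))).
  by rewrite mulrAC ler_pdivrMr // ler_pM2l // lerDl.
(* The square of the half-perimeter is additive under quartering. *)
move=> e0; rewrite /D.
apply: (@rect_bisection (fun a1 a2 b1 b2 => normc (rect_int f a1 a2 b1 b2) <=
   e * ((a2 - a1) + (b2 - b1)) ^+ 2)) => //.
  move=> a1 a2 b1 b2 h1 h2 h3 h4 h5 h6 cx cy Q1 Q2 Q3 Q4.
  have [c1 c2 m1 m2] := midpoint h2; have [c3 c4 m3 m4] := midpoint h5.
  have df z : in_rect a1 a2 b1 b2 z -> cdiff f z by exact: sub.
  rewrite (rect_int_splith c1 c2); last first.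
    by move=> x hx; split; apply: df; rewrite /in_rect /= hx lexx h5.
  rewrite (rect_int_splitv c3 c4); last first.
    by move=> y hy; split; apply: df; rewrite /in_rect /= hy ?lexx ?c1 ?c2 ?h2.
  rewrite (@rect_int_splitv f cx a2 _ _ _ c3 c4); last first.
    by move=> y hy; split; apply: df; rewrite /in_rect /= hy ?lexx ?c2 ?c1 ?h2.
  set q1 := rect_int _ _ _ _ _ in Q1 *; set q2 := rect_int _ _ _ _ _ in Q2 *.
  set q3 := rect_int _ _ _ _ _ in Q3 *; set q4 := rect_int _ _ _ _ _ in Q4 *.
  have := normcD (q1 + q3) (q2 + q4); have := normcD q1 q3; have := normcD q2 q4.
  have -> : e * ((a2 - a1) + (b2 - b1)) ^+ 2 =
    e * ((cx - a1) + (cy - b1)) ^+ 2 + e * ((a2 - cx) + (cy - b1)) ^+ 2 +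
    e * ((cx - a1) + (b2 - cy)) ^+ 2 + e * ((a2 - cx) + (b2 - cy)) ^+ 2.
    by rewrite m1 m2 m3 m4; field.
  move=> n1 n2 n3.
  apply: (le_trans n3); apply: (le_trans (lerD n2 n1)).
  apply: (le_trans (lerD (lerD Q1 Q3) (lerD Q2 Q4))); rewrite le_eqVlt.
  by apply/orP; left; apply/eqP; ring.
move=> p pin; have [del del0 H] := rect_int_local e0 (hf _ pin).
exists del => // a1 a2 b1 b2 h1 h2 h3 h4 h5 h6 pin' hd.
by apply: H => // z; exact: sub.
Qed.

(** Cutting along Re z = x0 - r and Re z = x0 + r, and then the middle strip along the two
    horizontal lines, leaves four outer rectangles that miss the exceptional point; [goursat]
    applies to each. *)
Lemma rect_int_puncture f x1 x2 y1 y2 (x0 y0 r : R) : 0 < r ->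
  x1 <= x0 - r -> x0 + r <= x2 -> y1 <= y0 - r -> y0 + r <= y2 ->
  (forall z, in_rect x1 x2 y1 y2 z -> (Re z != x0) || (Im z != y0) -> cdiff f z) ->
  rect_int f x1 x2 y1 y2 = rect_int f (x0 - r) (x0 + r) (y0 - r) (y0 + r).
Proof.
move=> r0 h1 h2 h3 h4 hf.
have [xl xr yl yr] : [/\ x0 - r < x0, x0 < x0 + r, y0 - r < y0 & y0 < y0 + r].
  by rewrite !ltrDl !ltrBlDr !ltrDl.
have [w1 w2 w3 w4] : [/\ x1 <= x0 + r, x0 - r <= x2, y1 <= y0 + r & y0 - r <= y2].
  by split; lra.
have [v1 v2] : x0 - r <= x0 + r /\ y0 - r <= y0 + r by split; lra.
have v3 : y1 <= y2 by lra.
have df x y : x1 <= x -> x <= x2 -> y1 <= y -> y <= y2 -> (x != x0) || (y != y0) ->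
    cdiff f (x +i* y).
  by move=> a1 a2 a3 a4; apply: (hf (x +i* y)); rewrite /in_rect /= a1 a2 a3.
have ny1 : y1 != y0 by rewrite lt_eqF // (le_lt_trans h3).
have ny2 : y2 != y0 by rewrite gt_eqF // (lt_le_trans yr).
have nxl : x0 - r != x0 by rewrite lt_eqF.
have nxr : x0 + r != x0 by rewrite gt_eqF.
have Z1 : rect_int f x1 (x0 - r) y1 y2 = 0.
  apply: goursat => // -[x y]; rewrite /in_rect /= => /andP[/andP[a1 a2] /andP[a3 a4]].
  apply: df => //; first by rewrite (le_trans a2).
  by rewrite lt_eqF // (le_lt_trans a2).
have Z2 : rect_int f (x0 + r) x2 y1 y2 = 0.
  apply: goursat => // -[x y]; rewrite /in_rect /= => /andP[/andP[a1 a2] /andP[a3 a4]].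
  apply: df => //; first by rewrite (le_trans w1).
  by rewrite gt_eqF // (lt_le_trans xr).
have Z3 : rect_int f (x0 - r) (x0 + r) y1 (y0 - r) = 0.
  apply: goursat => // -[x y]; rewrite /in_rect /= => /andP[/andP[a1 a2] /andP[a3 a4]].
  apply: df; rewrite ?(le_trans h1 a1) ?(le_trans a2 h2) ?(le_trans a4 w4) //.
  by rewrite orbC lt_eqF // (le_lt_trans a4).
have Z4 : rect_int f (x0 - r) (x0 + r) (y0 + r) y2 = 0.
  apply: goursat => // -[x y]; rewrite /in_rect /= => /andP[/andP[a1 a2] /andP[a3 a4]].
  apply: df; rewrite ?(le_trans h1 a1) ?(le_trans a2 h2) ?(le_trans w3 a3) //.
  by rewrite orbC gt_eqF // (lt_le_trans yr).
rewrite (rect_int_splith h1 w2); last first.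
  by move=> x /andP[a1 a2]; split; apply: df; rewrite ?ny1 ?ny2 ?orbT.
rewrite Z1 add0r (rect_int_splith v1 h2); last first.
  move=> x /andP[a1 a2]; have a3 := le_trans h1 a1.
  by split; apply: df; rewrite ?ny1 ?ny2 ?orbT.
rewrite Z2 addr0 (rect_int_splitv h3 w4); last first.
  by move=> y /andP[a1 a2]; split; apply: df; rewrite ?nxl ?nxr.
rewrite Z3 add0r (rect_int_splitv v2 h4); last first.
  move=> y /andP[a1 a2]; have a3 := le_trans h3 a1.
  by split; apply: df; rewrite ?nxl ?nxr.
by rewrite Z4 addr0.
Qed.

Definition on_boundary x1 x2 y1 y2 (z : C) := in_rect x1 x2 y1 y2 z &&
  [|| Re z == x1, Re z == x2, Im z == y1 | Im z == y2].

Section Boundary.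
Variables (a b c d : R).
Hypotheses (ab : a <= b) (cd : c <= d).
Notation bd := (on_boundary a b c d).

Lemma boundary_bottom x : a <= x <= b -> bd (x +i* c).
Proof. by move=> h; rewrite /on_boundary /in_rect /= h lexx cd eqxx !orbT. Qed.
Lemma boundary_top x : a <= x <= b -> bd (x +i* d).
Proof. by move=> h; rewrite /on_boundary /in_rect /= h lexx cd eqxx !orbT. Qed.
Lemma boundary_left y : c <= y <= d -> bd (a +i* y).
Proof. by move=> h; rewrite /on_boundary /in_rect /= h lexx ab eqxx. Qed.
Lemma boundary_right y : c <= y <= d -> bd (b +i* y).
Proof. by move=> h; rewrite /on_boundary /in_rect /= h lexx ab eqxx orbT. Qed.

Lemma boundary_ccont f : (forall z, bd z -> cdiff f z) ->
  [/\ ccont (fun x => f (x +i* c)) a b, ccont (fun x => f (x +i* d)) a b,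
      ccont (fun y => f (a +i* y)) c d & ccont (fun y => f (b +i* y)) c d].
Proof.
move=> hf; split.
- by apply: cdiff_ccont_h => x /boundary_bottom /hf.
- by apply: cdiff_ccont_h => x /boundary_top /hf.
- by apply: cdiff_ccont_v => x /boundary_left /hf.
- by apply: cdiff_ccont_v => x /boundary_right /hf.
Qed.

Lemma rect_int_norm f M : (forall z, bd z -> cdiff f z) ->
  (forall z, bd z -> normc (f z) <= M) ->
  normc (rect_int f a b c d) <= 4 * M * ((b - a) + (d - c)).
Proof.
move=> /boundary_ccont[hb ht hl hr] hM; rewrite /rect_int.
have nb := cint_norm ab hb (fun x hx => hM _ (boundary_bottom hx)).
have nt := cint_norm ab ht (fun x hx => hM _ (boundary_top hx)).
have nl := cint_norm cd hl (fun x hx => hM _ (boundary_left hx)).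
have nr := cint_norm cd hr (fun x hx => hM _ (boundary_right hx)).
apply: (le_trans (normcD _ _)); rewrite normcM normci mul1r.
apply: (le_trans (lerD (normc_leB _ _) (normc_leB _ _))).
apply: (le_trans (lerD (lerD nb nt) (lerD nr nl))).
by rewrite le_eqVlt; apply/orP; left; apply/eqP; ring.
Qed.

Lemma rect_int_lin f g (k : C) : (forall z, bd z -> cdiff f z) ->
  (forall z, bd z -> cdiff g z) ->
  rect_int (fun z => f z - k * g z) a b c d =
  rect_int f a b c d - k * rect_int g a b c d.
Proof.
move=> /boundary_ccont[fb ft fl fr] hg; have [gb gt gl gr] := boundary_ccont hg.
have [kb kt kl kr] := boundary_ccont (fun z hz => cdiffM (cdiff_cst k z) (hg z hz)).
rewrite /rect_int (cintB fb kb) (cintB ft kt) (cintB fl kl) (cintB fr kr).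
rewrite (cintZ k gb) (cintZ k gt) (cintZ k gl) (cintZ k gr).
ring.
Qed.

End Boundary.

Lemma ReV (z : C) : Re z^-1 = Re z / normc z ^+ 2.
Proof. by rewrite normc_sqr; case: z. Qed.

Lemma ImV (z : C) : Im z^-1 = - (Im z / normc z ^+ 2).
Proof. by rewrite normc_sqr; case: z. Qed.

(* Each side contributes a nonnegative imaginary part, the bottom side a positive one. *)
Lemma rect_int_winding x1 x2 y1 y2 (z0 : C) :
  x1 < Re z0 < x2 -> y1 < Im z0 < y2 ->
  exists2 k : R, 0 < k & k <= normc (rect_int (fun z => (z - z0)^-1) x1 x2 y1 y2).
Proof.
case: z0 => x0 y0 /= /andP[h1 h2] /andP[h3 h4].
have [x12 y12] : x1 <= x2 /\ y1 <= y2 by split; lra.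
set z0 := x0 +i* y0; set W := fun z : C => (z - z0)^-1.
have nz z : on_boundary x1 x2 y1 y2 z -> z - z0 != 0.
  case: z => x y /andP[_ hz]; rewrite subr_eq0 eq_complex /= negb_and.
  move: hz => /= /or4P[] /eqP ->.
  - by rewrite lt_eqF.
  - by rewrite gt_eqF.
  - by rewrite orbC lt_eqF.
  - by rewrite orbC gt_eqF.
have [hb ht hl hr] := boundary_ccont x12 y12
  (fun z hz => cdiff_inv_sub (nz z hz)).
(* The squared diagonal bounds |z - z0|^2, so on the bottom side the imaginary part of 1 / (z - z0)
   is at least (y0 - y1) / D. *)
set D := (x2 - x1) ^+ 2 + (y2 - y1) ^+ 2.
have D0 : 0 < D by rewrite ltr_wpDl ?sqr_ge0 // exprn_gt0 // subr_gt0; lra.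
exists ((y0 - y1) / D * (x2 - x1)).
  by rewrite mulr_gt0 ?divr_gt0 // subr_gt0 //; lra.
apply: (le_trans _ (le_trans (ler_norm _) (normc_ge_Im _))).
have -> : Im (rect_int W x1 x2 y1 y2) =
   rint (fun x => Im (W (x +i* y1))) x1 x2 - rint (fun x => Im (W (x +i* y2))) x1 x2
   + (rint (fun y => Re (W (x2 +i* y))) y1 y2 - rint (fun y => Re (W (x1 +i* y))) y1 y2).
  by rewrite /rect_int /cint /=; ring.
have pn (z : C) : 0 <= (normc z ^+ 2)^-1 by rewrite invr_ge0 sqr_ge0.
have B : (y0 - y1) / D * (x2 - x1) <= rint (fun x => Im (W (x +i* y1))) x1 x2.
  apply: rint_ge (ccont_Im hb) _ => // x /andP[a1 a2]; rewrite ImV -mulNr ImB /= opprB.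
  apply: ler_wpM2l; first by rewrite subr_ge0 ltW.
  rewrite lef_pV2 ?posrE //; last first.
    rewrite exprn_gt0 // normc_gt0; apply: nz; apply: boundary_bottom => //; exact/andP.
  rewrite normc_sqr ReB ImB /= /D; apply: lerD;
    rewrite -(real_normK (num_real _)) ler_sqr ?nnegrE ?normr_ge0 ?subr_ge0 // ler_norml; lra.
have T : rint (fun x => Im (W (x +i* y2))) x1 x2 <= 0 * (x2 - x1).
  apply: rint_le (ccont_Im ht) _ => // x _; rewrite ImV oppr_le0.
  by rewrite mulr_ge0 // ImB /= subr_ge0 ltW.
have Rt : 0 * (y2 - y1) <= rint (fun y => Re (W (x2 +i* y))) y1 y2.
  apply: rint_ge (ccont_Re hr) _ => // y _; rewrite ReV.
  by rewrite mulr_ge0 // ReB /= subr_ge0 ltW.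
have L : rint (fun y => Re (W (x1 +i* y))) y1 y2 <= 0 * (y2 - y1).
  apply: rint_le (ccont_Re hl) _ => // y _; rewrite ReV.
  by rewrite mulr_le0_ge0 // ReB /= subr_le0 ltW.
by rewrite !mul0r in T Rt L; lra.
Qed.

(** The integral of 1 / (z - z0) need not be evaluated: a positive lower bound for its modulus
    suffices to solve for H z0. What matters is that K depends on the rectangle and z0 only, so that
    the estimate can be applied to all powers of a function. *)
Theorem cauchy_estimate x1 x2 y1 y2 (z0 : C) :
  x1 < Re z0 < x2 -> y1 < Im z0 < y2 ->
  exists2 K : R, 0 <= K & forall (H : C -> C) (M : R),
    (forall z, in_rect x1 x2 y1 y2 z -> cdiff H z) ->
    (forall z, on_boundary x1 x2 y1 y2 z -> normc (H z) <= M) ->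
    normc (H z0) <= K * M.
Proof.
move=> hx hy; have [k k0 hk] := rect_int_winding hx hy.
case: z0 hx hy hk => x0 y0 /= /andP[h1 h2] /andP[h3 h4].
have [x12 y12] : x1 <= x2 /\ y1 <= y2 by split; lra.
set z0 := x0 +i* y0; set W := fun z : C => (z - z0)^-1 => hk.
have [r r0 [r1 r2 r3 r4]] : exists2 r : R, 0 < r &
    [/\ r <= x0 - x1, r <= x2 - x0, r <= y0 - y1 & r <= y2 - y0].
  exists (Num.min (Num.min (x0 - x1) (x2 - x0)) (Num.min (y0 - y1) (y2 - y0))).
    by rewrite !lt_min !subr_gt0 h1 h2 h3 h4.
  by rewrite !ge_min !lexx !orbT.
have rW z : on_boundary x1 x2 y1 y2 z -> r <= normc (z - z0).
  case: z => x y /andP[_ hz]; move: hz => /= /or4P[] /eqP ->.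
  - apply: le_trans (normc_ge_Re _); rewrite ReB /= distrC; apply: le_trans (ler_norm _); lra.
  - apply: le_trans (normc_ge_Re _); rewrite ReB /=; apply: le_trans (ler_norm _); lra.
  - apply: le_trans (normc_ge_Im _); rewrite ImB /= distrC; apply: le_trans (ler_norm _); lra.
  - apply: le_trans (normc_ge_Im _); rewrite ImB /=; apply: le_trans (ler_norm _); lra.
have nz z : on_boundary x1 x2 y1 y2 z -> z - z0 != 0.
  by move=> /rW h; rewrite -normc_gt0 (lt_le_trans r0).
have cW z : z - z0 != 0 -> cdiff W z.
  exact: cdiff_inv_sub.
set P := (x2 - x1) + (y2 - y1).
have P0 : 0 <= P by rewrite addr_ge0 // subr_ge0.
exists (4 / r * P / k); first by rewrite !mulr_ge0 // invr_ge0 ltW.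
move=> H M cH hM.
have inb z : on_boundary x1 x2 y1 y2 z -> in_rect x1 x2 y1 y2 z by case/andP.
pose F z := H z * W z; pose G z := F z - H z0 * W z.
have cF z : in_rect x1 x2 y1 y2 z -> z - z0 != 0 -> cdiff F z.
  by move=> hz hn; exact: (cdiffM (cH z hz) (cW z hn)).
have cG z : in_rect x1 x2 y1 y2 z -> z - z0 != 0 -> cdiff G z.
  by move=> hz hn; exact: (cdiffB (cF z hz hn) (cdiffM (cdiff_cst _ z) (cW z hn))).
(* G is the difference quotient of H at z0. On a square of half-side s around z0 it is at most B = 1
   + |d|, and [rect_int_norm] gives 4 B (2 s + 2 s) = 16 B s, which is arbitrarily small. *)
have G0 : rect_int G x1 x2 y1 y2 = 0.
  apply/eqP; rewrite -normc_eq0 eq_le normc_ge0 andbT; apply/ler_addgt0Pr => e e0.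
  rewrite add0r.
  have z0in : in_rect x1 x2 y1 y2 z0 by rewrite /in_rect /= !ltW.
  have /cdiffP[d /(_ 1 ltr01)[del del0 Hd]] := cH z0 z0in.
  set B := 1 + normc d; have B0 : 0 < B by rewrite ltr_wpDr // normc_ge0.
  have B16 : 0 < 16 * B by rewrite mulr_gt0.
  have [s s0 [s1 s2 s3]] : exists2 s : R, 0 < s &
      [/\ s <= r, s <= del / 4 & 16 * B * s <= e].
    exists (Num.min r (Num.min (del / 4) (e / (16 * B)))).
      by rewrite !lt_min r0 !divr_gt0.
    rewrite !ge_min !lexx !orbT; split => //.
    rewrite mulrC -ler_pdivlMr //; by rewrite !ge_min !lexx !orbT.
  rewrite (@rect_int_puncture G x1 x2 y1 y2 x0 y0 s) //; try lra.
  have bz z : on_boundary (x0 - s) (x0 + s) (y0 - s) (y0 + s) z ->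
     [/\ in_rect x1 x2 y1 y2 z, z - z0 != 0 & normc (z - z0) < del].
    case: z => x y /andP[]; rewrite /in_rect /= => /andP[/andP[a1 a2] /andP[a3 a4]] hz.
    split.
    - by apply/andP; split; apply/andP; split; lra.
    - rewrite subr_eq0 eq_complex /= negb_and.
      move: hz => /= /or4P[] /eqP ->.
      + by rewrite lt_eqF // ltrBlDr ltrDl.
      + by rewrite gt_eqF // ltrDl.
      + by rewrite orbC lt_eqF // ltrBlDr ltrDl.
      + by rewrite orbC gt_eqF // ltrDl.
    - apply: (le_lt_trans (normc_le_ReIm _)); rewrite ReB ImB /=.
      have : `|x - x0| <= s by rewrite ler_norml; lra.
      have : `|y - y0| <= s by rewrite ler_norml; lra.
      lra.
  have [ss1 ss2] : x0 - s <= x0 + s /\ y0 - s <= y0 + s by split; lra.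
  apply: (le_trans (rect_int_norm ss1 ss2 (M := B) _ _)).
  - by move=> z /bz[a1 a2 _]; exact: cG.
  - move=> z /bz[a1 a2 a3].
    rewrite /G /F -mulrBl normcM normcV ler_pdivrMr ?normc_gt0 //.
    have := Hd (z - z0) a3; rewrite (addrC z0) subrK mul1r => hh.
    have -> : H z - H z0 = (H z - H z0 - d * (z - z0)) + d * (z - z0) by ring.
    apply: (le_trans (normcD _ _)); rewrite normcM /B; lra.
  - by apply: le_trans s3; rewrite le_eqVlt; apply/orP; left; apply/eqP; ring.
  - move=> z hz hn; apply: cG => //.
    by rewrite subr_eq0 eq_complex /= negb_and.
have : rect_int F x1 x2 y1 y2 = H z0 * rect_int W x1 x2 y1 y2.
  apply/eqP; rewrite -subr_eq0 -(rect_int_lin x12 y12 (H z0)) ?[rect_int _ _ _ _ _]G0 //.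
    by move=> z hz; apply: cF; [exact: inb|exact: nz].
  by move=> z hz; apply: cW; exact: nz.
move=> /(congr1 (@ComplexField.Normc.normc R)); rewrite normcM => E.
have : normc (rect_int F x1 x2 y1 y2) <= 4 * (M / r) * P.
  apply: rect_int_norm => // z hz; first by apply: cF; [exact: inb|exact: nz].
  rewrite /F normcM normcV; have hr := rW _ hz.
  have hr0 := lt_le_trans r0 hr.
  apply: ler_pM; rewrite ?normc_ge0 ?invr_ge0 ?normc_ge0 ?hM //.
  by rewrite lef_pV2 ?posrE.
rewrite E => U.
have : normc (H z0) * k <= 4 * (M / r) * P.
  by apply: le_trans U; rewrite ler_wpM2l // normc_ge0.
rewrite -ler_pdivlMr // => /le_trans; apply.
by rewrite le_eqVlt; apply/orP; left; apply/eqP; ring.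
Qed.

End Goursat.

(** * Maximum principle in a half-plane *)

Section HalfPlane.
Variable R : realType.
Local Notation C := R[i].
Local Notation "x ^*" := (conjc x) : ring_scope.
Implicit Types (F H : C -> C) (E : seq C).

(** This replaces Riemann's theorem on removable singularities: a bounded function times a factor
    with a double zero is differentiable there with derivative 0, whatever value the bounded
    function has at the point. *)
Lemma cdiff_quadratic H (e : C) (r K : R) : 0 < r -> 0 <= K ->
  (forall h, normc h < r -> normc (H (e + h)) <= K * normc h ^+ 2) -> cdiff H e.
Proof.
move=> r0 K0 hH; apply/cdiffP; exists 0 => d d0.
have K1 : 0 < K + 1 by rewrite ltr_wpDl.
have He : H e = 0.
  have := hH 0; rewrite ComplexField.Normc.normc0 addr0 expr0n mulr0 => /(_ r0) h.
  by apply/eqP; rewrite -normc_eq0 eq_le h normc_ge0.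
exists (Num.min r (d / (K + 1))); first by rewrite lt_min r0 divr_gt0.
move=> h; rewrite lt_min => /andP[/hH h1]; rewrite ltr_pdivlMr // => h2.
rewrite He mul0r !subr0; apply: (le_trans h1); rewrite expr2 mulrA.
rewrite ler_wpM2r ?normc_ge0 //; have := normc_ge0 h; lra.
Qed.

Lemma expr_bounded_le1 (q A : R) : 0 <= q -> (forall k, q ^+ k <= A) -> q <= 1.
Proof.
move=> q0 hA; rewrite leNgt; apply/negP => q1.
have t0 : 0 < q - 1 by rewrite subr_gt0.
have bern k : 1 + k%:R * (q - 1) <= q ^+ k.
  elim: k => [|k IH]; first by rewrite mul0r addr0 expr0.
  rewrite exprS -natr1; apply: (@le_trans _ _ (q * (1 + k%:R * (q - 1)))).
    have -> : q * (1 + k%:R * (q - 1)) =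
      (1 + (k%:R + 1) * (q - 1)) + k%:R * (q - 1) ^+ 2 by ring.
    by rewrite lerDl mulr_ge0 ?sqr_ge0.
  by rewrite ler_wpM2l.
have A0 : 0 <= A by apply: le_trans (hA 0%N); rewrite expr0.
have := archi_boundP (divr_ge0 A0 (ltW t0)); set n := Num.bound _.
rewrite ltr_pdivrMr // => hn; have := bern n; have := hA n; lra.
Qed.

(* The factor 1 / g makes F small on the sides of a large rectangle other than the one on
   Re z = c; taking k-th powers removes the constant of the Cauchy estimate; the factor P,
   vanishing to second order on E, makes the singularities at E removable. *)
Lemma half_plane_max E F (c B M : R) : 0 <= M ->
  (forall e, e \in E -> c < Re e) ->
  (forall z, c <= Re z -> z \notin E -> cdiff F z) ->
  (forall z, c <= Re z -> z \notin E -> normc (F z) <= B) ->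
  (forall z, Re z = c -> z \notin E -> normc (F z) <= M) ->
  forall z, c <= Re z -> z \notin E -> normc (F z) <= M.
Proof.
move=> M0 Ec cF hB hM z0; rewrite le_eqVlt => /predU1P[/esym|] zc z0E; first exact: hM.
(* M may be 0, whereas the choice of L and the passage to k-th powers divide by the bound. *)
apply/ler_addgt0Pr => m m0; set M' := M + m.
have M'0 : 0 < M' by rewrite ltr_wpDl.
have B0 : 0 <= B by apply: le_trans (normc_ge0 _) (hB _ (ltW zc) z0E).
pose g (d : R) z := 1 + d%:C * (z - c%:C).
have Reg d z : Re (g d z) = 1 + d * (Re z - c).
  by rewrite /g; case: z => a b /=; rewrite mul0r subr0.
have Img d z : Im (g d z) = d * Im z.
  by rewrite /g; case: z => a b /=; rewrite mul0r addr0 add0r subr0.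
have ng1 d z : 0 < d -> c <= Re z -> 1 <= normc (g d z).
  move=> d0 cz; apply: le_trans (normc_ge_Re _); rewrite Reg.
  apply: le_trans (ler_norm _); rewrite lerDl mulr_ge0 ?subr_ge0 //; exact: ltW.
(* As d tends to 0, the factor |g d z0| <= 1 + d |z0 - c| tends to 1. *)
suff key d : 0 < d -> normc (F z0) <= M' * normc (g d z0).
  apply/ler_addgt0Pr => e e0; set N := normc (z0 - c%:C).
  have N0 : 0 < M' * N + 1 by rewrite ltr_wpDl // mulr_ge0 ?normc_ge0 // ltW.
  have d0 := divr_gt0 e0 N0; apply: (le_trans (key _ d0)).
  set d := e / _ in d0 *.
  have hd : d * (M' * N + 1) = e by rewrite /d divfK // gt_eqF.
  have : normc (g d z0) <= 1 + d * N.
    apply: (le_trans (normcD _ _)); rewrite normcM normcR (gtr0_norm d0).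
    by rewrite ComplexField.Normc.normc1.
  rewrite -(ler_pM2l M'0) => /le_trans; apply; lra.
move=> d0.
have gp z : c <= Re z -> 0 < normc (g d z) by move=> hz; rewrite (lt_le_trans ltr01) ?ng1.
have gn0 z : c <= Re z -> g d z != 0 by move=> /gp; rewrite normc_gt0.
rewrite -ler_pdivrMr; last by apply: gp; exact: ltW.
rewrite -normcf_div.
pose G z := F z / g d z.
have cg z : cdiff (g d) z.
  exact: (cdiffD (cdiff_cst 1 z) (cdiffM (cdiff_cst d%:C z)
    (cdiffB (cdiff_id z) (cdiff_cst c%:C z)))).
have cG z : c <= Re z -> z \notin E -> cdiff G z.
  by move=> hz hE; exact: (cdiff_div (gn0 z hz) (cF z hz hE) (cg z)).
have GB z : c <= Re z -> z \notin E -> normc (G z) <= B.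
  move=> hz hE; rewrite /G normcf_div ler_pdivrMr ?gp //.
  apply: (le_trans (hB z hz hE)); rewrite ler_peMr ?ng1 //.
pose P z : C := \prod_(e <- E) (z - e) ^+ 2.
have cP z : cdiff P z.
  by apply: cdiff_prod => e; apply: cdiffX; exact: (cdiffB (cdiff_id z) (cdiff_cst e z)).
have PE e : e \in E -> P e = 0.
  by move=> eE; rewrite /P (big_rem e) //= subrr expr0n mul0r.
have Pn0 : P z0 != 0.
  rewrite /P prodf_seq_neq0; apply/allP => e eE; rewrite /= expf_neq0 // subr_eq0.
  by apply: contraNneq z0E => ->.
have Pbound (s : seq C) z S : normc z <= S ->
    normc (\prod_(e <- s) (z - e) ^+ 2) <= \prod_(e <- s) (S + normc e) ^+ 2.
  move=> zS; rewrite normc_prod; apply: ler_prod => e _; rewrite normc_ge0 /= normcX.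
  rewrite ler_sqr ?nnegrE ?normc_ge0 ?addr_ge0 ?normc_ge0 //; last first.
    exact: le_trans (normc_ge0 _) zS.
  by apply: (le_trans (normc_leB _ _)); rewrite lerD2r.
pose H k z := G z ^+ k * P z.
have cH k z : c <= Re z -> cdiff (H k) z.
  move=> hz; case: (boolP (z \in E)) => zE; last first.
    exact: (cdiffM (cdiffX k (cG z hz zE)) (cP z)).
  have {}hz := Ec z zE.
  set S := normc z + 1; set Q := \prod_(e <- rem z E) (S + normc e) ^+ 2.
  have Q0 : 0 <= Q by apply: prodr_ge0 => e _; rewrite sqr_ge0.
  apply: (@cdiff_quadratic _ _ (Num.min 1 (Re z - c)) (B ^+ k * Q)).
  - by rewrite lt_min ltr01 subr_gt0.
  - by rewrite mulr_ge0 // exprn_ge0.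
  move=> h; rewrite lt_min => /andP[h1 h2]; rewrite /H.
  have [hE|hE] := boolP (z + h \in E).
    rewrite PE // mulr0 ComplexField.Normc.normc0 !mulr_ge0 ?exprn_ge0 ?normc_ge0 //.
  have hc : c <= Re (z + h).
    have := le_trans (ler_norm (- Re h)) _; rewrite normrN => /(_ _ (normc_ge_Re h)).
    have -> : Re (z + h) = Re z + Re h by case: (z) (h) => [? ?] [].
    lra.
  rewrite normcM normcX -mulrA; apply: ler_pM; rewrite ?normc_ge0 ?exprn_ge0 ?normc_ge0 //.
    by rewrite lerXn2r ?nnegrE ?normc_ge0 // GB.
  rewrite /P (big_rem z) //= normcM normcX addrAC subrr add0r mulrC ler_wpM2r ?sqr_ge0 //.
  by apply: Pbound; apply: (le_trans (normcD _ _)); rewrite lerD2l ltW.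
(* At distance L from the line Re z = c, or from the real axis, |g| >= d L = B / M', so the crude
   bound B on F already gives |G| <= M'. *)
pose L := B / (d * M').
have L0 : 0 <= L by rewrite divr_ge0 // mulr_ge0 // ltW.
pose x2 := Num.max c (Re z0) + L + 1; pose T := L + `|Im z0| + 1.
have m1 : c <= Num.max c (Re z0) by rewrite le_max lexx.
have m2 : Re z0 <= Num.max c (Re z0) by rewrite le_max lexx orbT.
have z0x : c < Re z0 < x2 by rewrite zc /x2; lra.
have z0y : - T < Im z0 < T.
  rewrite /T; have := ler_norm (Im z0); have := ler_norm (- Im z0); rewrite normrN; lra.
have zT : 0 <= T by rewrite /T; have := normr_ge0 (Im z0); lra.
have [K K0 HK] := cauchy_estimate z0x z0y.
set S := Num.max `|c| `|x2| + T.
set PB := \prod_(e <- E) (S + normc e) ^+ 2.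
have GM z : on_boundary c x2 (- T) T z -> z \notin E -> normc (G z) <= M'.
  move=> /andP[/andP[/andP[hz1 hz2] /andP[hz3 hz4]] hz] hE.
  have far : L <= Re z - c \/ L <= `|Im z| -> normc (G z) <= M'.
    move=> hL; rewrite /G normcf_div ler_pdivrMr ?gp //.
    apply: (le_trans (hB z hz1 hE)); rewrite -ler_pdivrMl //.
    have -> : M'^-1 * B = d * L.
      by rewrite /L; field; rewrite !gt_eqF.
    case: hL => hL.
      apply: le_trans (normc_ge_Re _); rewrite Reg; apply: le_trans (ler_norm _).
      have : d * L <= d * (Re z - c) by rewrite ler_pM2l.
      lra.
    apply: le_trans (normc_ge_Im _); rewrite Img normrM gtr0_norm //.
    by rewrite ler_pM2l.
  move: hz => /or4P[] /eqP hz.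
  - rewrite /G normcf_div ler_pdivrMr ?gp //; apply: (le_trans (hM z hz hE)).
    apply: (@le_trans _ _ M'); first by rewrite /M' lerDl ltW.
    by rewrite ler_peMr ?ng1 // ltW.
  - by apply: far; left; rewrite hz /x2; lra.
  - by apply: far; right; rewrite hz normrN ger0_norm // /T; have := normr_ge0 (Im z0); lra.
  - by apply: far; right; rewrite hz ger0_norm // /T; have := normr_ge0 (Im z0); lra.
have inS z : in_rect c x2 (- T) T z -> normc z <= S.
  move=> /andP[/andP[hz1 hz2] /andP[hz3 hz4]].
  apply: (le_trans (normc_le_ReIm _)); apply: lerD; last by rewrite ler_norml hz3.
  rewrite le_max; have [h|h] := leP 0 (Re z).
    by apply/orP; right; rewrite ger0_norm // (le_trans hz2) // ler_norm.
  apply/orP; left; rewrite (ltr0_norm h) (@ltr0_norm _ c) ?lerN2 //.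
  exact: le_lt_trans hz1 h.
have Hk k : normc (H k z0) <= K * (M' ^+ k * PB).
  apply: HK => [z /andP[/andP[hz _] _]|z hz]; first exact: cH.
  have PB0 : 0 <= PB by apply: prodr_ge0 => e _; rewrite sqr_ge0.
  have [hE|hE] := boolP (z \in E).
    by rewrite /H PE // mulr0 ComplexField.Normc.normc0 mulr_ge0 // exprn_ge0 // ltW.
  rewrite normcM normcX; apply: ler_pM; rewrite ?exprn_ge0 ?normc_ge0 //.
    by rewrite lerXn2r ?nnegrE ?normc_ge0 ?GM // ltW.
  by apply: Pbound; apply: inS; case/andP: hz.
have Pz : 0 < normc (P z0) by rewrite normc_gt0.
rewrite -[M']mul1r -ler_pdivrMr //.
apply: (@expr_bounded_le1 _ (K * PB / normc (P z0))).
  by rewrite divr_ge0 ?normc_ge0 // ltW.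
move=> k; rewrite ler_pdivlMr // expr_div_n mulrAC ler_pdivrMr ?exprn_gt0 //.
rewrite -normcX -normcM; apply: (le_trans (Hk k)).
by rewrite le_eqVlt; apply/orP; left; apply/eqP; ring.
Qed.

End HalfPlane.

(** * The Schur algorithm *)

Section SchurPick.
Variable R : realType.
Local Notation C := R[i].
Local Notation "x ^*" := (conjc x) : ring_scope.
Implicit Types (f g v : C -> C) (E s : seq C).

Definition pick_form f s v : C :=
  \sum_(x <- s) \sum_(y <- s) (v x)^* * v y * ((1 - (f x)^* * f y) / (x^* + y)).

(** E collects the nodes already divided out. The successive quotients have removable singularities
    there, and their values at these points, fixed by division by zero, carry no information. *)
Definition schur_off E (r : R) f :=
  (forall z, 0 < Re z -> z \notin E -> cdiff f z) /\
  (forall z, 0 < Re z -> z \notin E -> normc (f z) <= r).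

Lemma ReD (z w : C) : Re (z + w) = Re z + Re w.
Proof. by case: z w => [? ?] []. Qed.

Lemma Re_conjc (z : C) : Re z^* = Re z.
Proof. by case: z. Qed.

Lemma addc_conj_neq0 (z w : C) : 0 < Re z -> 0 < Re w -> z^* + w != 0.
Proof.
move=> z0 w0; apply/eqP => /(congr1 (@complex.Re R)) /eqP.
by rewrite ReD Re_conjc gt_eqF // addr_gt0.
Qed.

Lemma addc_conj_neq0r (z w : C) : 0 < Re z -> 0 < Re w -> z + w^* != 0.
Proof. by move=> z0 w0; rewrite addrC addc_conj_neq0. Qed.

Lemma seq_Re_lbound E : (forall e, e \in E -> 0 < Re e) ->
  exists2 m : R, 0 < m & forall e, e \in E -> m < Re e.
Proof.
elim: E => [|e E IH] hE; first by exists 1.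
have [|m m0 hm] := IH; first by move=> x xE; apply: hE; rewrite inE xE orbT.
have e0 : 0 < Re e by apply: hE; rewrite mem_head.
exists (Num.min m (Re e / 2)); first by rewrite lt_min m0 divr_gt0.
move=> x; rewrite inE gt_min => /predU1P[->|/hm ->//].
by apply/orP; right; rewrite ltr_pdivrMr // ltr_pMr // ltr1n.
Qed.

Lemma normc_moebius (w f : C) : 1 - w^* * f != 0 ->
  normc ((f - w) / (1 - w^* * f)) ^+ 2 =
  1 - (1 - normc w ^+ 2) * (1 - normc f ^+ 2) / normc (1 - w^* * f) ^+ 2.
Proof.
move=> n0; have n1 : normc (1 - w^* * f) ^+ 2 != 0 by rewrite expf_neq0 // normc_eq0.
rewrite normcf_div expr_div_n; apply: (mulIf n1); rewrite mulrBl !divfK // mul1r.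
rewrite !normc_sqr; case: w f {n0 n1} => [a b] [c d] /=; ring.
Qed.

(** From |z - a|^2 = |z + conj a|^2 - 4 Re z Re a and |z + conj a| >= Re a. The bound is uniform on
    a vertical line and tends to 1 as the line approaches Re z = 0. *)
Lemma blaschke_sqr (a z : C) : 0 < Re a -> 0 <= Re z ->
  1 - 4 * Re z / Re a <= normc ((z - a) / (z + a^*)) ^+ 2.
Proof.
move=> a0 z0; have n0 : 0 < normc (z + a^*) ^+ 2.
  rewrite exprn_gt0 // normc_gt0; apply/eqP => /(congr1 (@complex.Re R)) /eqP.
  by rewrite ReD Re_conjc gt_eqF // ltr_wpDl.
rewrite normcf_div expr_div_n ler_pdivlMr //.
have h : normc (z - a) ^+ 2 = normc (z + a^*) ^+ 2 - 4 * Re z * Re a.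
  by rewrite !normc_sqr; case: z a {a0 z0 n0} => [p q] [c d] /=; ring.
rewrite h mulrBl mul1r lerD2l lerN2.
rewrite [X in _ <= X]mulrAC ler_pdivlMr // -[X in X <= _]mulrA.
apply: ler_wpM2l; first exact: mulr_ge0.
rewrite -expr2.
apply: (@le_trans _ _ (Re (z + a^*) ^+ 2)); last first.
  by rewrite normc_sqr lerDl sqr_ge0.
by rewrite ReD Re_conjc ler_sqr ?nnegrE ?addr_ge0 ?(ltW a0) // lerDr.
Qed.

(** The bound stays strictly below 1, so the step can be iterated with all Moebius denominators
    bounded away from 0. *)
Lemma schur_step E (r : R) f (a : C) : 0 <= r -> r < 1 ->
  (forall e, e \in E -> 0 < Re e) -> schur_off E r f -> 0 < Re a -> a \notin E ->
  exists2 r' : R, 0 <= r' < 1 & schur_off (a :: E) r'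
    (fun z => (f z - f a) / (1 - (f a)^* * f z) / ((z - a) / (z + a^*))).
Proof.
move=> r0 r1 hE [cf bf] a0 aE; set w := f a.
have wr : normc w <= r := bf a a0 aE.
have r20 : 0 < 1 - r ^+ 2 by rewrite subr_gt0 expr_lt1.
have den z : 0 < Re z -> z \notin E -> 1 - r ^+ 2 <= normc (1 - w^* * f z).
  move=> z0 zE; have := normc_distl 1 (w^* * f z).
  rewrite ComplexField.Normc.normc1; apply: le_trans; rewrite lerD2l lerN2.
  by rewrite normcM normc_conj expr2 ler_pM ?normc_ge0 // bf.
have den0 z : 0 < Re z -> z \notin E -> 1 - w^* * f z != 0.
  by move=> z0 zE; rewrite -normc_gt0 (lt_le_trans r20) // den.
pose u z := (f z - w) / (1 - w^* * f z).
pose b z := (z - a) / (z + a^*).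
(* In [normc_moebius] the numerator is at least (1 - r^2)^2 and the denominator is at most 2^2. *)
pose p2 := 1 - (1 - r ^+ 2) ^+ 2 / 4.
have p20 : 0 <= p2.
  rewrite /p2 subr_ge0 ler_pdivrMr // mul1r.
  have h : 1 - r ^+ 2 <= 1 by rewrite lerBlDr lerDl sqr_ge0.
  have := ler_pM (ltW r20) (ltW r20) h h; rewrite mulr1 -expr2; lra.
have p21 : p2 < 1 by rewrite /p2 gtrBl divr_gt0 // exprn_gt0.
have ub z : 0 < Re z -> z \notin E -> normc (u z) ^+ 2 <= p2.
  move=> z0 zE; rewrite /u normc_moebius ?den0 // /p2 lerD2l lerN2.
  have f1 : normc (f z) <= r by exact: bf.
  have sq (x : C) : normc x <= r -> 1 - r ^+ 2 <= 1 - normc x ^+ 2.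
    by move=> h; rewrite lerD2l lerN2 ler_sqr ?nnegrE ?normc_ge0.
  apply: ler_pM; rewrite ?sqr_ge0 ?invr_ge0 ?ler0n //.
    by rewrite expr2; apply: ler_pM; rewrite ?(ltW r20) ?sq.
  have d0 : 0 < normc (1 - w^* * f z) by rewrite normc_gt0 den0.
  rewrite lef_pV2 ?posrE ?exprn_gt0 //.
  have -> : 4 = 2 ^+ 2 :> R by rewrite -natrX.
  rewrite ler_sqr ?nnegrE ?normc_ge0 //.
  apply: (le_trans (normc_leB _ _)); rewrite ComplexField.Normc.normc1.
  rewrite normcM normc_conj.
  have : normc w * normc (f z) <= r * r by rewrite ler_pM ?normc_ge0.
  have : r * r <= 1 * 1 by rewrite ler_pM // ltW.
  lra.
(* On Re z = c the Blaschke factor b has modulus close to 1 for small c, so any q with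
   sup |u| < q < 1 also bounds u / b there. *)
have [q2 [q20 q21 pq]] : exists q2 : R, [/\ 0 < q2, q2 < 1 & p2 < q2].
  by exists ((1 + p2) / 2); move: (p2) p20 p21 => p p0 p1; split; lra.
pose q := Num.sqrt q2.
have qE : q ^+ 2 = q2 by rewrite sqr_sqrtr // ltW.
have q0 : 0 <= q by exact: sqrtr_ge0.
exists q; first by rewrite q0 -(@ltr_pXn2r _ 2) ?nnegrE // qE expr1n.
have zan0 z : 0 < Re z -> z + a^* != 0 by move=> z0; exact: addc_conj_neq0r.
have bn0 z : 0 < Re z -> z \notin a :: E -> b z != 0.
  move=> z0; rewrite inE negb_or => /andP[za _].
  by rewrite /b mulf_neq0 ?invr_eq0 ?zan0 // subr_eq0.
have inE' z : z \notin a :: E -> z != a /\ z \notin E.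
  by rewrite inE negb_or => /andP.
have cu z : 0 < Re z -> z \notin E -> cdiff u z.
  move=> z0 zE; apply: cdiff_div; first exact: den0.
    exact: (cdiffB (cf z z0 zE) (cdiff_cst w z)).
  exact: (cdiffB (cdiff_cst 1 z) (cdiffM (cdiff_cst w^* z) (cf z z0 zE))).
have cb z : 0 < Re z -> cdiff b z.
  move=> z0; apply: cdiff_div; first exact: zan0.
    exact: (cdiffB (cdiff_id z) (cdiff_cst a z)).
  exact: (cdiffD (cdiff_id z) (cdiff_cst a^* z)).
have cg z : 0 < Re z -> z \notin a :: E -> cdiff (fun z => u z / b z) z.
  move=> z0 zE; have [za zE'] := inE' z zE.
  exact: (cdiff_div (bn0 z z0 zE) (cu z z0 zE') (cb z z0)).
split=> [//|z z0 zE].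
(* The maximum principle needs some a priori bound. Near a it comes from the difference quotient of
   f, away from a from |u| <= 1 and |y + conj a| / |y - a| <= 1 + A / del. *)
have [B HB] : exists B : R, forall z, 0 < Re z -> z \notin a :: E -> normc (u z / b z) <= B.
  have /cdiffP[d /(_ 1 ltr01)[del del0 Hd]] := cf a a0 aE.
  pose A := 2 * normc a.
  have A0 : 0 <= A by rewrite mulr_ge0 ?normc_ge0.
  have zaA y : normc (y + a^*) <= normc (y - a) + A.
    have -> : y + a^* = (y - a) + (a + a^*) by ring.
    apply: (le_trans (normcD _ _)); rewrite lerD2l.
    by apply: (le_trans (normcD _ _)); rewrite normc_conj /A; lra.
  exists (Num.max ((1 + normc d) / (1 - r ^+ 2) * (del + A)) (1 + A / del)).
  move=> y y0 yE; have [ya yE'] := inE' y yE.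
  have ya0 : 0 < normc (y - a) by rewrite normc_gt0 subr_eq0.
  have -> : u y / b y = (f y - w) / (1 - w^* * f y) * (y + a^*) / (y - a).
    by rewrite /u /b invf_div mulrA.
  rewrite normcf_div le_max.
  have [h|h] := ltP (normc (y - a)) del.
    apply/orP; left; rewrite ler_pdivrMr // normcM.
    have := Hd (y - a) h; rewrite (addrC a) subrK mul1r => hh.
    have f1 : normc (f y - w) <= (1 + normc d) * normc (y - a).
      have -> : f y - w = (f y - w - d * (y - a)) + d * (y - a) by ring.
      by apply: (le_trans (normcD _ _)); rewrite normcM; lra.
    rewrite normcf_div.
    have f2 : normc (f y - w) / normc (1 - w^* * f y) <=
        (1 + normc d) * normc (y - a) / (1 - r ^+ 2).
      apply: ler_pM; rewrite ?normc_ge0 ?invr_ge0 ?normc_ge0 //.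
      by rewrite lef_pV2 ?posrE ?den // normc_gt0 den0.
    have f3 : normc (y + a^*) <= del + A by apply: (le_trans (zaA y)); rewrite lerD2r ltW.
    apply: (le_trans (ler_pM _ _ f2 f3)); rewrite ?normc_ge0 ?divr_ge0 ?normc_ge0 //.
    by rewrite le_eqVlt; apply/orP; left; apply/eqP; ring.
  apply/orP; right; rewrite ler_pdivrMr // normcM.
  have f1 : normc ((f y - w) / (1 - w^* * f y)) <= 1.
    rewrite -(@ler_pXn2r _ 2) ?nnegrE ?normc_ge0 // expr1n.
    by apply: (le_trans (ub y y0 yE')); exact: ltW.
  apply: (@le_trans _ _ (normc (y - a) + A)).
    by apply: (le_trans _ (zaA y)); rewrite ler_piMl ?normc_ge0.
  rewrite mulrDl mul1r lerD2l mulrAC -[A in A <= _]mulr1 -mulrA ler_wpM2l //.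
  by rewrite ler_pdivlMr // mul1r.
have [m m0 hm] : exists2 m : R, 0 < m & forall e, e \in z :: a :: E -> m < Re e.
  apply: seq_Re_lbound => e; rewrite !inE => /or3P[/eqP->|/eqP->|/hE] //.
(* By [blaschke_sqr] the second condition gives |u|^2 <= q2 |b|^2 on Re z = c; the first puts z, a
   and E to the right of that line. *)
have [c c0 [cm cq]] : exists2 c : R, 0 < c & c <= m /\ p2 <= q2 * (1 - 4 * c / Re a).
  exists (Num.min m (Re a * (q2 - p2) / (4 * q2))).
    rewrite lt_min m0 /=; have h : 0 < q2 - p2 by rewrite subr_gt0.
    by apply: divr_gt0; apply: mulr_gt0.
  split; first by rewrite ge_min lexx.
  set c := Num.min _ _.
  have : c <= Re a * (q2 - p2) / (4 * q2) by rewrite /c ge_min lexx orbT.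
  rewrite ler_pdivlMr ?mulr_gt0 // => h.
  have : q2 * (4 * c / Re a) <= q2 - p2.
    by rewrite mulrA ler_pdivrMr // mulrC [X in _ <= X]mulrC; apply: le_trans h; lra.
  lra.
have pos y : c <= Re y -> 0 < Re y by exact: lt_le_trans.
apply: (@half_plane_max _ (a :: E) (fun z => u z / b z) c B q) => //.
- by move=> e eE; apply: (le_lt_trans cm); apply: hm; rewrite inE eE orbT.
- by move=> y /pos y0 yE; exact: cg.
- by move=> y /pos y0 yE; exact: HB.
- move=> y yc yE; have y0 : 0 < Re y by rewrite yc.
  have [ya yE'] := inE' y yE.
  rewrite -(@ler_pXn2r _ 2) ?nnegrE ?normc_ge0 // qE normcf_div expr_div_n.
  have b0 : 0 < normc (b y) ^+ 2 by rewrite exprn_gt0 // normc_gt0 bn0.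
  rewrite ler_pdivrMr //; apply: (le_trans (ub y y0 yE')); apply: (le_trans cq).
  by rewrite ler_pM2l // -yc blaschke_sqr // ltW.
- by apply: (le_trans cm); apply: ltW; apply: hm; rewrite mem_head.
Qed.

(** The Moebius map multiplies the kernel 1 - conj(fx) fy by a constant and by one factor in x and
    one in y. For the Blaschke factor b, (1 - conj(b x) b y) / (conj x + y) = (a + conj a) / ((conj
    x + a) (y + conj a)) has rank one. Writing u = b g separates this rank-one part from the Pick
    kernel of g. Here gx and gy are free, because at the node a the equation u = b g reads 0 = 0. *)
Lemma pick_term_identity (fx fy w x y a c d gx gy : C) :
  x^* + y != 0 -> x + a^* != 0 -> y + a^* != 0 -> 1 - w^* * fx != 0 -> 1 - w^* * fy != 0 ->
  (fx - w) / (1 - w^* * fx) = (x - a) / (x + a^*) * gx ->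
  (fy - w) / (1 - w^* * fy) = (y - a) / (y + a^*) * gy ->
  (1 - w^* * w) * (c^* * d * ((1 - fx^* * fy) / (x^* + y))) =
  (a + a^*) * (((1 - w^* * fx) * c / (x + a^*))^* * ((1 - w^* * fy) * d / (y + a^*))) +
  ((x - a) / (x + a^*) * ((1 - w^* * fx) * c))^* * ((y - a) / (y + a^*) * ((1 - w^* * fy) * d))
   * ((1 - gx^* * gy) / (x^* + y)).
Proof.
move=> n1 n2 n3 n4 n5 hx hy.
have -> : ((x - a) / (x + a^*) * ((1 - w^* * fx) * c))^* *
     ((y - a) / (y + a^*) * ((1 - w^* * fy) * d))
   * ((1 - gx^* * gy) / (x^* + y)) =
  ((1 - w^* * fx) * c)^* * ((1 - w^* * fy) * d) *
  (((x - a) / (x + a^*))^* * ((y - a) / (y + a^*)) -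
   ((x - a) / (x + a^*) * gx)^* * ((y - a) / (y + a^*) * gy)) / (x^* + y).
  by rewrite !conjcM; ring.
rewrite -hx -hy.
have m2 : x^* + a != 0 by rewrite -(conjcK a) -conjcD conjc_eq0.
have m4 : 1 - w * fx^* != 0.
  by rewrite -(conjcK w) -conjcM -conjc1 -conjcB conjc_eq0.
rewrite !(conjcf_div, conjcM, conjcB, conjcD, conjc1) !conjcK.
field; rewrite n1 n3 n5 m2 m4 //.
Qed.

(** Induction on the nodes: up to a positive constant, the form of f at a :: s is a nonnegative
    rank-one term plus the form of the Schur quotient g, in which the node a has dropped out. *)
Theorem pick_form_ge0 s E (r : R) f v : 0 <= r -> r < 1 ->
  (forall e, e \in E -> 0 < Re e) -> schur_off E r f ->
  uniq s -> (forall x, x \in s -> 0 < Re x /\ x \notin E) ->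
  0 <= pick_form f s v.
Proof.
elim: s E r f v => [|a s IH] E r f v r0 r1 hE hf.
  by rewrite /pick_form big_nil.
move=> /= /andP[as_ us] hs; have [a0 aE] := hs a (mem_head _ _).
have [r' /andP[r'0 r'1] hg] := schur_step r0 r1 hE hf a0 aE.
set w := f a in hg.
pose b z := (z - a) / (z + a^*).
pose u z := (f z - w) / (1 - w^* * f z).
set g := fun z => _ in hg.
have wr : normc w <= r := hf.2 a a0 aE.
have den0 z : z \in a :: s -> 1 - w^* * f z != 0.
  move=> /hs[z0 zE]; apply/eqP => /eqP; rewrite subr_eq0 => /eqP.
  move=> /(congr1 (@ComplexField.Normc.normc R)).
  rewrite ComplexField.Normc.normc1 normcM normc_conj => h.
  have : normc w * normc (f z) <= r * 1.
    by apply: ler_pM; rewrite ?normc_ge0 // (le_trans (hf.2 z z0 zE)) // ltW.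
  by rewrite -h mulr1 leNgt r1.
have ug x : x \in a :: s -> u x = b x * g x.
  rewrite inE => /predU1P[->|xs]; first by rewrite /u /b !subrr !mul0r.
  have [x0 xE] : 0 < Re x /\ x \notin E by apply: hs; rewrite inE xs orbT.
  rewrite /g -/(b x) mulrC divfK //.
  rewrite /b mulf_neq0 ?invr_eq0 ?addc_conj_neq0r // subr_eq0.
  by apply: contraNneq as_ => <-.
have kE : 1 - w^* * w = (1 - normc w ^+ 2)%:C by rewrite mulcJ rmorphB.
have k0 : 0 < 1 - w^* * w.
  rewrite kE ltcR subr_gt0 expr_lt1 ?normc_ge0 //; exact: le_lt_trans r1.
rewrite -(pmulr_rge0 _ k0).
pose V x := (1 - w^* * f x) * v x.
have -> : (1 - w^* * w) * pick_form f (a :: s) v =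
    (a + a^*) * ((\sum_(x <- a :: s) V x / (x + a^*))^* * \sum_(x <- a :: s) V x / (x + a^*))
    + pick_form g (a :: s) (fun x => b x * V x).
  rewrite /pick_form conjc_sum mulr_suml !mulr_sumr -big_split /=.
  apply: eq_big_seq => x xs; rewrite !mulr_sumr -big_split /=.
  apply: eq_big_seq => y ys.
  have [[x0 _] [y0 _]] := (hs x xs, hs y ys).
  rewrite (@pick_term_identity (f x) (f y) w x y a (v x) (v y) (g x) (g y)) //.
  - exact: addc_conj_neq0.
  - exact: addc_conj_neq0r.
  - exact: addc_conj_neq0r.
  - exact: den0.
  - exact: den0.
  - exact: ug.
  - exact: ug.
(* The coefficient b a vanishes, so the meaningless value g a never counts. *)
have -> : pick_form g (a :: s) (fun x => b x * V x) = pick_form g s (fun x => b x * V x).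
  have ba : b a = 0 by rewrite /b subrr mul0r.
  rewrite /pick_form big_cons [X in X + _]big1 ?add0r; last first.
    by move=> y _; rewrite ba !mul0r conjc0 !mul0r.
  apply: eq_bigr => x _; rewrite big_cons ba !mul0r mulr0 mul0r add0r //.
apply: addr_ge0.
  rewrite addcJ -mulrA; apply: mulr_ge0; first by rewrite ler0n.
  apply: mulr_ge0; first by rewrite lecR ltW.
  by rewrite mulrC mulcJ_ge0.
apply: (IH (a :: E) r' g) => //.
  by move=> e; rewrite inE => /predU1P[->|/hE].
move=> x xs; have [x0 xE] : 0 < Re x /\ x \notin E by apply: hs; rewrite inE xs orbT.
split=> //; rewrite inE negb_or xE andbT.
by apply: contraNneq as_ => <-.
Qed.

(* Apply the previous theorem to r f with r < 1 and let r tend to 1. *)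
Theorem pick_form_ge0_unit s f v :
  (forall z, 0 < Re z -> cdiff f z) -> (forall z, 0 < Re z -> normc (f z) <= 1) ->
  uniq s -> (forall x, x \in s -> 0 < Re x) -> 0 <= pick_form f s v.
Proof.
move=> cf bf us hs.
have key (r : R) : 0 <= r -> r < 1 -> 0 <= pick_form (fun z => r%:C * f z) s v.
  move=> r0 r1; apply: (@pick_form_ge0 s [::] r) => //.
    split=> z z0 _; first exact: (cdiffM (cdiff_cst r%:C z) (cf z z0)).
    by rewrite normcM normcR ger0_norm // ler_piMr // bf.
  by move=> x /hs.
pose A := \sum_(x <- s) \sum_(y <- s) (v x)^* * v y / (x^* + y).
pose B := \sum_(x <- s) \sum_(y <- s) (v x)^* * v y * ((f x)^* * f y / (x^* + y)).
have E (r : R) : pick_form (fun z => r%:C * f z) s v = A - (r ^+ 2)%:C * B.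
  rewrite /pick_form /A /B mulr_sumr -sumrB; apply: eq_bigr => x _.
  rewrite mulr_sumr -sumrB; apply: eq_bigr => y _.
  by rewrite conjcM conjc_real rmorphXn /=; ring.
have -> : pick_form f s v = A - B.
  transitivity (pick_form (fun z => (1 : R)%:C * f z) s v).
    by congr pick_form; apply/funext => z; rewrite (mul1r (f z)).
  by rewrite E expr1n (mul1r B).
have AB (r : R) : 0 <= r -> r < 1 -> Im A - r ^+ 2 * Im B = 0 /\ 0 <= Re A - r ^+ 2 * Re B.
  move=> r0 r1; have := key r r0 r1; rewrite E ge0c.
  case: (A) (B) => [a1 a2] [b1 b2] /=; rewrite !mul0r subr0 addr0 => /andP[/eqP h1 h2].
  by rewrite h1.
have iA : Im A = 0 by have [] := AB 0 (lexx _) ltr01; rewrite expr0n mul0r subr0.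
have iB : Im B = 0.
  have h0 : 0 <= 2^-1 :> R by rewrite invr_ge0.
  have h1 : 2^-1 < 1 :> R by rewrite invf_lt1 // ltr1n.
  have [h _] := AB _ h0 h1.
  move: h; rewrite iA sub0r => /eqP; rewrite oppr_eq0 mulf_eq0 expf_eq0 /= invr_eq0.
  by rewrite pnatr_eq0 /= => /eqP.
rewrite ge0c ImB iA iB subrr eqxx /= ReB.
rewrite leNgt; apply/negP => lt0.
have rA : 0 <= Re A by have [_] := AB 0 (lexx _) ltr01; rewrite expr0n mul0r subr0.
have rB : 0 < Re B by lra.
have t0 : Re A / Re B < 1 by rewrite ltr_pdivrMr // mul1r; lra.
have t1 : 0 <= Re A / Re B by rewrite divr_ge0 // ltW.
(* If Re A < Re B, then r^2 = q lies strictly between Re A / Re B and 1, and A - r^2 B would be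
   negative for an admissible r. *)
pose q := (1 + Re A / Re B) / 2.
have q1 : q < 1 by rewrite /q; lra.
have q0 : 0 < q by rewrite /q; lra.
have sq1 : Num.sqrt q < 1 by rewrite -sqrtr1 ltr_sqrt.
have [_] := AB (Num.sqrt q) (sqrtr_ge0 _) sq1.
rewrite sqr_sqrtr ?(ltW q0) //.
have : Re A < q * Re B by rewrite -ltr_pdivrMr // /q; lra.
lra.
Qed.

End SchurPick.

(** * Bounded Dirichlet series *)

Section VerticalAverage.
Variable R : realType.
Local Notation C := R[i].
Local Notation "x ^*" := (conjc x) : ring_scope.
Implicit Types (F G H : C -> C) (ts : seq R) (z : C).

(* Averaging over z and z + i t annihilates the exponentials whose frequency l satisfies
   t l = pi; finitely many such averages replace the mean value over vertical lines. *)
Fixpoint vavg ts H : C -> C :=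
  if ts is t :: ts' then fun z => (vavg ts' H z + vavg ts' H (z + 0 +i* t)) / 2
  else H.

Lemma Re_addiy z (t : R) : Re (z + 0 +i* t) = Re z.
Proof. by case: z => a b /=; rewrite addr0. Qed.

Lemma vavg_cdiff ts H (c : R) : (forall z, c < Re z -> cdiff H z) ->
  forall z, c < Re z -> cdiff (vavg ts H) z.
Proof.
move=> hH; elim: ts => [|t ts IH] z hz /=; first exact: hH.
have h2 : cdiff (fun w => vavg ts H (w + 0 +i* t)) z.
  have -> : (fun w => vavg ts H (w + 0 +i* t)) = (fun w => vavg ts H (1 * w + 0 +i* t)).
    by apply/funext => w; rewrite mul1r.
  by apply: cdiff_affine; apply: IH; rewrite mul1r Re_addiy.
exact: (cdiffM (cdiffD (IH z hz) h2) (cdiff_cst 2^-1 z)).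
Qed.

Lemma normc2 : normc (2 : C) = 2.
Proof. by rewrite -[2](rmorph_nat (real_complex R)) /= normcR normr_nat. Qed.

Lemma Re_half z : Re (z / 2) = Re z / 2.
Proof.
rewrite -[X in z / X](rmorph_nat (real_complex R)) -(fmorphV (real_complex R)) /=.
by case: z => a b /=; rewrite mulr0 subr0.
Qed.

(** Vertical shifts preserve Re z, so a comparison on one line survives averaging. G is complex
    valued so that its average can be computed term by term with the same operator. *)
Lemma vavg_majorant ts F G (x : R) :
  (forall z, Re z = x -> normc (F z) <= Re (G z)) ->
  forall z, Re z = x -> normc (vavg ts F z) <= Re (vavg ts G z).
Proof.
move=> h; elim: ts => [|t ts IH] z zx /=; first exact: h.
rewrite normcf_div normc2 Re_half ler_pM2r ?invr_gt0 //.
by rewrite ReD; apply: (le_trans (normcD _ _)); rewrite lerD ?IH ?Re_addiy.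
Qed.

Lemma vavg_cst ts (k : C) z : vavg ts (fun=> k) z = k.
Proof.
by elim: ts z => [//|t ts IH] z /=; rewrite !IH; field.
Qed.

Lemma vavg_bound ts F (x B : R) : (forall z, Re z = x -> normc (F z) <= B) ->
  forall z, Re z = x -> normc (vavg ts F z) <= B.
Proof.
move=> h z zx; have := @vavg_majorant ts F (fun=> B%:C) x h z zx.
by rewrite vavg_cst.
Qed.

Lemma vavgD ts F G z : vavg ts (fun w => F w + G w) z = vavg ts F z + vavg ts G z.
Proof. by by elim: ts z => [//|t ts IH] z /=; rewrite !IH; field. Qed.

Lemma vavgZ ts (k : C) F z : vavg ts (fun w => k * F w) z = k * vavg ts F z.
Proof. by by elim: ts z => [//|t ts IH] z /=; rewrite !IH; field. Qed.

Lemma vavg_sum ts (I : Type) (r : seq I) (P : pred I) (F : I -> C -> C) z :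
  vavg ts (fun w => \sum_(i <- r | P i) F i w) z = \sum_(i <- r | P i) vavg ts (F i) z.
Proof.
elim: r => [|i r IH].
  rewrite big_nil -[RHS](vavg_cst ts 0 z); congr vavg; apply/funext => w.
  by rewrite big_nil.
have -> : (fun w => \sum_(i <- i :: r | P i) F i w) =
   (fun w => (if P i then F i w else 0) + \sum_(i <- r | P i) F i w).
  by apply/funext => w; rewrite big_cons; case: (P i); rewrite ?add0r.
rewrite vavgD IH big_cons; case: (P i) => //.
by rewrite vavg_cst add0r.
Qed.

(** A shift by t multiplies F by exp (i pi) = -1. Averages over other shifts keep this
    antiperiodicity, so the position of t in the list does not matter. *)
Lemma vavg_kill ts F (l t : R) : t \in ts -> t * l = pi ->
  (forall z u, F (z + 0 +i* u) = cexp (0 +i* (u * l)) * F z) ->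
  forall z, vavg ts F z = 0.
Proof.
move=> tts tl hF.
elim: ts tts => [//|u ts IH]; rewrite inE => /predU1P[<-|/IH{}IH] z /=; last first.
  by rewrite !IH addr0 mul0r.
have gen ts' : forall z, vavg ts' F (z + 0 +i* t) = - vavg ts' F z.
  elim: ts' => [|v ts' IH'] y /=.
    rewrite hF tl /cexp /= expR0 cospi sinpi mulr0 mul1r; case: (F y) => p q.
    by apply/eqP; rewrite eq_complex /= !mul0r subr0 addr0 !mulN1r !eqxx.
  by rewrite IH' addrAC IH' -opprD mulNr.
by rewrite gen subrr mul0r.
Qed.

End VerticalAverage.

(** * Elementary estimates for exponentials, logarithms and reciprocal squares *)

Section RealLimits.
Variable R : realType.

Lemma expRN_le1 (x : R) : 0 <= x -> expR (- x) <= 1.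
Proof. by move=> x0; rewrite -[1]expR0 ler_expR oppr_le0. Qed.

Lemma expR_decay (d B e : R) : 0 < d -> 0 <= B -> 0 < e ->
  exists x0 : R, 0 <= x0 /\ forall x, x0 <= x -> B * expR (- (x * d)) <= e.
Proof.
move=> d0 B0 e0; exists (B / (e * d)); split; first by rewrite divr_ge0 // mulr_ge0 // ltW.
move=> x; rewrite ler_pdivrMr ?mulr_gt0 // => hx.
have x0 : 0 <= x.
  rewrite leNgt; apply/negP => x0; have : x * (e * d) < 0 by rewrite nmulr_rlt0 // mulr_gt0.
  lra.
rewrite expRN ler_pdivrMr ?expR_gt0 //; apply: (le_trans hx).
have -> : x * (e * d) = e * (x * d) by ring.
rewrite ler_pM2l //; have := expR_ge1Dx (x * d); lra.
Qed.

Lemma expR_small (l e : R) : 0 <= l -> 0 < e -> exists2 d : R, 0 < d & expR (d * l) <= 1 + e.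
Proof.
move=> l0 e0; have e1 : 0 < 1 + e by rewrite addr_gt0.
have le0 : 0 < ln (1 + e) by rewrite ln_gt0 // ltrDl.
exists (ln (1 + e) / (l + 1)); first by rewrite divr_gt0 // ltr_wpDl.
rewrite -[X in _ <= X]lnK ?posrE // ler_expR mulrAC ler_pdivrMr ?ltr_wpDl //.
by rewrite ler_pM2l // lerDl.
Qed.

Lemma ln_nat_ge0 (n : nat) : 0 <= ln (n%:R : R).
Proof. by case: n => [|n]; [rewrite ln0 | rewrite ln_ge0 // ler1n]. Qed.

Lemma ln_nat_le (m n : nat) : (0 < m)%N -> (m <= n)%N -> ln (m%:R : R) <= ln n%:R.
Proof. by move=> m0 mn; rewrite ler_ln ?posrE ?ltr0n ?ler_nat // (leq_trans m0). Qed.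

Lemma ln_nat_lt (m n : nat) : (0 < m)%N -> (m < n)%N -> ln (m%:R : R) < ln n%:R.
Proof. by move=> m0 mn; rewrite ltr_ln ?posrE ?ltr0n ?ltr_nat // (leq_trans m0) // ltnW. Qed.

Lemma sum_inv_sqr (m n : nat) : \sum_(m <= k < n) expR (- 2 * ln (k.+1%:R : R)) <= 2.
Proof.
(* The correction term makes the induction telescope: 1 / x^2 <= 2 / (x (x + 1)) for x >= 1. *)
have key (p : nat) : \sum_(0 <= k < p) expR (- 2 * ln (k.+1%:R : R)) <= 2 - 2 / p.+1%:R.
  elim: p => [|p IH]; first by rewrite big_geq // divr1 subrr.
  rewrite big_nat_recr //=; apply: (le_trans (lerD IH (lexx _))).
  have -> : expR (- 2 * ln (p.+1%:R : R)) = p.+1%:R ^- 2.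
    by rewrite mulNr expRN mulrC expRM_natr lnK // posrE ltr0n.
  rewrite -[p.+2%:R]natr1; set x : R := p.+1%:R.
  have x1 : 1 <= x by rewrite ler1n.
  have x0 : 0 < x by lra.
  have -> : 2 - 2 / (x + 1) = 2 - 2 / x + 2 / (x * (x + 1)) by field; rewrite !gt_eqF //; lra.
  rewrite lerD2l -[_ ^- 2]mul1r ler_pdivrMr ?exprn_gt0 // mulrAC.
  rewrite ler_pdivlMr ?mulr_gt0 //; last by lra.
  by rewrite mul1r expr2; nra.
apply: le_trans (_ : \sum_(0 <= k < n) expR (- 2 * ln (k.+1%:R : R)) <= _).
  have [mn|nm] := leqP m n; last first.
    by rewrite big_geq ?(ltnW nm) //; apply: sumr_ge0 => k _; exact: expR_ge0.
  rewrite [X in _ <= X](big_cat_nat _ mn) //= lerDr.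
  by apply: sumr_ge0 => k _; exact: expR_ge0.
by apply: (le_trans (key n)); rewrite gerBl divr_ge0.
Qed.

Lemma cvg_normcP (u : nat -> R[i]) (l : R[i]) :
  (u : nat -> R[i]^o) @ \oo --> (l : R[i]^o) <->
  forall e : R, 0 < e -> exists N, forall n, (N <= n)%N -> normc (l - u n) <= e.
Proof.
split=> [/cvgrPdist_le H e e0|H].
  have e0' : (0 : R[i]) < e%:C by rewrite ltcR.
  have [N _ hN] := H _ e0'; exists N => n Nn.
  by have := hN n Nn; rewrite normE lecR.
apply/cvgrPdist_le => e /gt0c[-> e0]; have [N hN] := H _ e0.
by exists N => // n /= Nn; rewrite normE lecR; exact: hN.
Qed.

End RealLimits.

(** * The powers n^s and n^-s *)

Section DirichletPower.
Variable R : realType.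
Local Notation C := R[i].
Local Notation "x ^*" := (conjc x) : ring_scope.

Definition npow (n : nat) (s : C) : C := cexp ((ln (n%:R : R))%:C * s).

Lemma nat_cpowNE n s : nat_cpowN n s = cexp (- (ln (n%:R : R))%:C * s).
Proof.
have h1 : Re (- (ln (n%:R : R))%:C * s) = - Re s * ln n%:R.
  by case: s => a b /=; ring.
have h2 : Im (- (ln (n%:R : R))%:C * s) = - (Im s * ln n%:R).
  by case: s {h1} => a b /=; ring.
by rewrite /nat_cpowN /cexp h1 h2 cosN sinN mulrN.
Qed.

Lemma Re_realM (r : R) (s : C) : Re (r%:C * s) = r * Re s.
Proof. by case: s => a b /=; rewrite mul0r subr0. Qed.

Lemma normc_nat_cpowN n (s : C) : normc (nat_cpowN n s) = expR (- (Re s * ln n%:R)).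
Proof. by rewrite nat_cpowNE normc_cexp -rmorphN Re_realM mulNr mulrC. Qed.

Lemma normc_npow n (s : C) : normc (npow n s) = expR (Re s * ln n%:R).
Proof. by rewrite /npow normc_cexp Re_realM mulrC. Qed.

Lemma cdiff_cexpZ (k : C) z : cdiff (fun w => cexp (k * w)) z.
Proof.
have -> : (fun w => cexp (k * w)) = (fun w => cexp (k * w + 0)).
  by apply/funext => w; rewrite addr0.
by apply: cdiff_affine; exact: cdiff_cexp.
Qed.

Lemma cdiff_nat_cpowN n z : cdiff (@nat_cpowN R n) z.
Proof.
have -> : @nat_cpowN R n = (fun w => cexp (- (ln (n%:R : R))%:C * w)).
  by apply/funext => w; rewrite nat_cpowNE.
exact: cdiff_cexpZ.
Qed.

Lemma cdiff_npow n z : cdiff (@npow n) z.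
Proof. exact: cdiff_cexpZ. Qed.

Lemma nat_cpowNM (m n : nat) (s : C) : (0 < m)%N -> (0 < n)%N ->
  nat_cpowN (m * n) s = nat_cpowN m s * nat_cpowN n s.
Proof.
move=> m0 n0; rewrite !nat_cpowNE -cexpD natrM lnM ?posrE ?ltr0n // rmorphD /=.
by congr cexp; ring.
Qed.

Lemma nat_cpowN_conj n (s : C) : (nat_cpowN n s)^* = nat_cpowN n s^*.
Proof. by rewrite !nat_cpowNE cexp_conj conjcM -!rmorphN conjc_real. Qed.

Lemma nat_cpowN_add n (s t : C) : nat_cpowN n (s + t) = nat_cpowN n s * nat_cpowN n t.
Proof. by rewrite !nat_cpowNE mulrDr cexpD. Qed.

End DirichletPower.

(** * Coefficients and partial sums of a bounded Dirichlet series *)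

Section DirichletSeries.
Variable R : realType.
Local Notation C := R[i].
Local Notation "x ^*" := (conjc x) : ring_scope.
Variables (phi : C -> C) (a : nat -> C) (sigma : R).
Hypothesis phi_diff : forall z, 0 < Re z -> cdiff phi z.
Hypothesis phi_le1 : forall z, 0 < Re z -> normc (phi z) <= 1.
Hypothesis phi_series : forall s : C, sigma < Re s ->
  series (fun k : nat => (a k.+1 * nat_cpowN k.+1 s : R[i]^o)) @ \oo --> (phi s : R[i]^o).

Definition dpart (K : nat) (z : C) : C := \sum_(0 <= k < K) a k.+1 * nat_cpowN k.+1 z.

Lemma dpart_cvg (s : C) : sigma < Re s -> forall e : R, 0 < e ->
  exists N, forall n, (N <= n)%N -> normc (phi s - dpart n s) <= e.
Proof. by move=> /phi_series /cvg_normcP. Qed.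

Lemma dpart_cdiff K z : cdiff (dpart K) z.
Proof.
apply: (@cdiff_sum _ _ _ (fun k w => a k.+1 * nat_cpowN k.+1 w)) => k.
exact: (cdiffM (cdiff_cst _ z) (cdiff_nat_cpowN _ z)).
Qed.

Lemma coef_growth : exists (s0 B : R), [/\ 0 <= s0, sigma < s0, 0 <= B &
  forall k, normc (a k.+1) <= B * expR (s0 * ln (k.+1%:R : R))].
Proof.
pose s0 := Num.max 0 sigma + 1.
have m1 : 0 <= Num.max 0 sigma by rewrite le_max lexx.
have m2 : sigma <= Num.max 0 sigma by rewrite le_max lexx orbT.
have s1 : 0 <= s0 by rewrite /s0; lra.
have s2 : sigma < s0 by rewrite /s0; lra.
pose T k : R := normc (a k.+1 * nat_cpowN k.+1 s0%:C).
have T0 k : 0 <= T k by exact: normc_ge0.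
have [N hN] := dpart_cvg (s := s0%:C) s2 ltr01.
(* A term either occurs among the first N or is the difference of two partial sums, each within 1 of
   the limit. *)
have TB k : T k <= \sum_(0 <= j < N) T j + 2.
  have [kN|Nk] := ltnP k N.
    rewrite (big_cat_nat (n := k)) ?(ltnW kN) //= [X in _ + X + 2]big_ltn //=.
    have := @sumr_ge0 R _ (index_iota 0 k) xpredT T (fun j _ => T0 j).
    have := @sumr_ge0 R _ (index_iota k.+1 N) xpredT T (fun j _ => T0 j).
    lra.
  have h1 := hN k Nk; have h2 := hN k.+1 (leq_trans Nk (leqnSn k)).
  have -> : T k = normc ((phi s0%:C - dpart k s0%:C) - (phi s0%:C - dpart k.+1 s0%:C)).
    by rewrite /dpart [in RHS]big_nat_recr //= /T; congr normc; ring.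
  apply: (le_trans (normc_leB _ _)).
  have := @sumr_ge0 R _ (index_iota 0 N) xpredT T (fun j _ => T0 j).
  lra.
exists s0, (\sum_(0 <= j < N) T j + 2); split => //.
  by rewrite addr_ge0 // sumr_ge0.
move=> k; have := TB k; rewrite /T normcM normc_nat_cpowN /= expRN.
by rewrite ler_pdivrMr ?expR_gt0.
Qed.

(** The tail decays like its first term. With s1 = s0 + 2, where s0 is the growth exponent of the
    coefficients, a factor k^-2 is left over to sum the series; s1 does not depend on K. *)
Lemma dpart_tail : exists2 s1 : R, 0 <= s1 & forall K, exists2 B : R, 0 <= B &
  forall z, s1 <= Re z -> normc (phi z - dpart K z) <= B * expR (- (Re z * ln (K.+1%:R : R))).
Proof.
have [s0 [B [s00 sg B0 hB]]] := coef_growth.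
exists (s0 + 2); first lra.
move=> K; exists (2 * B * expR ((s0 + 2) * ln (K.+1%:R : R))).
  by rewrite !mulr_ge0 // expR_ge0.
move=> z zs; apply/ler_addgt0Pr => e e0.
have [|N hN] := dpart_cvg (s := z) _ e0; first lra.
have [M [NM KM]] : exists M, (N <= M)%N /\ (K <= M)%N.
  by exists (maxn N K); rewrite leq_maxl leq_maxr.
have -> : phi z - dpart K z = (phi z - dpart M z) + (dpart M z - dpart K z) by ring.
apply: (le_trans (normcD _ _)); rewrite addrC; apply: lerD; last exact: hN.
have -> : dpart M z - dpart K z = \sum_(K <= k < M) a k.+1 * nat_cpowN k.+1 z.
  by rewrite /dpart (big_cat_nat (n := K) (p := M)) //= addrAC subrr add0r.
apply: (le_trans (normc_sum _ _ _)).
set X := B * expR (- ((Re z - (s0 + 2)) * ln (K.+1%:R : R))).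
apply: (@le_trans _ _ (\sum_(K <= k < M) X * expR (- 2 * ln (k.+1%:R : R)))); last first.
  rewrite -mulr_sumr; apply: (@le_trans _ _ (X * 2)).
    by rewrite ler_wpM2l ?sum_inv_sqr // mulr_ge0 // expR_ge0.
  have -> : X = B * (expR ((s0 + 2) * ln (K.+1%:R : R)) * expR (- (Re z * ln (K.+1%:R : R)))).
    by rewrite /X -expRD; congr (_ * expR _); ring.
  by rewrite le_eqVlt; apply/orP; left; apply/eqP; ring.
rewrite big_nat_cond [X in _ <= X]big_nat_cond; apply: ler_sum => k /andP[/andP[Kk kM] _].
rewrite normcM normc_nat_cpowN.
apply: (@le_trans _ _ (B * expR (s0 * ln k.+1%:R) * expR (- (Re z * ln k.+1%:R)))).
  by rewrite ler_wpM2r ?expR_ge0.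
rewrite /X -!mulrA ler_wpM2l // -!expRD ler_expR.
have l1 : ln (K.+1%:R : R) <= ln k.+1%:R by apply: ln_nat_le.
have : (Re z - (s0 + 2)) * ln (K.+1%:R : R) <= (Re z - (s0 + 2)) * ln k.+1%:R.
  by rewrite ler_wpM2l // subr_ge0.
lra.
Qed.

(** Each nonzero frequency log (p / q) with p, q <= M receives its shift t with t log (p / q) = pi.
    For p = q division by zero gives the shift 0, which does not change an average. *)
Definition killing_times (M : nat) : seq R :=
  [seq pi / (ln (p.+1%:R : R) - ln q.+1%:R) | p <- iota 0 M, q <- iota 0 M].

Lemma cexp_shift (l u : R) (z : C) :
  cexp (l%:C * (z + 0 +i* u)) = cexp (0 +i* (u * l)) * cexp (l%:C * z).
Proof.
rewrite -cexpD; congr cexp; rewrite mulrDr addrC; congr (_ + _).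
by apply/eqP; rewrite eq_complex /= mul0r mulr0 subr0 mul0r addr0 mulrC !eqxx.
Qed.

Lemma vavg_ratio M (p q : nat) (F : C -> C) : (p < M)%N -> (q < M)%N -> p <> q ->
  (forall z u, F (z + 0 +i* u) = cexp (0 +i* (u * (ln (p.+1%:R : R) - ln q.+1%:R))) * F z) ->
  forall z, vavg (killing_times M) F z = 0.
Proof.
move=> pM qM pq hF.
apply: (@vavg_kill _ _ F (ln p.+1%:R - ln q.+1%:R) (pi / (ln p.+1%:R - ln q.+1%:R))) => //.
  by apply: (@allpairs_f _ _ _ (fun p q : nat => pi / (ln (p.+1%:R : R) - ln q.+1%:R)));
    rewrite mem_iota.
rewrite divfK // subr_eq0; apply/eqP => /(congr1 expR).
by rewrite !lnK ?posrE ?ltr0n // => /eqP; rewrite eqr_nat eqSS => /eqP.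
Qed.

Section Contraction.
Variable N : nat.
Variables (b e : nat -> C).

(** The first N Dirichlet coefficients of phi f, with f the sum of b_m m^-s, paired with e; k m = n
    <= N forces k, m <= N. *)
Definition conv_form : C := \sum_(0 <= k < N) \sum_(0 <= m < N)
  \sum_(0 <= n < N | (k.+1 * m.+1 == n.+1)%N) a k.+1 * b m * e n.

Local Notation fb z := (\sum_(0 <= m < N) b m * nat_cpowN m.+1 z).
Local Notation fe z := (\sum_(0 <= n < N) e n * npow n.+1 z).

Lemma vavg_main z : vavg (killing_times (N * N)) (fun z => dpart N z * fb z * fe z) z = conv_form.
Proof.
have -> : (fun z => dpart N z * fb z * fe z) = (fun z => \sum_(0 <= k < N) \sum_(0 <= m < N)
    \sum_(0 <= n < N) (a k.+1 * b m * e n) *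
      cexp ((ln (n.+1%:R : R) - ln ((k.+1 * m.+1)%:R : R))%:C * z)).
  apply/funext => w; rewrite /dpart !mulr_suml; apply: eq_bigr => k _.
  rewrite -mulrA mulr_suml mulr_sumr; apply: eq_bigr => m _.
  rewrite !mulr_sumr; apply: eq_bigr => n _.
  rewrite rmorphB /= mulrBl cexpD -mulNr -nat_cpowNE nat_cpowNM // /npow; ring.
rewrite vavg_sum; apply: eq_big_nat => k /andP[_ kN].
rewrite vavg_sum; apply: eq_big_nat => m /andP[_ mN].
rewrite vavg_sum [RHS]big_mkcond; apply: eq_big_nat => n /andP[_ nN].
rewrite vavgZ; case: eqP => [->|ne].
  have -> : (fun w : C => cexp ((ln (n.+1%:R : R) - ln n.+1%:R)%:C * w)) = (fun=> 1).
    by apply/funext => w; rewrite subrr mul0r cexp0.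
  by rewrite vavg_cst mulr1.
set q := (k.+1 * m.+1)%N in ne *.
have q0 : (0 < q)%N by rewrite muln_gt0.
have qN : (q <= N * N)%N by rewrite leq_mul.
(* The products q = k m reach N^2, hence [killing_times (N * N)]; the predecessor appears because
   indices there are shifted by one. *)
rewrite -(prednK q0) (@vavg_ratio _ n q.-1) ?mulr0 //.
- by apply: (leq_trans nN); rewrite leq_pmull // (leq_ltn_trans _ nN).
- by move=> h; apply: ne; rewrite h prednK.
- by move=> w u; exact: cexp_shift.
Qed.

(** A finite Parseval identity on each vertical line. The sign covers both sums of m^-z and sums of
    m^z; the shifts are those of [vavg_main], since one average has to serve both computations. *)
Lemma vavg_sqr (c : nat -> C) (sg : R) z : sg = 1 \/ sg = -1 ->
  vavg (killing_times (N * N)) (fun w =>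
     (\sum_(0 <= m < N) c m * cexp ((sg * ln (m.+1%:R : R))%:C * w)) *
     (\sum_(0 <= m < N) c m * cexp ((sg * ln (m.+1%:R : R))%:C * w))^*) z =
  \sum_(0 <= m < N) (normc (c m) ^+ 2 * expR (2 * Re z * (sg * ln (m.+1%:R : R))))%:C.
Proof.
move=> hsg.
have -> : (fun w => (\sum_(0 <= m < N) c m * cexp ((sg * ln (m.+1%:R : R))%:C * w)) *
     (\sum_(0 <= m < N) c m * cexp ((sg * ln (m.+1%:R : R))%:C * w))^*) =
   (fun w => \sum_(0 <= m < N) \sum_(0 <= n < N) (c m * (c n)^*) *
     (cexp ((sg * ln (m.+1%:R : R))%:C * w) * (cexp ((sg * ln (n.+1%:R : R))%:C * w))^*)).
  apply/funext => w; rewrite conjc_sum mulr_suml; apply: eq_bigr => m _.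
  by rewrite mulr_sumr; apply: eq_bigr => n _; rewrite conjcM; ring.
rewrite vavg_sum; apply: eq_big_nat => m /andP[_ mN].
rewrite vavg_sum (bigD1_seq m) ?mem_index_iota ?mN ?iota_uniq //=.
rewrite [X in _ + X]big1_seq ?addr0; last first.
  move=> n /andP[nm]; rewrite mem_index_iota => /andP[_ nN].
  have NN : (N <= N * N)%N by rewrite leq_pmull // (leq_ltn_trans _ nN).
  rewrite vavgZ.
  have shift w u : cexp ((sg * ln (m.+1%:R : R))%:C * (w + 0 +i* u)) *
      (cexp ((sg * ln (n.+1%:R : R))%:C * (w + 0 +i* u)))^* =
      cexp (0 +i* (u * (sg * (ln (m.+1%:R : R) - ln (n.+1%:R : R))))) *
      (cexp ((sg * ln (m.+1%:R : R))%:C * w) * (cexp ((sg * ln (n.+1%:R : R))%:C * w))^*).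
    rewrite !cexp_shift conjcM (cexp_conj (0 +i* _)).
    have -> : 0 +i* (u * (sg * (ln (m.+1%:R : R) - ln (n.+1%:R : R)))) =
       0 +i* (u * (sg * ln (m.+1%:R : R))) + (0 +i* (u * (sg * ln (n.+1%:R : R))))^* :> C.
      by apply/eqP; rewrite eq_complex /= addr0 eqxx /=; apply/eqP; ring.
    by rewrite cexpD; ring.
  case: hsg shift => -> shift.
    rewrite (@vavg_ratio _ m n) ?mulr0 ?(leq_trans mN) ?(leq_trans nN) //.
      by move=> h; move: nm; rewrite h eqxx.
    by move=> w u; rewrite shift mul1r.
  rewrite (@vavg_ratio _ n m) ?mulr0 ?(leq_trans mN) ?(leq_trans nN) //.
    by move=> h; move: nm; rewrite h eqxx.
  by move=> w u; rewrite shift mulN1r opprB.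
have hE w : Re w = Re z ->
    cexp ((sg * ln (m.+1%:R : R))%:C * w) * (cexp ((sg * ln (m.+1%:R : R))%:C * w))^* =
    (expR (2 * Re z * (sg * ln (m.+1%:R : R))))%:C.
  move=> wz; rewrite mulrC mulcJ normc_cexp Re_realM wz; congr (_%:C).
  by rewrite expr2 -expRD; congr expR; ring.
have gen ts (F : C -> C) (k : C) : (forall w, Re w = Re z -> F w = k) -> vavg ts F z = k.
  move=> hF; suff : forall w, Re w = Re z -> vavg ts F w = k by apply.
  elim: ts => [|t ts IH] w wz /=; first exact: hF.
  by rewrite !IH ?Re_addiy //; field.
rewrite (gen _ _ (c m * (c m)^* * (expR (2 * Re z * (sg * ln (m.+1%:R : R))))%:C)).
  by rewrite mulrC [c m * _]mulrC mulcJ mulrC -rmorphM.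
by move=> w wz; rewrite hE.
Qed.

(* The averages L of phi f Q, with f = sum b m^-z and Q = sum e n^z, tend to conv_form as
   Re z grows, and are controlled by the averages of (|f|^2 + |Q|^2) / 2 on Re z = c. *)
Lemma conv_form_bound : normc conv_form <=
  (\sum_(0 <= m < N) normc (b m) ^+ 2 + \sum_(0 <= n < N) normc (e n) ^+ 2) / 2.
Proof.
have sq0 (c : nat -> C) : 0 <= \sum_(0 <= m < N) normc (c m) ^+ 2.
  by apply: sumr_ge0 => m _; exact: sqr_ge0.
have [N0|N0] := posnP N.
  by rewrite /conv_form N0 big_geq // ComplexField.Normc.normc0 !big_geq.
set S := conv_form; set ts := killing_times (N * N).
pose f z := \sum_(0 <= m < N) b m * nat_cpowN m.+1 z.
pose Q z := \sum_(0 <= n < N) e n * npow n.+1 z.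
have cf z : cdiff f z.
  apply: (@cdiff_sum _ _ _ (fun m w => b m * nat_cpowN m.+1 w)) => m.
  exact: (cdiffM (cdiff_cst _ z) (cdiff_nat_cpowN _ z)).
have cQ z : cdiff Q z.
  apply: (@cdiff_sum _ _ _ (fun m w => e m * npow m.+1 w)) => m.
  exact: (cdiffM (cdiff_cst _ z) (cdiff_npow _ z)).
pose Bb := \sum_(0 <= m < N) normc (b m); pose Be := \sum_(0 <= n < N) normc (e n).
have Bb0 : 0 <= Bb by apply: sumr_ge0 => m _; exact: normc_ge0.
have Be0 : 0 <= Be by apply: sumr_ge0 => m _; exact: normc_ge0.
have fB z : 0 <= Re z -> normc (f z) <= Bb.
  move=> z0; apply: (le_trans (normc_sum _ _ _)); apply: ler_sum => m _.
  rewrite normcM normc_nat_cpowN ler_piMr ?normc_ge0 // expRN_le1 //.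
  by rewrite mulr_ge0 // ln_nat_ge0.
have QB z : 0 <= Re z -> normc (Q z) <= Be * expR (Re z * ln (N%:R : R)).
  move=> z0; apply: (le_trans (normc_sum _ _ _)); rewrite mulr_suml.
  apply: ler_sum_nat => m /andP[_ mN]; rewrite normcM normc_npow ler_wpM2l ?normc_ge0 //.
  by rewrite ler_expR ler_wpM2l // ln_nat_le.
pose H z := phi z * f z * Q z.
pose L := vavg ts H.
have cL z : 0 < Re z -> cdiff L z.
  apply: vavg_cdiff => w w0; exact: (cdiffM (cdiffM (phi_diff w0) (cf w)) (cQ w)).
have [s1 s10 /(_ N)[D D0 hD]] := dpart_tail.
(* The tail of phi decays like (N + 1)^-x while Q grows at most like N^x, so their product still
   decays at rate d > 0. *)
pose d : R := ln (N.+1%:R : R) - ln N%:R.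
have d0 : 0 < d by rewrite subr_gt0 ln_nat_lt.
have far z : s1 <= Re z -> normc (L z - S) <= D * Bb * Be * expR (- (Re z * d)).
  move=> zs.
  have -> : L z - S = vavg ts (fun w => (phi w - dpart N w) * f w * Q w) z.
    rewrite /S -(vavg_main z) -/ts /L.
    have -> : H = (fun w => dpart N w * f w * Q w + (phi w - dpart N w) * f w * Q w).
      by apply/funext => w; rewrite /H; ring.
    by rewrite vavgD addrAC subrr add0r.
  apply: (@vavg_bound _ _ _ (Re z)) => // w wz; rewrite !normcM.
  have w0 : 0 <= Re w by rewrite wz; exact: le_trans zs.
  have h1 := hD w; rewrite wz in h1; move: h1 => /(_ zs) h1.
  have h2 := QB w w0; rewrite wz in h2.
  have -> : D * Bb * Be * expR (- (Re z * d)) =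
     D * expR (- (Re z * ln N.+1%:R)) * Bb * (Be * expR (Re z * ln N%:R)).
    have -> : - (Re z * d) = - (Re z * ln (N.+1%:R : R)) + Re z * ln N%:R by rewrite /d; ring.
    by rewrite expRD; ring.
  apply: ler_pM; rewrite ?mulr_ge0 ?normc_ge0 //.
  by apply: ler_pM; rewrite ?normc_ge0 ?fB.
pose B := Bb * (Be * expR (s1 * ln (N%:R : R))) + (normc S + D * Bb * Be).
have LB z : 0 < Re z -> normc (L z) <= B.
  move=> z0; have [zs|sz] := leP s1 (Re z).
    have -> : L z = (L z - S) + S by ring.
    apply: (le_trans (normcD _ _)); rewrite /B.
    have h : D * Bb * Be * expR (- (Re z * d)) <= D * Bb * Be * 1.
      rewrite ler_wpM2l ?mulr_ge0 // expRN_le1 //.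
      by rewrite mulr_ge0 // ?(ltW d0) // (le_trans s10).
    have := far z zs.
    have : 0 <= Bb * (Be * expR (s1 * ln (N%:R : R))) by rewrite !mulr_ge0 // expR_ge0.
    lra.
  apply: (@le_trans _ _ (Bb * (Be * expR (s1 * ln (N%:R : R))))); last first.
    by rewrite /B lerDl addr_ge0 ?normc_ge0 // !mulr_ge0.
  apply: (@vavg_bound _ _ _ (Re z)) => // w wz; rewrite !normcM.
  have w0 : 0 < Re w by rewrite wz.
  apply: ler_pM; rewrite ?mulr_ge0 ?normc_ge0 //.
    by rewrite -[Bb]mul1r; apply: ler_pM; rewrite ?normc_ge0 ?phi_le1 ?fB // ltW.
  apply: (le_trans (QB w (ltW w0))); rewrite ler_wpM2l // ler_expR.
  by rewrite ler_wpM2r ?ln_nat_ge0 // wz ltW.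
apply/ler_addgt0Pr => eta eta0.
pose X := \sum_(0 <= m < N) normc (b m) ^+ 2; pose Y := \sum_(0 <= n < N) normc (e n) ^+ 2.
have X0 : 0 <= X := sq0 b; have Y0 : 0 <= Y := sq0 e.
have Y1 : 0 < Y + 1 by rewrite ltr_wpDl.
(* On Re z = c the squares |e_n|^2 acquire factors n^(2 c) <= N^(2 c); this c keeps the total excess
   below eta. *)
have [c c0 hc] : exists2 c : R, 0 < c & expR (c * (2 * ln (N%:R : R))) <= 1 + eta / (Y + 1).
  by apply: expR_small; rewrite ?mulr_ge0 ?ln_nat_ge0 ?divr_gt0.
pose M := (X + expR (c * (2 * ln (N%:R : R))) * Y) / 2.
have M0 : 0 <= M by rewrite divr_ge0 // addr_ge0 // mulr_ge0 // expR_ge0.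
have line z : Re z = c -> normc (L z) <= M.
  move=> zc.
  pose G w := 2^-1 * (f w * (f w)^* + Q w * (Q w)^*).
  have HG w : Re w = c -> normc (H w) <= Re (G w).
    move=> wc; have -> : Re (G w) = (normc (f w) ^+ 2 + normc (Q w) ^+ 2) / 2.
      by rewrite /G mulrC Re_half ReD (mulrC (f w)) (mulrC (Q w)) !mulcJ.
    rewrite /H !normcM.
    have p1 : normc (phi w) <= 1 by apply: phi_le1; rewrite wc.
    have := normc_ge0 (f w); have := normc_ge0 (Q w).
    have : normc (phi w) * normc (f w) * normc (Q w) <= 1 * (normc (f w) * normc (Q w)).
      by rewrite -mulrA ler_wpM2r // mulr_ge0 // normc_ge0.
    have : 0 <= (normc (f w) - normc (Q w)) ^+ 2 by rewrite sqr_ge0.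
    nra.
  apply: (le_trans (vavg_majorant ts HG zc)); rewrite /G vavgZ vavgD.
  have -> : (fun w => f w * (f w)^*) = (fun w =>
      (\sum_(0 <= m < N) b m * cexp ((-1 * ln (m.+1%:R : R))%:C * w)) *
      (\sum_(0 <= m < N) b m * cexp ((-1 * ln (m.+1%:R : R))%:C * w))^*).
    apply/funext => w.
    suff -> : f w = \sum_(0 <= m < N) b m * cexp ((-1 * ln (m.+1%:R : R))%:C * w) by [].
    by apply: eq_bigr => m _; rewrite nat_cpowNE mulN1r rmorphN.
  have -> : (fun w => Q w * (Q w)^*) = (fun w =>
      (\sum_(0 <= m < N) e m * cexp ((1 * ln (m.+1%:R : R))%:C * w)) *
      (\sum_(0 <= m < N) e m * cexp ((1 * ln (m.+1%:R : R))%:C * w))^*).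
    apply/funext => w.
    suff -> : Q w = \sum_(0 <= m < N) e m * cexp ((1 * ln (m.+1%:R : R))%:C * w) by [].
    by apply: eq_bigr => m _; rewrite mul1r.
  rewrite !vavg_sqr; [|by left|by right].
  rewrite mulrC Re_half ReD !Re_sum /= /M ler_pM2r ?invr_gt0 // zc; apply: lerD.
    apply: ler_sum_nat => m /andP[_ mN]; rewrite ler_piMr ?sqr_ge0 // mulN1r mulrN expRN_le1 //.
    by rewrite !mulr_ge0 ?ln_nat_ge0 // ltW.
  rewrite mulr_sumr; apply: ler_sum_nat => m /andP[_ mN]; rewrite mulrC ler_wpM2r ?sqr_ge0 //.
  rewrite ler_expR mul1r (mulrC 2) -mulrA ler_wpM2l ?(ltW c0) //.
  by rewrite ler_wpM2l // ln_nat_le.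
have all z : c <= Re z -> normc (L z) <= M.
  move=> zc; apply: (@half_plane_max _ [::] L c B M) => //.
  - by move=> w wc _; apply: cL; exact: lt_le_trans wc.
  - by move=> w wc _; apply: LB; exact: lt_le_trans wc.
  - by move=> w wc _; exact: line.
have C0 : 0 <= D * Bb * Be by rewrite !mulr_ge0.
have eta2 : 0 < eta / 2 by rewrite divr_gt0.
have [x0 [x00 hx0]] := expR_decay d0 C0 eta2.
(* At x one has |S| <= M + eta / 2 and M <= (X + Y + eta) / 2. *)
pose x := Num.max x0 (Num.max s1 c).
have [hx1 hx2 hx3] : [/\ x0 <= x, s1 <= x & c <= x].
  by rewrite /x !le_max !lexx !orbT.
have h1 := far x%:C hx2; have h2 := all x%:C hx3; have h3 := hx0 x hx1.
have -> : S = L x%:C - (L x%:C - S) by ring.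
apply: (le_trans (normc_leB _ _)).
have h4 : expR (c * (2 * ln (N%:R : R))) * Y <= Y + eta.
  apply: (le_trans (ler_wpM2r Y0 hc)); rewrite mulrDl mul1r lerD2l mulrAC.
  by rewrite ler_pdivrMr // ler_pM2l // lerDl.
rewrite -/X -/Y; move: h1 h2 h3 h4; rewrite /M /=; lra.
Qed.

End Contraction.

(* The inner sum is the m-th entry of the transpose of the (truncated) matrix of
   multiplication by phi in the basis n^-s, applied to e. *)
Lemma adjoint_bound N (e : nat -> C) :
  \sum_(0 <= m < N) normc (\sum_(0 <= k < N) \sum_(0 <= n < N | (k.+1 * m.+1 == n.+1)%N)
     a k.+1 * e n) ^+ 2 <= \sum_(0 <= n < N) normc (e n) ^+ 2.
Proof.
set c := fun m : nat => \sum_(0 <= k < N) \sum_(0 <= n < N | (k.+1 * m.+1 == n.+1)%N) a k.+1 * e n.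
(* With b = conj c the form becomes S, the sum of the |c_m|^2, and S <= (S + Y) / 2 gives S <= Y;
   Cauchy-Schwarz and rescaling are avoided. *)
have := conv_form_bound N (fun m => (c m)^*) e.
have -> : conv_form N (fun m => (c m)^*) e = (\sum_(0 <= m < N) normc (c m) ^+ 2)%:C.
  rewrite /conv_form exchange_big /= (rmorph_sum (real_complex R)) /=.
  apply: eq_bigr => m _; rewrite -mulcJ /c mulr_sumr; apply: eq_bigr => k _.
  by rewrite mulr_sumr; apply: eq_bigr => n _; ring.
rewrite normcR ger0_norm; last by apply: sumr_ge0 => m _; exact: sqr_ge0.
under [X in _ <= (X + _) / 2]eq_bigr do rewrite normc_conj.
rewrite -/(\sum_(0 <= m < N) normc (c m) ^+ 2); lra.
Qed.

(** Test [adjoint_bound] on the conjugate phases of the coefficients: the entry with m = 0 is then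
    the sum of the |a_k|, and the right-hand side is at most K. A vanishing coefficient gets phase 0
    because 0 / 0 = 0. *)
Lemma coef_abs_sum K : \sum_(0 <= k < K) normc (a k.+1) <= Num.sqrt (K%:R : R).
Proof.
have [->|K0] := posnP K; first by rewrite big_geq // sqrtr_ge0.
pose e k : C := (a k.+1)^* / (normc (a k.+1))%:C.
have ae k : a k.+1 * e k = (normc (a k.+1))%:C.
  rewrite /e; have [->|a0] := eqVneq (normc (a k.+1)) 0.
    by rewrite (rmorph0 (real_complex R)) invr0 !mulr0.
  rewrite mulrA [a k.+1 * _]mulrC mulcJ -(fmorphV (real_complex R)) -rmorphM /=.
  by rewrite expr2 mulfK.
have e1 k : normc (e k) ^+ 2 <= 1.
  rewrite /e normcf_div normc_conj normcR ger0_norm ?normc_ge0 //.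
  have [->|a0] := eqVneq (normc (a k.+1)) 0; first by rewrite mul0r expr0n.
  by rewrite mulfV // expr1n.
have S0 : 0 <= \sum_(0 <= k < K) normc (a k.+1) by apply: sumr_ge0 => k _; exact: normc_ge0.
rewrite -(@ler_pXn2r _ 2) ?nnegrE ?sqrtr_ge0 // sqr_sqrtr ?ler0n //.
have := adjoint_bound K e; rewrite big_ltn //.
have -> : \sum_(0 <= k < K) \sum_(0 <= n < K | (k.+1 * 1 == n.+1)%N) a k.+1 * e n =
    (\sum_(0 <= k < K) normc (a k.+1))%:C.
  rewrite (rmorph_sum (real_complex R)) /=; apply: eq_big_nat => k /andP[_ kK].
  rewrite -ae big_mkcond (bigD1_seq k) ?mem_index_iota ?kK ?iota_uniq //=.
  rewrite muln1 eqxx big1_seq ?addr0 // => n /andP[nk _].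
  by rewrite eqSS eq_sym (negbTE nk).
rewrite normcR ger0_norm // => h.
have h2 : \sum_(0 <= n < K) normc (e n) ^+ 2 <= K%:R.
  apply: (@le_trans _ _ (\sum_(0 <= n < K) 1)); first by apply: ler_sum => n _.
  by rewrite sumr_const_nat subn0.
apply: le_trans h2; apply: le_trans h; rewrite lerDl.
by apply: sumr_ge0 => m _; exact: sqr_ge0.
Qed.

(* Maximum principle for (phi - dpart K) K^z. *)
Lemma dpart_error K z : (0 < K)%N -> 0 < Re z ->
  normc (phi z - dpart K z) <= (1 + Num.sqrt (K%:R : R)) * expR (- (Re z * ln (K%:R : R))).
Proof.
move=> K0 z0; set A := 1 + _.
have A0 : 0 <= A by rewrite addr_ge0 ?sqrtr_ge0.
pose G w := (phi w - dpart K w) * npow K w.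
have cG w : 0 < Re w -> cdiff G w.
  by move=> w0; exact: (cdiffM (cdiffB (phi_diff w0) (dpart_cdiff K w)) (cdiff_npow K w)).
have PA w : 0 < Re w -> normc (phi w - dpart K w) <= A.
  move=> w0; apply: (le_trans (normc_leB _ _)); apply: lerD; first exact: phi_le1.
  apply: le_trans (coef_abs_sum K); apply: (le_trans (normc_sum _ _ _)).
  apply: ler_sum => k _; rewrite normcM normc_nat_cpowN ler_piMr ?normc_ge0 //.
  by rewrite expRN_le1 // mulr_ge0 ?ln_nat_ge0 ?(ltW w0).
have [s1 s10 /(_ K)[D D0 hD]] := dpart_tail.
have l0 := ln_nat_ge0 R K.
pose B := A * expR (s1 * ln (K%:R : R)) + D.
have GB w : 0 < Re w -> normc (G w) <= B.
  move=> w0; rewrite normcM normc_npow.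
  have [ws|sw] := leP s1 (Re w).
    apply: (@le_trans _ _ D); last by rewrite /B lerDr mulr_ge0 // expR_ge0.
    apply: (@le_trans _ _ (D * expR (- (Re w * ln K.+1%:R)) * expR (Re w * ln K%:R))).
      by rewrite ler_wpM2r ?expR_ge0 // hD.
    rewrite -mulrA ler_piMr // -expRD addrC -opprB expRN_le1 // subr_ge0.
    by rewrite ler_wpM2l ?ln_nat_le // ltW.
  apply: (@le_trans _ _ (A * expR (s1 * ln (K%:R : R)))); last by rewrite /B lerDl.
  apply: ler_pM; rewrite ?normc_ge0 ?expR_ge0 ?PA // ler_expR ler_wpM2r // ltW //.
(* The line Re w = 0 is out of reach; on Re w = c the loss is K^c, which tends to 1 with c for fixed
   K. *)
have main c : 0 < c -> c <= Re z -> normc (G z) <= A * expR (c * ln (K%:R : R)).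
  move=> c0 cz; apply: (@half_plane_max _ [::] G c B) => //.
  - by rewrite mulr_ge0 // expR_ge0.
  - by move=> w wc _; apply: cG; exact: lt_le_trans wc.
  - by move=> w wc _; apply: GB; exact: lt_le_trans wc.
  - move=> w wc _; rewrite normcM normc_npow wc ler_wpM2r ?expR_ge0 // PA //.
    by rewrite wc.
rewrite expRN ler_pdivlMr ?expR_gt0 // -normc_npow -normcM -/(G z).
apply/ler_addgt0Pr => eta eta0.
have A1 : 0 < A + 1 by rewrite ltr_wpDl.
have [c c0 hc] := expR_small l0 (divr_gt0 eta0 A1).
pose c' := Num.min c (Re z).
have [c'0 c'1 c'2] : [/\ 0 < c', c' <= Re z & c' <= c].
  by rewrite /c' lt_min c0 z0 !ge_min !lexx orbT.
apply: (le_trans (main c' c'0 c'1)).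
apply: (@le_trans _ _ (A * (1 + eta / (A + 1)))).
  by rewrite ler_wpM2l //; apply: le_trans hc; rewrite ler_expR ler_wpM2r.
rewrite mulrDr mulr1 lerD2l mulrCA mulrA -[X in _ <= X]mulr1 -mulrA ler_pM2l //.
by rewrite ler_pdivrMr // mul1r lerDl.
Qed.

(** By [dpart_error] the error is at most 2 K^(1/2 - Re z). *)
Theorem dpart_converges z : 1 / 2 < Re z -> forall eta : R, 0 < eta ->
  exists K0, forall K, (K0 <= K)%N -> normc (phi z - dpart K z) <= eta.
Proof.
move=> zh eta eta0; have z0 : 0 < Re z by lra.
have d0 : 0 < Re z - 1 / 2 by rewrite subr_gt0.
have [x0 [x00 hx0]] := expR_decay d0 (ler0n R 2) eta0.
exists (Num.bound (expR x0)).+1 => K hK.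
have K0 : (0 < K)%N by apply: leq_trans hK.
have K1 : 1 <= K%:R :> R by rewrite ler1n.
apply: (le_trans (dpart_error K0 z0)).
have lx : x0 <= ln (K%:R : R).
  rewrite -(expRK x0) ler_ln ?posrE ?expR_gt0 ?ltr0n //.
  apply: (le_trans (ltW (archi_boundP (expR_ge0 x0)))); rewrite ler_nat.
  exact: leq_trans hK.
apply: le_trans (hx0 _ lx).
have sE : Num.sqrt (K%:R : R) = expR (1 / 2 * ln (K%:R : R)).
  apply/eqP; rewrite -(@eqrXn2 _ 2) ?sqrtr_ge0 ?expR_ge0 // sqr_sqrtr ?ler0n //.
  rewrite expr2 -expRD; have -> : 1 / 2 * ln (K%:R : R) + 1 / 2 * ln K%:R = ln K%:R by lra.
  by rewrite lnK // posrE ltr0n.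
apply: (@le_trans _ _ (2 * Num.sqrt (K%:R : R) * expR (- (Re z * ln (K%:R : R))))).
  rewrite ler_wpM2r ?expR_ge0 // mulr_natl mulr2n lerD2r.
  by rewrite -[X in X <= _]sqrtr1 ler_sqrt // ltr0n.
rewrite sE -mulrA -expRD ler_wpM2l // ler_expR; lra.
Qed.

End DirichletSeries.

(** * Convergence of the zeta series *)

Section ComplexLimits.
Variable R : realType.
Local Notation C := R[i].
Local Notation "x ^*" := (conjc x) : ring_scope.
Implicit Types (u v : nat -> C) (k l : C).

Definition clim u l := forall e : R, 0 < e ->
  exists N, forall n, (N <= n)%N -> normc (l - u n) <= e.

Lemma clim_cst k : clim (fun=> k) k.
Proof. by move=> e e0; exists 0%N => n _; rewrite subrr ComplexField.Normc.normc0 ltW. Qed.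

Lemma climD u v k l : clim u k -> clim v l -> clim (fun n => u n + v n) (k + l).
Proof.
move=> hu hv e e0; have e2 : 0 < e / 2 by rewrite divr_gt0.
have [N1 h1] := hu _ e2; have [N2 h2] := hv _ e2.
exists (maxn N1 N2) => n; rewrite geq_max => /andP[/h1 {}h1 /h2 {}h2].
rewrite opprD addrACA; apply: (le_trans (normcD _ _)); lra.
Qed.

Lemma climM u v k l : clim u k -> clim v l -> clim (fun n => u n * v n) (k * l).
Proof.
move=> hu hv e e0.
have A0 : 0 < normc l + 1 by rewrite ltr_wpDl ?normc_ge0.
have B0 : 0 < normc k + 1 by rewrite ltr_wpDl ?normc_ge0.
have m0 : 0 < Num.min 1 (e / 2 / (normc l + 1)) by rewrite lt_min ltr01 !divr_gt0.
have [N1 h1] := hu _ m0.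
have [N2 h2] := hv (e / 2 / (normc k + 1)) (divr_gt0 (divr_gt0 e0 (ltr0n _ 2)) B0).
exists (maxn N1 N2) => n; rewrite geq_max => /andP[/h1 {}h1 /h2 {}h2].
move: h1; rewrite le_min => /andP[h1 h1'].
have -> : k * l - u n * v n = (k - u n) * l + u n * (l - v n) by ring.
apply: (le_trans (normcD _ _)); rewrite !normcM.
have hu1 : normc (u n) <= normc k + 1.
  have -> : u n = k - (k - u n) by ring.
  by apply: (le_trans (normc_leB _ _)); rewrite lerD2l.
have s1 : normc (k - u n) * normc l <= e / 2.
  apply: (@le_trans _ _ (e / 2 / (normc l + 1) * (normc l + 1))).
    by apply: ler_pM; rewrite ?normc_ge0 // lerDl.
  by rewrite divfK // gt_eqF.
have s2 : normc (u n) * normc (l - v n) <= e / 2.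
  apply: (@le_trans _ _ ((normc k + 1) * (e / 2 / (normc k + 1)))).
    by apply: ler_pM; rewrite ?normc_ge0.
  by rewrite mulrC divfK // gt_eqF.
lra.
Qed.

Lemma clim_sum (I : Type) (r : seq I) (F : I -> nat -> C) (L : I -> C) :
  (forall i, clim (F i) (L i)) -> clim (fun n => \sum_(i <- r) F i n) (\sum_(i <- r) L i).
Proof.
move=> hF; elim: r => [|i r IH].
  by under eq_fun do rewrite big_nil; rewrite big_nil; exact: clim_cst.
under eq_fun do rewrite big_cons; rewrite big_cons; exact: climD.
Qed.

Lemma clim_conj u l : clim u l -> clim (fun n => (u n)^*) l^*.
Proof.
move=> hu e /hu[N hN]; exists N => n /hN.
by rewrite -conjcB normc_conj.
Qed.

Lemma clim_real (r : nat -> R) l : clim (fun n => (r n)%:C) l -> Im l = 0.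
Proof.
move=> h; apply/eqP; rewrite -normr_eq0 eq_le normr_ge0 andbT.
apply/ler_addgt0Pr => e /h[N /(_ N (leqnn N))]; rewrite add0r; apply: le_trans.
by apply: le_trans (normc_ge_Im _); rewrite ImB /= subr0.
Qed.

Lemma clim_le (r t : nat -> R) k l (M : nat) : clim (fun n => (r n)%:C) k ->
  clim (fun n => (t n)%:C) l -> (forall n, (M <= n)%N -> r n <= t n) -> Re k <= Re l.
Proof.
move=> hr ht rt; apply/ler_addgt0Pr => e e0; have e2 : 0 < e / 2 by rewrite divr_gt0.
have [N1 h1] := hr _ e2; have [N2 h2] := ht _ e2.
pose n := maxn M (maxn N1 N2).
have [m1 m2 m3] : [/\ (M <= n)%N, (N1 <= n)%N & (N2 <= n)%N].
  by rewrite /n !leq_max !leqnn !orbT.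
have := le_trans (normc_ge_Re _) (h1 n m2); have := le_trans (normc_ge_Re _) (h2 n m3).
rewrite !ReB /= !ler_norml => /andP[? ?] /andP[? ?].
have := rt n m1; lra.
Qed.

End ComplexLimits.

(** * Comparison with the real series of k^-s *)

Section Zeta.
Variable R : realType.
Local Notation C := R[i].

(** Integral test in discrete form: d (x + 1)^(-1-d) <= x^-d - (x + 1)^-d, which follows from 1 / (x
    + 1) <= ln (x + 1) - ln x and 1 + y <= exp y. *)
Lemma riemann_sum_bound (d : R) (P : nat) : 0 < d ->
  \sum_(0 <= k < P.+1) expR (- ((1 + d) * ln (k.+1%:R : R))) <=
  1 + (1 - expR (- (d * ln (P.+1%:R : R)))) / d.
Proof.
move=> d0; elim: P => [|P IH].
  by rewrite big_nat1 ln1 !mulr0 oppr0 expR0 subrr mul0r addr0.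
rewrite big_nat_recr //=; apply: (le_trans (lerD IH (lexx _))).
set x : R := P.+1%:R; have x0 : 0 < x by rewrite ltr0n.
have -> : P.+2%:R = x + 1 by rewrite natr1.
set l := ln x; set l' := ln (x + 1).
have x1 : 0 < x + 1 by lra.
have hl : (x + 1)^-1 <= l' - l.
  have : ln (1 + - (x + 1)^-1) <= - (x + 1)^-1.
    by apply: le_ln1Dx; rewrite ltrN2 invf_lt1 // ltrDr.
  have -> : 1 + - (x + 1)^-1 = x / (x + 1) by field; rewrite gt_eqF.
  rewrite ln_div ?posrE // -/l -/l'; lra.
have e1 : expR (- ((1 + d) * l')) = expR (- (d * l')) / (x + 1).
  have -> : - ((1 + d) * l') = - (d * l') + - l' by ring.
  by rewrite expRD expRN (expRN l') lnK // posrE.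
have e2 : expR (- (d * l')) * (1 + d / (x + 1)) <= expR (- (d * l)).
  have -> : - (d * l) = - (d * l') + d * (l' - l) by ring.
  rewrite expRD ler_wpM2l ?expR_ge0 //; apply: le_trans (expR_ge1Dx _).
  by rewrite lerD2l ler_wpM2l // ltW.
rewrite e1 -addrA lerD2l -lerBrDl -mulrBl ler_pdivlMr //.
set E' := expR _ in e2 *; set E := expR _ in e2 *.
have -> : E' / (x + 1) * d = E' * (d / (x + 1)) by rewrite mulrAC mulrA.
by rewrite mulrDr mulr1 in e2; lra.
Qed.

Lemma riemann_cvg (s : R) : 1 < s ->
  cvgn (series (fun k : nat => expR (- (s * ln (k.+1%:R : R))))).
Proof.
move=> s1; have d0 : 0 < s - 1 by rewrite subr_gt0.
apply: nondecreasing_is_cvgn.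
  by apply: nondecreasing_series => k _ _; exact: expR_ge0.
exists (1 + 1 / (s - 1)) => _ [n _ <-].
apply: (@le_trans _ _ (\sum_(0 <= k < n.+1) expR (- ((1 + (s - 1)) * ln (k.+1%:R : R))))).
  have -> : 1 + (s - 1) = s by ring.
  by rewrite /series /= big_nat_recr //= lerDl expR_ge0.
apply: (le_trans (riemann_sum_bound n d0)); rewrite lerD2l ler_pM2r ?invr_gt0 //.
Qed.

(** [zeta] is a [lim], which is informative only once convergence is known; real and imaginary parts
    converge absolutely by [riemann_cvg]. *)
Lemma zeta_clim (s : C) : 1 < Re s ->
  clim (fun n => \sum_(0 <= k < n) nat_cpowN k.+1 s) (zeta s).
Proof.
move=> s1; pose u k : C := nat_cpowN k.+1 s.
have nu k : normc (u k) = expR (- (Re s * ln (k.+1%:R : R))) by exact: normc_nat_cpowN.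
have real_cvg (f : C -> R) : (forall z, `|f z| <= normc z) ->
    cvgn (series (fun k => f (u k))).
  move=> hf; apply: (@normed_cvg R R^o).
  apply: (@series_le_cvg R _ (fun k : nat => expR (- (Re s * ln (k.+1%:R : R))))).
  - by move=> k; exact: normr_ge0.
  - by move=> k; exact: expR_ge0.
  - by move=> k; rewrite -nu; exact: hf.
  - exact: riemann_cvg.
have [l1 h1] : exists l1 : R, series (fun k => Re (u k)) @ \oo --> l1.
  by apply/cvg_ex; apply: real_cvg; exact: normc_ge_Re.
have [l2 h2] : exists l2 : R, series (fun k => Im (u k)) @ \oo --> l2.
  by apply/cvg_ex; apply: real_cvg; exact: normc_ge_Im.
have main : clim (fun n => \sum_(0 <= k < n) u k) (l1 +i* l2).
  move=> e e0; have e2 : 0 < e / 2 by rewrite divr_gt0.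
  have /cvgrPdist_le/(_ _ e2)[N1 _ H1] := h1.
  have /cvgrPdist_le/(_ _ e2)[N2 _ H2] := h2.
  exists (maxn N1 N2) => n; rewrite geq_max => /andP[/H1 {}H1 /H2 {}H2].
  apply: (le_trans (normc_le_ReIm _)); rewrite ReB ImB Re_sum.
  have -> : Im (\sum_(0 <= k < n) u k) = \sum_(0 <= k < n) Im (u k).
    by elim/big_rec2: _ => [//|i y x _ <-]; case: (u i) x => [? ?] [].
  by rewrite /series /= in H1 H2 *; lra.
suff -> : zeta s = l1 +i* l2 by [].
have H : (series (fun k : nat => (nat_cpowN k.+1 s : R[i]^o))) @ \oo --> (l1 +i* l2 : R[i]^o).
  by apply/cvg_normcP.
exact: (cvg_lim (@norm_hausdorff _ _) H).
Qed.

End Zeta.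

(** * Nondegeneracy and the Pick matrices *)

Section CauchyDecay.
Variable R : realType.
Local Notation C := R[i].
Implicit Types (F : R -> C) (s : seq C).

(** Decay faster than every power, rather than exponential at a fixed rate, because this class is
    stable under multiplication by x + mu. *)
Definition rapid F := forall k : nat, exists B : R, forall x : R, 1 <= x ->
  normc (F x) * (1 + x) ^+ k <= B.

Lemma rapid_expR F (B d : R) : 0 < d -> 0 <= B ->
  (forall x, 1 <= x -> normc (F x) <= B * expR (- (x * d))) -> rapid F.
Proof.
(* This makes 1 + x <= c (1 + x d / (k + 1)) <= c exp (x d / (k + 1)); using k + 1 avoids a division
   by zero at k = 0. *)
move=> d0 B0 hF k; pose c := Num.max 1 (k.+1%:R / d).
have c1 : 1 <= c by rewrite /c le_max lexx.
have cd : k.+1%:R / d <= c by rewrite /c le_max lexx orbT.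
have c0 : 0 < c by lra.
exists (B * c ^+ k.+1) => x x1.
have y0 : 0 <= x * d / k.+1%:R by rewrite divr_ge0 // mulr_ge0 // ?ltW //; lra.
have h1 : 1 + x <= c * expR (x * d / k.+1%:R).
  apply: (@le_trans _ _ (c * (1 + x * d / k.+1%:R))).
    rewrite mulrDr mulr1 lerD //.
    have xE : x = k.+1%:R / d * (x * d / k.+1%:R) by field; rewrite !gt_eqF.
    by rewrite [X in X <= _]xE ler_wpM2r.
  by rewrite ler_pM2l // expR_ge1Dx.
have h2 : (1 + x) ^+ k.+1 <= c ^+ k.+1 * expR (x * d).
  have -> : expR (x * d) = expR (x * d / k.+1%:R) ^+ k.+1.
    by rewrite -expRM_natr divfK // pnatr_eq0.
  by rewrite -exprMn lerXn2r ?nnegrE ?mulr_ge0 ?expR_ge0 //; lra.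
have h3 : (1 + x) ^+ k <= (1 + x) ^+ k.+1.
  by rewrite exprS ler_peMl ?exprn_ge0 //; lra.
apply: (le_trans (ler_pM (normc_ge0 _) _ (hF x x1) (le_trans h3 h2))).
  by rewrite exprn_ge0 //; lra.
have -> : B * expR (- (x * d)) * (c ^+ k.+1 * expR (x * d)) =
  B * c ^+ k.+1 * (expR (- (x * d)) * expR (x * d)) by ring.
by rewrite -expRD addNr expR0 mulr1.
Qed.

Lemma rapid_scale F (mu : C) : rapid F -> rapid (fun x => (x%:C + mu) * F x).
Proof.
move=> hF k; have [B hB] := hF k.+1; exists ((1 + normc mu) * B) => x x1.
rewrite normcM.
have h : normc (x%:C + mu) <= (1 + normc mu) * (1 + x).
  apply: (le_trans (normcD _ _)); rewrite normcR ger0_norm; last by lra.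
  have := normc_ge0 mu => m0; have : 0 <= normc mu * x by rewrite mulr_ge0 //; lra.
  lra.
apply: (@le_trans _ _ ((1 + normc mu) * (1 + x) * normc (F x) * (1 + x) ^+ k)).
  rewrite ler_wpM2r ?exprn_ge0 //; first by lra.
  by rewrite ler_wpM2r ?normc_ge0.
have -> : (1 + normc mu) * (1 + x) * normc (F x) * (1 + x) ^+ k =
   (1 + normc mu) * (normc (F x) * (1 + x) ^+ k.+1) by rewrite exprS; ring.
by rewrite ler_wpM2l ?hB // addr_ge0 ?normc_ge0.
Qed.

Lemma real_add_neq0 (x : R) (mu : C) : 1 <= x -> 0 < Re mu -> x%:C + mu != 0.
Proof.
move=> x1 m0; apply/eqP => /(congr1 (@complex.Re R)) /eqP.
by rewrite ReD /= gt_eqF // addr_gt0 //; lra.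
Qed.

Lemma normc_real_add (x : R) (mu : C) : 1 <= x -> 0 < Re mu -> x <= normc (x%:C + mu).
Proof.
move=> x1 m0; apply: le_trans (normc_ge_Re _); rewrite ReD /=.
by apply: le_trans (ler_norm _); rewrite lerDl ltW.
Qed.

(* Multiplying a rapidly decreasing sum of simple fractions by x + m0 removes one pole and
   leaves a constant, which must vanish. *)
Lemma partial_fractions_rapid s (g : C -> C) : uniq s -> (forall m, m \in s -> 0 < Re m) ->
  rapid (fun x => \sum_(m <- s) g m / (x%:C + m)) -> forall m, m \in s -> g m = 0.
Proof.
elim: s g => [//|m0 s IH] g /= /andP[m0s us] hs hr.
have m00 : 0 < Re m0 by apply: hs; rewrite mem_head.
have hs' m : m \in s -> 0 < Re m by move=> ms; apply: hs; rewrite inE ms orbT.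
pose G := \sum_(m <- m0 :: s) g m.
pose g' m := g m * (m0 - m).
have key x : 1 <= x -> (x%:C + m0) * (\sum_(m <- m0 :: s) g m / (x%:C + m)) =
    G + \sum_(m <- s) g' m / (x%:C + m).
  move=> x1; rewrite /G !big_cons mulrDr mulrC divfK ?real_add_neq0 //.
  rewrite -addrA; congr (_ + _); rewrite mulr_sumr -big_split /=.
  apply: eq_big_seq => m /hs' m_0; rewrite /g'.
  by field; rewrite real_add_neq0.
have hr1 := rapid_scale m0 hr.
have hG : G = 0.
  have [B hB] := hr1 1%N.
  pose K := \sum_(m <- s) normc (g' m).
  have K0 : 0 <= K by apply: sumr_ge0 => m _; exact: normc_ge0.
  have small x : 1 <= x -> normc G * x <= B + K.
    move=> x1; have x0 : 0 < x by lra.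
    have -> : G = (x%:C + m0) * (\sum_(m <- m0 :: s) g m / (x%:C + m)) -
        \sum_(m <- s) g' m / (x%:C + m) by rewrite key //; ring.
    have h1 := hB x x1; rewrite expr1 in h1.
    have h2 : normc (\sum_(m <- s) g' m / (x%:C + m)) * x <= K.
      rewrite -ler_pdivlMr //; apply: (le_trans (normc_sum _ _ _)).
      rewrite mulr_suml big_seq_cond [X in _ <= X]big_seq_cond.
      apply: ler_sum => m /andP[/hs' m_0 _]; rewrite normcf_div ler_wpM2l ?normc_ge0 //.
      by rewrite lef_pV2 ?posrE ?normc_real_add // normc_gt0 real_add_neq0.
    apply: (@le_trans _ _ ((normc ((x%:C + m0) * (\sum_(m <- m0 :: s) g m / (x%:C + m))) +
        normc (\sum_(m <- s) g' m / (x%:C + m))) * x)).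
      by rewrite ler_wpM2r ?normc_leB // ltW.
    rewrite mulrDl lerD //; apply: le_trans h1; rewrite ler_wpM2l ?normc_ge0 //; lra.
  apply/eqP; rewrite -normc_eq0 eq_le normc_ge0 andbT leNgt; apply/negP => G0.
  have := small (Num.max 1 ((B + K + 1) / normc G)) _.
  rewrite le_max lexx /= => /(_ isT).
  have : (B + K + 1) / normc G <= Num.max 1 ((B + K + 1) / normc G) by rewrite le_max lexx orbT.
  rewrite ler_pdivrMr // mulrC; lra.
have hr2 : rapid (fun x => \sum_(m <- s) g' m / (x%:C + m)).
  move=> k; have [B hB] := hr1 k; exists B => x x1.
  by have := hB x x1; rewrite key // hG add0r.
have hg m : m \in s -> g m = 0.
  move=> ms; have := IH g' us hs' hr2 m ms => /eqP; rewrite mulf_eq0 subr_eq0.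
  by case/predU1P => // /eqP h; move: m0s; rewrite h ms.
move=> m; rewrite inE => /predU1P[->|]; last exact: hg.
by move: hG; rewrite /G big_cons big_seq big1 ?addr0.
Qed.

End CauchyDecay.

(** * Quadratic forms indexed by finite families *)

Section FiniteFamilies.
Variable R : realType.
Local Notation C := R[i].
Local Notation "x ^*" := (conjc x) : ring_scope.

Lemma psd_mxP n (M : 'M[C]_n) :
  (forall c : 'I_n -> C, 0 <= \sum_i \sum_j (c i)^* * c j * M i j) -> psd_mx M.
Proof.
move=> h v; have := h (fun i => v i 0); congr (0 <= _).
rewrite mxE exchange_big /=; apply: eq_bigr => j _.
rewrite mxE mulr_suml; apply: eq_bigr => i _; rewrite !mxE.
by rewrite mulrAC.
Qed.

Lemma extend_family n (lam c : 'I_n -> C) : injective lam ->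
  exists v : C -> C, forall i, v (lam i) = c i.
Proof.
move=> lam_inj; exists (fun x => if [pick i | lam i == x] is Some i then c i else 0) => i.
case: pickP => [j /eqP /lam_inj -> //|/(_ i)]; by rewrite eqxx.
Qed.

Lemma pick_form_family n (lam c : 'I_n -> C) (f v : C -> C) :
  (forall i, v (lam i) = c i) ->
  \sum_i \sum_j (c i)^* * c j * ((1 - (f (lam i))^* * f (lam j)) / ((lam i)^* + lam j)) =
  pick_form f [seq lam i | i <- index_enum 'I_n] v.
Proof.
move=> hv; rewrite /pick_form big_map; apply: eq_bigr => i _.
by rewrite big_map; apply: eq_bigr => j _; rewrite !hv.
Qed.

(* Otherwise the Pick form at x :: s would become negative along t delta_x + v, t small. *)
Lemma pick_form_null s (x : C) (f v : C -> C) :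
  (forall z, 0 < Re z -> cdiff f z) -> (forall z, 0 < Re z -> normc (f z) <= 1) ->
  uniq (x :: s) -> (forall y, y \in x :: s -> 0 < Re y) -> pick_form f s v = 0 ->
  \sum_(y <- s) v y * ((1 - (f x)^* * f y) / (x^* + y)) = 0.
Proof.
move=> cf bf us hs Q0; have := us => /= /andP[xs _].
set T := \sum_(y <- s) _.
pose K := (1 - (f x)^* * f x) / (x^* + x).
have form (t : C) : 0 <= t^* * t * K + (t^* * T + (t^* * T)^*).
  pose V z := if z == x then t else v z.
  have Vs y : y \in s -> V y = v y.
    by rewrite /V; case: eqP => // ->; rewrite (negbTE xs).
  have Vx : V x = t by rewrite /V eqxx.
  have := pick_form_ge0_unit V cf bf us hs; congr (0 <= _).
  rewrite /pick_form big_cons big_cons Vx -addrA; congr (_ + _).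
  have -> : \sum_(y <- s) t^* * V y * ((1 - (f x)^* * f y) / (x^* + y)) = t^* * T.
    by rewrite /T mulr_sumr; apply: eq_big_seq => y /Vs ->; rewrite mulrA.
  congr (_ + _).
  have -> : \sum_(y <- s) \sum_(z <- x :: s) (V y)^* * V z * ((1 - (f y)^* * f z) / (y^* + z)) =
     \sum_(y <- s) (v y)^* * t * ((1 - (f y)^* * f x) / (y^* + x)) + pick_form f s v.
    rewrite /pick_form -big_split /=; apply: eq_big_seq => y ys; rewrite big_cons Vs // Vx.
    by congr (_ + _); apply: eq_big_seq => z /Vs ->.
  rewrite Q0 addr0 conjcM conjcK /T conjc_sum mulr_sumr; apply: eq_bigr => y _.
  rewrite conjcM conjcf_div conjcB conjc1 conjcM conjcD !conjcK.
  by rewrite (addrC x) (mulrC (f x)); ring.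
have x0 : 0 < Re x by apply: hs; rewrite mem_head.
pose k := (1 - normc (f x) ^+ 2) / (2 * Re x).
have KE : K = k%:C.
  rewrite /K /k mulcJ (addrC x^*) addcJ -[2](rmorph_nat (real_complex R)).
  rewrite -(rmorphM (real_complex R)) -(rmorph1 (real_complex R)) -(rmorphB (real_complex R)).
  by rewrite -(fmorph_div (real_complex R)).
have k0 : 0 <= k.
  rewrite divr_ge0 ?mulr_ge0 ?(ltW x0) // subr_ge0 expr_le1 ?normc_ge0 //.
  exact: bf.
have k1 : 0 < k + 1 by rewrite ltr_wpDl.
(* For t = - eta T the form is (eta^2 k - 2 eta) |T|^2, and eta k < 1 makes the coefficient
   negative, which forces T = 0. *)
pose eta := (k + 1)^-1; have eta0 : 0 < eta by rewrite invr_gt0.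
have := form (- (eta%:C * T)).
have -> : (- (eta%:C * T))^* * - (eta%:C * T) * K +
   ((- (eta%:C * T))^* * T + ((- (eta%:C * T))^* * T)^*) =
   ((eta ^+ 2 * k - 2 * eta) * normc T ^+ 2)%:C.
  have -> : ((eta ^+ 2 * k - 2 * eta) * normc T ^+ 2)%:C =
      (eta%:C ^+ 2 * k%:C - 2 * eta%:C) * (T^* * T).
    rewrite mulcJ -(rmorphXn (real_complex R)).
    have -> : (2 : C) = (2 : R)%:C by rewrite (rmorph_nat (real_complex R)).
    by rewrite -!(rmorphM (real_complex R)) -(rmorphB (real_complex R)) -(rmorphM (real_complex R)).
  have -> : (- (eta%:C * T))^* = - (eta%:C * T^*).
    by rewrite (rmorphN conjc) /= conjcM conjc_real.
  rewrite KE (conjcM (- (eta%:C * T^*))) (rmorphN conjc) /= conjcM conjcK conjc_real.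
  ring.
rewrite lecR => h.
have : (eta ^+ 2 * k - 2 * eta) < 0.
  have -> : eta ^+ 2 * k - 2 * eta = eta * (eta * k - 2) by ring.
  rewrite pmulr_rlt0 // subr_lt0 mulrC ltr_pdivrMr //; lra.
move=> neg; have h' : normc T ^+ 2 <= 0 by rewrite -(nmulr_rge0 _ neg).
by apply/eqP; rewrite -normc_eq0 -sqrf_eq0 eq_le h' sqr_ge0.
Qed.

End FiniteFamilies.

(** * Positivity for the zeta kernel and nondegeneracy of the Pick matrix *)

Section ZetaPick.
Variable R : realType.
Local Notation C := R[i].
Local Notation "x ^*" := (conjc x) : ring_scope.
Variables (phi : C -> C) (a : nat -> C) (sigma : R).
Hypothesis phi_diff : forall z, 0 < Re z -> cdiff phi z.
Hypothesis phi_le1 : forall z, 0 < Re z -> normc (phi z) <= 1.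
Hypothesis phi_series : forall s : C, sigma < Re s ->
  series (fun k : nat => (a k.+1 * nat_cpowN k.+1 s : R[i]^o)) @ \oo --> (phi s : R[i]^o).
Variables (n : nat) (lam : 'I_n -> C).
Hypothesis lam_half : forall i, 1 / 2 < Re (lam i).

Lemma gram_zeta (c : 'I_n -> C) N :
  (\sum_(0 <= m < N) normc (\sum_i c i * nat_cpowN m.+1 (lam i)) ^+ 2)%:C =
  \sum_i \sum_j (c i)^* * c j * \sum_(0 <= m < N) nat_cpowN m.+1 ((lam i)^* + lam j).
Proof.
rewrite (rmorph_sum (real_complex R)) /=.
under [RHS]eq_bigr => i _ do
  (under eq_bigr => j _ do rewrite mulr_sumr; rewrite exchange_big /=).
rewrite exchange_big /=; apply: eq_bigr => m _; rewrite -mulcJ conjc_sum mulr_suml.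
apply: eq_bigr => i _; rewrite mulr_sumr; apply: eq_bigr => j _.
by rewrite nat_cpowN_add conjcM nat_cpowN_conj; ring.
Qed.

Lemma gram_zeta_clim (c : 'I_n -> C) :
  clim (fun N => (\sum_(0 <= m < N) normc (\sum_i c i * nat_cpowN m.+1 (lam i)) ^+ 2)%:C)
    (\sum_i \sum_j (c i)^* * c j * zeta ((lam i)^* + lam j)).
Proof.
have -> : (fun N => (\sum_(0 <= m < N) normc (\sum_i c i * nat_cpowN m.+1 (lam i)) ^+ 2)%:C) =
  (fun N => \sum_i \sum_j (c i)^* * c j * \sum_(0 <= m < N) nat_cpowN m.+1 ((lam i)^* + lam j)).
  by apply/funext => N; exact: gram_zeta.
apply: clim_sum => i; apply: clim_sum => j; apply: climM; first exact: clim_cst.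
apply: zeta_clim; rewrite ReD Re_conjc; have := lam_half i; have := lam_half j; lra.
Qed.

(** Since p^-s = k^-s m^-s for p = k m, the adjoint acts on p^-lam almost as on an eigenvector.
    Truncating at k m <= N leaves k <= N / m, hence a partial sum of [phi] in place of its value. *)
Lemma adjoint_kernel (c : 'I_n -> C) (N m : nat) : (m < N)%N ->
  \sum_(0 <= k < N) \sum_(0 <= p < N | (k.+1 * m.+1 == p.+1)%N)
     a k.+1 * (\sum_i c i * nat_cpowN p.+1 (lam i)) =
  \sum_i c i * nat_cpowN m.+1 (lam i) * dpart a (N %/ m.+1) (lam i).
Proof.
move=> mN.
have inner k : \sum_(0 <= p < N | (k.+1 * m.+1 == p.+1)%N)
     a k.+1 * (\sum_i c i * nat_cpowN p.+1 (lam i)) =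
   if (k < N %/ m.+1)%N then
     \sum_i c i * nat_cpowN m.+1 (lam i) * (a k.+1 * nat_cpowN k.+1 (lam i)) else 0.
  have [r rE] : exists r, (k.+1 * m.+1)%N = r.+1.
    by exists (k.+1 * m.+1).-1; rewrite prednK // muln_gt0.
  rewrite leq_divRL // rE; case: ifP => rN; last first.
    rewrite big1_seq // => p /andP[/eqP pE]; rewrite mem_index_iota => /andP[_ pN].
    by move: rN; rewrite pE pN.
  rewrite big_mkcond (bigD1_seq r) ?mem_index_iota ?iota_uniq //= eqxx.
  rewrite [X in _ + X]big1_seq ?addr0; last first.
    by move=> p /andP[pr _]; rewrite eqSS eq_sym (negbTE pr).
  rewrite -rE mulr_sumr; apply: eq_bigr => i _; rewrite nat_cpowNM //; ring.
rewrite (eq_bigr _ (fun k _ => inner k)) -big_mkcond /=.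
have -> : \sum_(0 <= k < N | (k < N %/ m.+1)%N)
     \sum_i c i * nat_cpowN m.+1 (lam i) * (a k.+1 * nat_cpowN k.+1 (lam i)) =
   \sum_(0 <= k < N %/ m.+1)
     \sum_i c i * nat_cpowN m.+1 (lam i) * (a k.+1 * nat_cpowN k.+1 (lam i)).
  by rewrite [RHS](big_nat_widen _ _ N) ?leq_div.
rewrite exchange_big /=; apply: eq_bigr => i _.
by rewrite /dpart mulr_sumr.
Qed.

Lemma zeta_pick_ge0 (c : 'I_n -> C) :
  0 <= \sum_i \sum_j (c i)^* * c j *
    ((1 - (phi (lam i))^* * phi (lam j)) * zeta ((lam i)^* + lam j)).
Proof.
pose A := \sum_i \sum_j (c i)^* * c j * zeta ((lam i)^* + lam j).
pose c' i := c i * phi (lam i).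
pose B := \sum_i \sum_j (c' i)^* * c' j * zeta ((lam i)^* + lam j).
have -> : \sum_i \sum_j (c i)^* * c j *
    ((1 - (phi (lam i))^* * phi (lam j)) * zeta ((lam i)^* + lam j)) = A - B.
  rewrite /A /B -sumrB; apply: eq_bigr => i _; rewrite -sumrB; apply: eq_bigr => j _.
  by rewrite /c' conjcM; ring.
have hA := gram_zeta_clim c; have hB := gram_zeta_clim c'; rewrite -/A -/B in hA hB.
set U := fun N => \sum_(0 <= m < N) normc (\sum_i c i * nat_cpowN m.+1 (lam i)) ^+ 2 in hA.
set W := fun N => \sum_(0 <= m < N) normc (\sum_i c' i * nat_cpowN m.+1 (lam i)) ^+ 2 in hB.
(* The limits are taken one after the other: for the first M entries N tends to infinity, so that N
   / m does too and the partial sums become [phi (lam i)]; only then does M grow. *)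
pose V M N : R := \sum_(0 <= m < M) normc
  (\sum_i c i * nat_cpowN m.+1 (lam i) * dpart a (N %/ m.+1) (lam i)) ^+ 2.
have VU M N : (M <= N)%N -> V M N <= U N.
  move=> MN; apply: le_trans (adjoint_bound phi_diff phi_le1 phi_series N
     (fun p => \sum_i c i * nat_cpowN p.+1 (lam i))).
  rewrite (big_cat_nat (n := M) (p := N)) //=.
  apply: (@le_trans _ _ (\sum_(0 <= m < M) normc (\sum_(0 <= k < N)
      \sum_(0 <= p < N | (k.+1 * m.+1 == p.+1)%N)
        a k.+1 * (\sum_i c i * nat_cpowN p.+1 (lam i))) ^+ 2)).
    rewrite le_eqVlt; apply/orP; left; apply/eqP; apply: eq_big_nat => m /andP[_ mM].
    by rewrite adjoint_kernel // (leq_trans mM).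
  by rewrite lerDl; apply: sumr_ge0 => m _; exact: sqr_ge0.
have Vlim M : clim (fun N => (V M N)%:C) (W M)%:C.
  have -> : (fun N => (V M N)%:C) = (fun N => \sum_(0 <= m < M)
     ((\sum_i c i * nat_cpowN m.+1 (lam i) * dpart a (N %/ m.+1) (lam i))^* *
      (\sum_i c i * nat_cpowN m.+1 (lam i) * dpart a (N %/ m.+1) (lam i)))).
    apply/funext => N; rewrite /V (rmorph_sum (real_complex R)) /=.
    by apply: eq_bigr => m _; rewrite mulcJ.
  have -> : (W M)%:C = \sum_(0 <= m < M)
     ((\sum_i c i * nat_cpowN m.+1 (lam i) * phi (lam i))^* *
      (\sum_i c i * nat_cpowN m.+1 (lam i) * phi (lam i))).
    rewrite /W (rmorph_sum (real_complex R)) /=; apply: eq_bigr => m _; rewrite mulcJ.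
    by congr ((normc _ ^+ 2)%:C); apply: eq_bigr => i _; rewrite /c'; ring.
  apply: clim_sum => m.
  have L : clim (fun N => \sum_i c i * nat_cpowN m.+1 (lam i) * dpart a (N %/ m.+1) (lam i))
      (\sum_i c i * nat_cpowN m.+1 (lam i) * phi (lam i)).
    apply: clim_sum => i; apply: climM; first exact: clim_cst.
    move=> e e0; have [K0 hK] := dpart_converges phi_diff phi_le1 phi_series (lam_half i) e0.
    exists (K0 * m.+1)%N => N hN; apply: hK; by rewrite leq_divRL.
  by apply: climM => //; exact: clim_conj.
have WA M : W M <= Re A by exact: (clim_le (M := M) (Vlim M) hA (VU M)).
have BA : Re B <= Re A.
  exact: (clim_le (M := 0) hB (clim_cst (Re A)%:C) (fun N _ => WA N)).
by rewrite ge0c ImB ReB (clim_real hA) (clim_real hB) subrr eqxx subr_ge0 BA.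
Qed.

Hypothesis lam_inj : injective lam.
Hypothesis phi_lt1 : forall i, normc (phi (lam i)) < 1.

Lemma dpart1 z : dpart a 1 z = a 1.
Proof. by rewrite /dpart big_nat1 nat_cpowNE ln1 oppr0 mul0r cexp0 mulr1. Qed.

Lemma pick_nondegenerate (c : 'I_n -> C) :
  (forall j, \sum_i (c i)^* * ((1 - (phi (lam i))^* * phi (lam j)) / ((lam i)^* + lam j)) = 0) ->
  forall i, c i = 0.
Proof.
move=> hc; have lam0 i : 0 < Re (lam i) by have := lam_half i; lra.
have [v hv] := extend_family c lam_inj.
pose s := [seq lam i | i <- index_enum 'I_n].
have us : uniq s by rewrite map_inj_uniq ?index_enum_uniq.
have Q0 : pick_form phi s v = 0.
  rewrite -(pick_form_family phi hv) exchange_big big1 //= => j _.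
  rewrite (eq_bigr (fun i => c j * ((c i)^* *
    ((1 - (phi (lam i))^* * phi (lam j)) / ((lam i)^* + lam j))))).
    by rewrite -mulr_sumr hc mulr0.
  by move=> i _; ring.
have [s1 s10 /(_ 1%N)[B B0 hB]] := dpart_tail phi_series.
(* Any real x >= X0 exceeds all |lam i|, hence is a new node, and lies in the region of
   [dpart_tail]. *)
pose X0 := 1 + s1 + \sum_i normc (lam i).
have lamX i : normc (lam i) <= \sum_i normc (lam i).
  by rewrite (bigD1 i) //= lerDl sumr_ge0 // => j _; exact: normc_ge0.
have S0 : 0 <= \sum_i normc (lam i) by apply: sumr_ge0 => j _; exact: normc_ge0.
have X01 : 1 <= X0 by rewrite /X0; lra.
have null (x : R) : X0 <= x ->
    \sum_i (c i)^* * ((1 - phi x%:C * (phi (lam i))^*) / (x%:C + (lam i)^*)) = 0.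
  move=> xX; have x0 : 0 < Re x%:C by rewrite /=; lra.
  have xs : x%:C \notin s.
    apply/negP => /mapP[i _ /(congr1 (@ComplexField.Normc.normc R))].
    rewrite normcR ger0_norm; last by rewrite /= in x0; exact: ltW.
    by have := lamX i; rewrite /X0 in xX; lra.
  have := @pick_form_null _ s x%:C phi v phi_diff phi_le1 _ _ Q0.
  rewrite /= xs us => /(_ isT) h.
  have {h} := h _; rewrite big_map => h.
  have {h} : \sum_i v (lam i) * ((1 - (phi x%:C)^* * phi (lam i)) / (x%:C^* + lam i)) = 0.
    by apply: h => y; rewrite inE => /predU1P[->//|/mapP[i _ ->]].
  move=> /(congr1 (@conjc _)); rewrite conjc0 conjc_sum => h; rewrite -[RHS]h.
  apply: eq_bigr => i _; rewrite hv conjcM conjcf_div conjcB conjc1 conjcM conjcD !conjcK //.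
(* With x = y + X0 the poles become -mu i and the estimate holds for all y >= 1, as [rapid]
   requires. The rate ln 2 below comes from the first term after a_1, which is a multiple of
   2^-x. *)
pose mu i := (lam i)^* + X0%:C.
have mu_inj : injective mu.
  by move=> i j /addIr /(congr1 (@conjc _)); rewrite !conjcK => /lam_inj.
have mu0 i : 0 < Re (mu i) by rewrite ReD Re_conjc /=; have := lam0 i; lra.
pose g i := (c i)^* * (1 - a 1 * (phi (lam i))^*).
have [G hG] := extend_family g mu_inj.
have rap : rapid (fun y => \sum_(m <- [seq mu i | i <- index_enum 'I_n]) G m / (y%:C + m)).
  apply: (@rapid_expR _ _ ((\sum_i normc (c i)) * B) (ln 2)).
  - by rewrite ln_gt0 // ltr1n.
  - by rewrite mulr_ge0 // sumr_ge0 // => i _; exact: normc_ge0.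
  move=> y y1; rewrite big_map.
  have xX : X0 <= y + X0 by lra.
  have -> : \sum_i G (mu i) / (y%:C + mu i) =
     \sum_i (c i)^* * ((phi (y + X0)%:C - a 1) * (phi (lam i))^*) / (y%:C + mu i).
    apply/eqP; rewrite -subr_eq0 -sumrB; apply/eqP; apply: etrans (null _ xX).
    apply: eq_bigr => i _.
    have -> : (y + X0)%:C + (lam i)^* = y%:C + mu i.
      by rewrite /mu (rmorphD (real_complex R)) /=; ring.
    by rewrite hG /g; ring.
  apply: (le_trans (normc_sum _ _ _)).
  rewrite -mulrA mulr_suml; apply: ler_sum => i _.
  rewrite normcf_div !normcM !normc_conj -mulrA ler_wpM2l ?normc_ge0 //.
  have d1 : 1 <= normc (y%:C + mu i) := le_trans y1 (normc_real_add y1 (mu0 i)).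
  have d0 : 0 < normc (y%:C + mu i) by lra.
  rewrite ler_pdivrMr //.
  have h1 : normc (phi (y + X0)%:C - a 1) <= B * expR (- (y * ln 2)).
    have s1y : s1 <= Re (y + X0)%:C by rewrite /= /X0; lra.
    have := hB _ s1y; rewrite dpart1 /= => /le_trans; apply.
    rewrite ler_wpM2l // ler_expR lerN2 ler_wpM2r ?ln_nat_ge0 //; lra.
  have h2 : normc (phi (y + X0)%:C - a 1) * normc (phi (lam i)) <= B * expR (- (y * ln 2)) * 1.
    by apply: ler_pM; rewrite ?normc_ge0 // ltW.
  apply: (le_trans h2); apply: ler_pM; rewrite ?mulr_ge0 ?expR_ge0 //.
have umu : uniq [seq mu i | i <- index_enum 'I_n] by rewrite map_inj_uniq ?index_enum_uniq.
have gz i : g i = 0.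
  rewrite -hG; apply: (partial_fractions_rapid umu _ rap).
    by move=> m /mapP[j _ ->].
  by apply/mapP; exists i; rewrite ?mem_index_enum.
(* Together with |phi (lam i)| < 1 this makes the factor 1 - a_1 conj (phi (lam i)) nonzero, so g i
   = 0 gives c i = 0. *)
have a1 : normc (a 1) <= 1.
  by have := coef_abs_sum phi_diff phi_le1 phi_series 1; rewrite big_nat1 sqrtr1.
move=> i; have := gz i => /eqP; rewrite mulf_eq0 conjc_eq0 => /predU1P[//|].
rewrite subr_eq0 => /eqP /(congr1 (@ComplexField.Normc.normc R)).
rewrite ComplexField.Normc.normc1 normcM normc_conj => h.
have : normc (a 1) * normc (phi (lam i)) <= 1 * normc (phi (lam i)).
  by rewrite ler_wpM2r ?normc_ge0.
by rewrite -h mul1r leNgt phi_lt1.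
Qed.

End ZetaPick.

Unset Implicit Arguments.
Local Close Scope classical_set_scope.

Theorem theorem2p1 (R : realType) (n : nat) (lam w : 'I_n -> R[i])
  (lam_inj : injective lam)
  (lam_H : forall j, halfplane (1 / 2) (lam j))
  (w_D : forall j, `|w j| < 1)
  (phi_ex : exists phi : R[i] -> R[i],
      [/\ Hinf_unit_ball phi, dirichlet_rep phi & forall j, phi (lam j) = w j]) :
  psd_mx (\matrix_(i, j) ((1 - (w i)^* * w j) * zeta ((lam i)^* + lam j)))
  /\
  (psd_mx (\matrix_(i, j) ((1 - (w i)^* * w j) / ((lam i)^* + lam j)))
   /\ \rank (\matrix_(i, j) ((1 - (w i)^* * w j) / ((lam i)^* + lam j))) = n).
Proof.
have [phi [[phi_hol phi_bd] [a [sigma phi_ser]] phi_w]] := phi_ex.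
have phi_diff z : 0 < Re z -> cdiff phi z by move=> z0; split; exact: phi_hol.
have phi_le1 z : 0 < Re z -> normc (phi z) <= 1.
  by move=> z0; have := phi_bd z z0; rewrite normE lecR.
have lam_half i : 1 / 2 < Re (lam i) by exact: lam_H.
have lam0 i : 0 < Re (lam i) by have := lam_half i; lra.
have phi_lt1 i : normc (phi (lam i)) < 1 by have := w_D i; rewrite phi_w normE ltcR.
split.
  apply: psd_mxP => c.
  have := zeta_pick_ge0 phi_diff phi_le1 phi_ser lam_half c; congr (0 <= _).
  by apply: eq_bigr => i _; apply: eq_bigr => j _; rewrite mxE !phi_w.
split.
  apply: psd_mxP => c; have [v hv] := extend_family c lam_inj.
  have := @pick_form_ge0_unit _ [seq lam i | i <- index_enum 'I_n] phi v phi_diff phi_le1.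
  rewrite map_inj_uniq ?index_enum_uniq // => /(_ isT) h.
  have {h} : 0 <= pick_form phi [seq lam i | i <- index_enum 'I_n] v.
    by apply: h => x /mapP[i _ ->].
  rewrite -(pick_form_family phi hv); congr (0 <= _).
  by apply: eq_bigr => i _; apply: eq_bigr => j _; rewrite mxE !phi_w.
apply/eqP; rewrite -/(row_free _) -kermx_eq0; apply/rowV0P => u /sub_kermxP uM.
apply/rowP => i; rewrite mxE.
(* Full rank is proved through the left kernel; the coefficients enter [pick_nondegenerate]
   conjugated, hence the conjugate of u. *)
have h := @pick_nondegenerate _ _ _ _ phi_diff phi_le1 phi_ser _ _ lam_half lam_inj phi_lt1
  (fun i => conjc (u 0 i)).
apply/eqP; rewrite -conjc_eq0; apply/eqP; apply: (h _ i) => j.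
have e := congr1 (fun A : 'rV_n => A 0 j) uM; rewrite !mxE in e; apply: etrans e.
by apply: eq_bigr => k _; rewrite mxE !phi_w conjcK.
Qed.
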